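(* Consider observations $Y=(Y_1,Y_2,\dots)$ with $Y_i=\kappa_i\mu_{0,i}+n^{-1/2}Z_i$, $Z_i$ i.i.d. standard normal, $\mu_0\in\ell_2$, and known $(\kappa_i)$ with $C^{-1}i^{-p}\le\kappa_i\le Ci^{-p}$ for some $p\ge0,C\ge1$. For $\alpha\ge0$ let \[ \Pi_\alpha(\cdot\mid Y)=\bigotimes_{i=1}^\infty N\Big(\frac{n\kappa_i^{-1}}{i^{1+2\alpha}\kappa_i^{-2}+n}Y_i,\ \frac{\kappa_i^{-2}}{i^{1+2\alpha}\kappa_i^{-2}+n}\Big), \] which is the posterior distribution of $\mu$ under the prior $\Pi_\alpha=\bigotimes_{i}N(0,i^{-1-2\alpha})$, let \[ \ell_n(\alpha)=-\frac12\sum_{i=1}^\infty\Big(\log\Big(1+\frac{n}{i^{1+2\alpha}\kappa_i^{-2}}\Big)-\frac{n^2}{i^{1+2\alpha}\kappa_i^{-2}+n}Y_i^2\Big), \] let $\hat\alpha_n\in\operatorname*{argmax}_{\alpha\in[0,\log n]}\ell_n(\alpha)$ (any maximizer), and let the empirical Bayes posterior be $\Pi_{\hat\alpha_n}(B\mid Y)=\Pi_\alpha(B\mid Y)|_{\alpha=\hat\alpha_n}$. Then for every $\beta,\gamma,R>0$ and every sequence $M_n\to\infty$, \[ \sup_{\|\mu_0\|_\beta\le R}\mathrm{E}_0\,\Pi_{\hat\alpha_n}\big(\|\mu-\mu_0\|\ge M_nL_n n^{-\beta/(1+2\beta+2p)}\mid Y\big)\to0 \] and \[ \sup_{\|\mu_0\|_{A^\gamma}\le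 R}\mathrm{E}_0\,\Pi_{\hat\alpha_n}\big(\|\mu-\mu_0\|\ge M_nL_n(\log n)^{1/2+p}n^{-1/2}\mid Y\big)\to0, \] where $(L_n)$ is a slowly varying sequence.
   Context: $\mathrm{E}_0$ is expectation under the law of $Y$ with true parameter $\mu_0$. $\|\cdot\|$ is the $\ell_2$-norm; $\|\mu\|_\beta^2=\sum_i i^{2\beta}\mu_i^2$; $\|\mu\|_{A^\gamma}^2=\sum_i e^{2\gamma i}\mu_i^2$. A slowly varying sequence here means one that tends to infinity (if at all) slower than any positive power of $n$. *)

(* Defs.v *)
From HB Require Import structures.
From mathcomp Require Import all_boot all_order all_algebra.
From mathcomp Require Import all_classical all_reals all_analysis.
Set Implicit Arguments. Unset Strict Implicit. Unset Printing Implicit Defensive.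
Import Order.TTheory GRing.Theory Num.Theory.
Import numFieldNormedType.Exports.
Local Open Scope classical_set_scope.
Local Open Scope ring_scope.

(* Sequences x : nat -> R; only the coordinates i >= 1 are meaningful
   (the paper indexes by i = 1, 2, ...); coordinate 0 is ignored everywhere. *)

Definition iid_std_normal {d} {T : measurableType d} {R : realType}
    (P : probability T R) (Z : nat -> T -> R) : Prop :=
  [/\ (forall i, measurable_fun setT (Z i)),
      (forall i (A : set R), measurable A ->
          P (Z i @^-1` A) = normal_prob 0 1 A) &
      (forall (s : seq nat) (B : nat -> set R), uniq s ->
          (forall i, measurable (B i)) ->
          P (\bigcap_(i in [set` s]) (Z i @^-1` B i)) =
          (\prod_(i <- s) P (Z i @^-1` B i))%E)].

Definition sqnorm {R : realType} (x : nat -> R) : \bar R :=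
  (\sum_(1 <= i <oo) ((x i) ^+ 2)%:E)%E.

Definition norm_ge {R : realType} (x : nat -> R) (r : R) : Prop :=
  r <= 0 \/ ((r ^+ 2)%:E <= sqnorm x)%E.

Definition sob_sqnorm {R : realType} (beta : R) (x : nat -> R) : \bar R :=
  (\sum_(1 <= i <oo) ((i%:R `^ (2 * beta)) * (x i) ^+ 2)%:E)%E.

Definition ana_sqnorm {R : realType} (gamma : R) (x : nat -> R) : \bar R :=
  (\sum_(1 <= i <oo) (expR (2 * gamma * i%:R) * (x i) ^+ 2)%:E)%E.

Definition tcoef {R : realType} (kappa : nat -> R) (alpha : R) (i : nat) : R :=
  (i%:R `^ (1 + 2 * alpha)) * (kappa i) ^- 2.

Definition post_mean {R : realType} (kappa : nat -> R) (n : nat) (alpha : R)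
    (y : nat -> R) (i : nat) : R :=
  n%:R * (kappa i)^-1 / (tcoef kappa alpha i + n%:R) * y i.
Definition post_var {R : realType} (kappa : nat -> R) (n : nat) (alpha : R)
    (i : nat) : R :=
  (kappa i) ^- 2 / (tcoef kappa alpha i + n%:R).

(* Posterior probability Pi_alpha(||mu - mu0|| >= r | Y = y): realised on a
   probability space (T', Q) carrying i.i.d. N(0,1) variables W, via
   mu_i = post_mean_i + sqrt(post_var_i) W_i (i >= 1). *)
Definition post_prob {d'} {T' : measurableType d'} {R : realType}
    (Q : probability T' R) (W : nat -> T' -> R) (kappa : nat -> R) (n : nat)
    (alpha : R) (y : nat -> R) (mu0 : nat -> R) (r : R) : \bar R :=
  Q [set w | norm_ge (fun i => post_mean kappa n alpha y i
                         + Num.sqrt (post_var kappa n alpha i) * W i w - mu0 i) r].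

Definition loglik {R : realType} (kappa : nat -> R) (n : nat) (alpha : R)
    (y : nat -> R) : R :=
  - 2^-1 * limn (fun N : nat => \sum_(1 <= i < N)
      (ln (1 + n%:R / tcoef kappa alpha i)
       - (n%:R ^+ 2) / (tcoef kappa alpha i + n%:R) * (y i) ^+ 2)).

Definition slowly_varying {R : realType} (L : nat -> R) : Prop :=
  forall delta : R, 0 < delta ->
    (fun n : nat => L n * (n%:R `^ (- delta))) @ \oo --> (0 : R).

Definition obs {R : realType} {T : Type} (kappa : nat -> R) (Z : nat -> T -> R)
    (n : nat) (mu0 : nat -> R) (w : T) : nat -> R :=
  fun i => kappa i * mu0 i + (Num.sqrt n%:R)^-1 * Z i w.

Definition emp_bayes_selector {d} {T : measurableType d} {R : realType}
    (P : probability T R) (Z : nat -> T -> R) (kappa : nat -> R)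
    (alphahat : nat -> (nat -> R) -> R) : Prop :=
  forall (n : nat) (mu0 : nat -> R), (sqnorm mu0 < +oo)%E ->
    (measurable_fun setT (fun w => alphahat n (obs kappa Z n mu0 w))) /\
    ({ae P, forall w, (0 <= alphahat n (obs kappa Z n mu0 w) <= ln n%:R) /\
        (forall alpha, 0 <= alpha <= ln n%:R ->
          loglik kappa n alpha (obs kappa Z n mu0 w)
          <= loglik kappa n (alphahat n (obs kappa Z n mu0 w))
                (obs kappa Z n mu0 w))}).

(* Main.v *)
Require Import Defs.
From HB Require Import structures.
From mathcomp Require Import all_boot all_order all_algebra.
From mathcomp Require Import all_classical all_reals all_analysis.
From mathcomp Require Import ring lra.
From mathcomp Require Import measurable_realfun normal_distribution.
Set Implicit Arguments.
Unset Strict Implicit.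
Import Order.TTheory GRing.Theory Num.Theory.
Import numFieldNormedType.Exports.
Local Open Scope classical_set_scope.
Local Open Scope ring_scope.

(** Write [a_i(alpha)] for the shrinkage factors, [t_i] for the scaled signal
    [n^(1/2) kappa_i mu_i]. Up to a term that does not depend on [alpha], the
    criterion [-2 l_n(alpha)] is [D(alpha) - N(alpha)], where
    [D(alpha) = sum_i (log (1 + n / (i^(1+2 alpha) kappa_i^-2)) - a_i + (1 - a_i) t_i^2)]
    measures complexity plus bias and the centred noise [N(alpha)] has variance
    [O(D(alpha))]. Chebyshev's inequality on a polynomially fine grid and
    monotonicity in [alpha] between its points give the oracle inequality
    [D(alphahat) <= const (D(beta) + Delta)] on an event of large probability.
    For every [b < beta] this forces [alphahat >= alpha'] with [b < alpha' < beta],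
    which bounds the posterior spread, and it bounds the bias of the posterior
    mean, so the rate [n^(-b/(1+2b+2p))] is attained. Letting [b] increase to
    [beta] (to infinity in the analytic case, where the ball lies in every
    Sobolev ball) slowly with [n] gives [L_n = n^(1/(k_n+1))], [k_n -> oo].

    At [alpha = p = 0] the likelihood series converges only conditionally, so
    its tail has to be controlled uniformly in [alpha] through cancellation:
    the leading terms are [i^(-2 alpha) e_i] with [e_i] free of [alpha], and
    Abel summation reduces them to sums of [e_i] over the blocks
    [l^3 <= i < (l+1)^3], whose second moments are summable in [l]. *)

(** * Moments of normal variables *)

(** Giving away a small power of n lets every estimate be crude. For fixed [b < be] the exponents
    gained over [b] (in cutoff, bias and spread) are positive; with [y = n^dd], [dd] a small
    fraction of these gaps, each constant and each logarithm is eventually below [y], and the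
    bookkeeping is in powers of [y]: mesh at most [y^-3], at most [4 y^4] grid points,
    [Delta = y^6], hence a union bound of order [y^-2] and a complexity bound of at most
    [J(be) y^7]. The obstacle is that the maximizer depends on the data and may lie far above [be].
    Good events are therefore described by nonnegative variables with bounded mean that do not
    involve it. The spread decreases in [alpha], so a lower bound on the maximizer makes it
    deterministic; the bias, which increases, is read off the complexity at the grid point just
    below. The threshold in n is chosen before [mu], the selector and the radius. This yields the
    supremum over the ball and allows [L_n] to be fixed before the selector and [M_n]. *)

Lemma ge0_integral_normal_prob (R : realType) (m s : R) (f : R -> \bar R) :
  measurable_fun [set: R] f -> (forall x, 0 <= f x)%E ->
  (\int[normal_prob m s]_x f x =
   \int[lebesgue_measure]_x (f x * (normal_pdf m s x)%:E))%E.
Proof.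
move=> mf f0.
have dom : normal_prob m s `<< (@lebesgue_measure R) := normal_prob_dominates m s.
have mE := @measurableT _ (measurableTypeR R).
rewrite -(Radon_Nikodym_SigmaFinite.change_of_variables dom f0 mE mf).
apply: ae_eq_integral => //.
- apply: emeasurable_funM => //.
  exact/measurable_int/(Radon_Nikodym_SigmaFinite.f_integrable dom).
- apply: emeasurable_funM => //.
  by apply/measurable_EFinP; exact: measurable_normal_pdf.
- apply: ae_eqe_mul2l.
  apply: integral_ae_eq => //.
  + exact: (Radon_Nikodym_SigmaFinite.f_integrable dom).
  + by apply/measurable_EFinP; exact: measurable_normal_pdf.
  + by move=> E _ mE'; rewrite -Radon_Nikodym_SigmaFinite.f_integral.
Qed.

Lemma normal_probN (R : realType) (s : R) (A : set R) : s != 0 -> measurable A ->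
  normal_prob 0 s ((-%R : R -> R) @^-1` A) = normal_prob 0 s A.
Proof.
move=> s0 mA; rewrite /normal_prob.
have pdfN x : normal_pdf 0 s (- x) = normal_pdf 0 s x.
  by rewrite !normal_pdfE// /normal_fun !subr0 sqrrN.
pose phi : measurableTypeR R -> measurableTypeR R := -%R.
pose f : measurableTypeR R -> \bar R := fun x => (normal_pdf 0 s x)%:E.
have mphi : measurable_fun setT phi by exact: oppr_measurable.
transitivity (\int[lebesgue_measure]_(x in phi @^-1` A) (f \o phi) x)%E.
  by apply: eq_integral => x _; rewrite /f /= pdfN.
rewrite -ge0_integral_pushforward//=.
- by apply: eq_measure_integral => //= B mB _; exact: lebesgue_measureN.
- by apply: measurable_funTS; apply/measurable_EFinP; exact: measurable_normal_pdf.
- by move=> x _; rewrite lee_fin normal_pdf_ge0.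
Qed.

Lemma measurable_fun_exprn (R : realType) (k : nat) :
  measurable_fun [set: R] (fun x : R => (x ^+ k)%:E).
Proof. by apply/measurable_EFinP; apply: measurable_funX. Qed.

(** By symmetry of the law. Positive and negative parts are compared as integrals of nonnegative
    functions, before integrability is known. *)
Lemma normal_mean0 (R : realType) :
  (\int[normal_prob 0 1]_x (Num.max x 0)%:E =
   \int[normal_prob 0 1]_x (Num.max (- x) 0)%:E :> \bar R)%E.
Proof.
pose phi : measurableTypeR R -> measurableTypeR R := -%R.
have mphi : measurable_fun setT phi by exact: oppr_measurable.
pose f : measurableTypeR R -> \bar R := fun x => (Num.max x 0)%:E.
transitivity (\int[normal_prob 0 1]_(x in phi @^-1` setT) (f \o phi) x)%E; last first.
  by rewrite preimage_setT.
rewrite -ge0_integral_pushforward//=.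
- apply: eq_measure_integral => //= A mA _.
  by rewrite /pushforward normal_probN// oner_neq0.
- by apply/measurable_EFinP; exact: measurable_maxr.
- by move=> x _; rewrite lee_fin le_max lexx orbT.
Qed.

Lemma expR_ge_sqr (R : realType) (x : R) : 0 <= x -> x ^+ 2 / 2 <= expR x.
Proof. by move=> x0; have := expR_ge1Dxn 1 x0; rewrite /= (_ : 2`! = 2%N)//; lra. Qed.

Lemma normal_pdf_std (R : realType) (x : R) :
  normal_pdf 0 1 x = normal_peak 1 * expR (- (x ^+ 2 / 2)).
Proof.
rewrite normal_pdfE ?oner_neq0// /normal_fun subr0 expr1n.
by rewrite mulNr.
Qed.

(** Half of the Gaussian exponent is traded away: [u^2/2 <= exp u] at [u = x^2/4] gives
    [x^4 <= 32 exp (x^2/4)], which leaves the density with standard deviation [sqrt 2]. The ratio of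
    the peaks, [sqrt 2 <= 2], turns 32 into 64. *)
Lemma normal_pow4_le (R : realType) :
  (\int[normal_prob 0 1]_x (x ^+ 4)%:E <= 64%:E :> \bar R)%E.
Proof.
have x4 (x : R) : 0 <= x ^+ 4 by rewrite exprn_even_ge0.
rewrite ge0_integral_normal_prob//; last exact: measurable_fun_exprn.
have s2 : Num.sqrt 2 != 0 :> R by rewrite gt_eqF// sqrtr_gt0.
have pk : normal_peak 1 = Num.sqrt 2 * normal_peak (Num.sqrt 2) :> R.
  rewrite /normal_peak sqr_sqrtr// expr1n mul1r -mulrnAr (sqrtrM (pi *+ 2)) // invfM.
  by rewrite mulVKf.
apply: (@le_trans _ _ (\int[lebesgue_measure]_x (64%:E * (normal_pdf 0 (Num.sqrt 2) x)%:E))%E).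
  apply: ge0_le_integral => //.
  - by move=> x _; rewrite mule_ge0// lee_fin ?normal_pdf_ge0.
  - apply: emeasurable_funM; first exact: measurable_fun_exprn.
    by apply/measurable_EFinP; exact: measurable_normal_pdf.
  - apply: emeasurable_funM; first exact: measurable_cst.
    by apply/measurable_EFinP; exact: measurable_normal_pdf.
  - move=> x _; rewrite -!EFinM lee_fin normal_pdf_std normal_pdfE//.
    rewrite /normal_fun subr0 sqr_sqrtr// pk.
    set q := normal_peak _; have q0 : 0 <= q by exact: normal_peak_ge0.
    have -> : - x ^+ 2 / (2 *+ 2) = - (x ^+ 2 / 2) + x ^+ 2 / 4.
      by rewrite -mulr_natr; field.
    rewrite expRD.
    have e0 := expR_ge0 (- (x ^+ 2 / 2)).
    have x24 : 0 <= (x : R) ^+ 2 / 4 by rewrite divr_ge0// sqr_ge0.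
    have h := expR_ge_sqr x24.
    have h2 : Num.sqrt 2 <= 2 :> R.
      by rewrite -[leRHS]ger0_norm// -sqrtr_sqr ler_sqrt; lra.
    have k : Num.sqrt 2 * x ^+ 4 <= 64 * expR (x ^+ 2 / 4).
      have := ler_wpM2r (x4 x) h2; move: h; rewrite !expr_div_n -exprM /=; lra.
    by have := ler_wpM2l (mulr_ge0 q0 e0) k; lra.
rewrite ge0_integralZl//.
- by rewrite integral_normal_pdf mule1.
- by apply/measurable_EFinP; exact: measurable_normal_pdf.
- by move=> x _; rewrite lee_fin normal_pdf_ge0.
Qed.

Lemma cvg_xexpR_sqr (R : realType) :
  (x * expR (- (x ^+ 2 / 2)) : R) @[x --> +oo] --> (0 : R).
Proof.
apply: (@squeeze_cvgr _ _ _ _ (cst 0) (fun x : R => 2 * x^-1)).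
- near=> x; have x0 : 0 < x by near: x; exact: nbhs_pinfty_gt.
  rewrite mulr_ge0 ?expR_ge0 ?ltW//=.
  rewrite expRN -[2 * _]mulrC ltr_pdivrMr ?expR_gt0//.
  have h : 1 + x ^+ 2 / 2 <= expR (x ^+ 2 / 2) by exact: expR_ge1Dx.
  have ix : 0 < x^-1 by rewrite invr_gt0.
  have : x^-1 * 2 * (1 + x ^+ 2 / 2) <= x^-1 * 2 * expR (x ^+ 2 / 2).
    by apply: ler_wpM2l => //; lra.
  have -> : x^-1 * 2 * (1 + x ^+ 2 / 2) = 2 * x^-1 + x by field; rewrite gt_eqF.
  by apply: lt_le_trans; lra.
- exact: cvg_cst.
- rewrite -[X in _ --> X](mulr0 2); apply: cvgMr.
  apply/gtr0_cvgV0; last by apply: cvg_id.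
  by near=> x; near: x; exact: nbhs_pinfty_gt.
Unshelve. all: by end_near. Qed.

Lemma is_derive_xexpR_sqr (R : realType) (x : R) :
  is_derive x 1 (fun x : R => x * expR (- (x ^+ 2 / 2)))
    ((1 - x ^+ 2) * expR (- (x ^+ 2 / 2))).
Proof.
have -> : (fun x : R => x * expR (- (x ^+ 2 / 2))) =
    (id : R -> R) * (expR \o ((- 2^-1) \*: ((id : R -> R) * (id : R -> R)))).
  apply/funext => y; rewrite fctE /=; congr (_ * expR _).
  by rewrite -[RHS]/(- 2^-1 * (y * y)); lra.
apply: is_derive_eq; rewrite /= /GRing.scale /= fctE /=.
have -> : - 2^-1 * (x * x) = - (x ^+ 2 / 2) by lra.
by field.
Qed.

(** The difference of the integrands is the derivative of [x e^(-x^2/2)], which vanishes at 0 and at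
    infinity. Splitting at 1, where that derivative changes sign, makes both halves integrals of
    nonnegative functions; each equals [e^(-1/2)]. *)
Lemma integral_sqr_expR_sqr (R : realType) :
  (\int[lebesgue_measure]_(x in `[0%R, +oo[) (x ^+ 2 * expR (- (x ^+ 2 / 2)))%:E =
   \int[lebesgue_measure]_(x in `[0%R, +oo[) (expR (- (x ^+ 2 / 2)))%:E :> \bar R)%E.
Proof.
pose e (x : R) := expR (- (x ^+ 2 / 2)).
have e0 x : 0 <= e x by exact: expR_ge0.
have cx2 : continuous (fun x : R => x ^+ 2) by move=> x; exact: exprn_continuous.
have ce : continuous e.
  move=> x; apply: continuous_comp; last exact: continuous_expR.
  by apply: continuousN; apply: continuousM; [exact: cx2|exact: cst_continuous].
have cf : continuous (fun x : R => (1 - x ^+ 2) * e x).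
  move=> x; apply: (@continuousM R R (fun x => 1 - x ^+ 2) e x); last exact: ce.
  by apply: continuousB; [exact: cst_continuous|exact: cx2].
have cg : continuous (fun x : R => (x ^+ 2 - 1) * e x).
  move=> x; apply: (@continuousM R R (fun x => x ^+ 2 - 1) e x); last exact: ce.
  by apply: continuousB; [exact: cx2|exact: cst_continuous].
have c2 : continuous (fun x : R => x ^+ 2 * e x).
  by move=> x; apply: (@continuousM R R (fun x => x ^+ 2) e x); [exact: cx2|exact: ce].
have cF : continuous (fun x : R => x * e x).
  by move=> x; apply: (@continuousM R R id e x); [exact: cvg_id|exact: ce].
have meas (f : R -> R) (D : set R) : continuous f -> measurable_fun D (fun x => (f x)%:E).
  move=> cf'; apply/measurable_EFinP; apply: measurable_funTS.
  exact: continuous_measurable_fun.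
have dF (x : R) := is_derive_xexpR_sqr x.
have dFN (x : R) : is_derive x 1 (fun x : R => - (x * e x)) ((x ^+ 2 - 1) * e x).
  have -> : (x ^+ 2 - 1) * e x = - ((1 - x ^+ 2) * e x) by ring.
  exact: (is_deriveN (dF x)).
have I1 : (\int[lebesgue_measure]_(x in `[0%R, 1%R]) ((1 - x ^+ 2) * e x)%:E = (e 1)%:E)%E.
  rewrite (@continuous_FTC2 _ _ (fun x => x * e x))//.
  - by rewrite mul1r mul0r sube0.
  - exact: continuous_subspaceT.
  - split => //.
    + by apply: cvg_at_right_filter; exact: cF.
    + by apply: cvg_at_left_filter; exact: cF.
  - by move=> x _; rewrite derive1E; exact: (@derive_val _ _ _ _ _ _ _ (dF x)).
have I2 : (\int[lebesgue_measure]_(x in `[1%R, +oo[) ((x ^+ 2 - 1) * e x)%:E = (e 1)%:E)%E.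
  rewrite (@ge0_continuous_FTC2y _ _ (fun x => - (x * e x)) 1 0)//.
  - by rewrite mul1r EFinN oppeK add0e.
  - move=> x x1; rewrite mulr_ge0// subr_ge0; nra.
  - exact: continuous_subspaceT.
  - by rewrite -[X in _ --> X]oppr0; apply: cvgN; exact: cvg_xexpR_sqr.
  - by apply: cvg_at_right_filter; apply: cvgN; exact: cF.
  - by move=> x _; rewrite derive1E; exact: (@derive_val _ _ _ _ _ _ _ (dFN x)).
have split (f : R -> R) : continuous f -> (forall x, 0 <= f x) ->
    (\int[lebesgue_measure]_(x in `[0%R, +oo[) (f x)%:E =
     \int[lebesgue_measure]_(x in `[0%R, 1%R]) (f x)%:E +
     \int[lebesgue_measure]_(x in `[1%R, +oo[) (f x)%:E :> \bar R)%E.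
  move=> cf' f0; rewrite -(integral_itv_bndo_bndc (meas _ _ cf')).
  rewrite -ge0_integral_setU//=.
  - by rewrite -itv_bndbnd_setU// bnd_simp.
  - exact: meas.
  - by move=> x _; rewrite lee_fin.
  - by apply/disj_setPS => x /=; rewrite !in_itv/=; lra.
rewrite !split//; last by move=> x; rewrite mulr_ge0// sqr_ge0.
have -> : (\int[lebesgue_measure]_(x in `[0%R, 1%R]) (e x)%:E =
   \int[lebesgue_measure]_(x in `[0%R, 1%R]) (x ^+ 2 * e x)%:E + (e 1)%:E :> \bar R)%E.
  rewrite -I1 -ge0_integralD//.
  - by apply: eq_integral => x _; rewrite -EFinD; congr (_%:E); ring.
  - by move=> x _; rewrite lee_fin mulr_ge0// sqr_ge0.
  - exact: meas.
  - by move=> x /=; rewrite in_itv/= => x01; rewrite lee_fin mulr_ge0// subr_ge0; nra.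
  - exact: meas.
have -> : (\int[lebesgue_measure]_(x in `[1%R, +oo[) (x ^+ 2 * e x)%:E =
   \int[lebesgue_measure]_(x in `[1%R, +oo[) (e x)%:E + (e 1)%:E :> \bar R)%E.
  rewrite -I2 -ge0_integralD//.
  - by apply: eq_integral => x _; rewrite -EFinD; congr (_%:E); ring.
  - by move=> x _; rewrite lee_fin.
  - exact: meas.
  - by move=> x /=; rewrite in_itv/= => x01; rewrite lee_fin mulr_ge0// subr_ge0; nra.
  - exact: meas.
by rewrite -addeA [X in (_ + X)%E]addeC.
Qed.

Lemma normal_sqr_mean (R : realType) :
  (\int[normal_prob 0 1]_x (x ^+ 2)%:E = 1 :> \bar R)%E.
Proof.
rewrite ge0_integral_normal_prob//; first last.
- by move=> x; rewrite lee_fin sqr_ge0.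
- exact: measurable_fun_exprn.
transitivity (\int[lebesgue_measure]_x
    ((normal_peak 1 : R)%:E * (x ^+ 2 * expR (- (x ^+ 2 / 2)))%:E))%E.
  by apply: eq_integral => x _; rewrite -!EFinM normal_pdf_std mulrCA.
transitivity (\int[lebesgue_measure]_x
    ((normal_peak 1 : R)%:E * (expR (- (x ^+ 2 / 2)))%:E))%E; last first.
  rewrite -[RHS](integral_normal_pdf (0 : R) 1).
  by apply: eq_integral => x _; rewrite -EFinM normal_pdf_std.
have ce : continuous (fun x : R => expR (- (x ^+ 2 / 2))).
  move=> x; apply: continuous_comp; last exact: continuous_expR.
  by apply: continuousN; apply: continuousM; [exact: exprn_continuous|exact: cst_continuous].
have c2 : continuous (fun x : R => x ^+ 2 * expR (- (x ^+ 2 / 2))).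
  by move=> x; apply: (@continuousM R R (fun x => x ^+ 2) _ x); [exact: exprn_continuous|exact: ce].
have p0 : (0 <= (normal_peak 1 : R)%:E)%E by rewrite lee_fin normal_peak_ge0.
rewrite !ge0_integralZl//.
- congr (_ * _)%E; rewrite !ge0_symfun_integralT//.
  + by rewrite -!set_itvcy integral_sqr_expR_sqr.
  + by move=> x /=; rewrite sqrrN.
  + by move=> x; rewrite mulr_ge0 ?sqr_ge0 ?expR_ge0.
  + by move=> x /=; rewrite sqrrN.
- by apply/measurable_EFinP; exact: continuous_measurable_fun.
- by apply/measurable_EFinP; exact: continuous_measurable_fun.
- by move=> x _; rewrite lee_fin mulr_ge0 ?sqr_ge0 ?expR_ge0.
Qed.

Lemma integral_probability1 d (T : measurableType d) (R : realType)
  (P : probability T R) : (\int[P]_w 1 = 1)%E.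
Proof. by rewrite integral_cst//= mul1e; exact: probability_setT. Qed.

(** * Moments and orthogonality of an i.i.d. Gaussian sequence *)

Section gaussian_sequence.
Context d (T : measurableType d) (R : realType) (P : probability T R).
Variables (Z : nat -> T -> R) (hZ : iid_std_normal P Z).

Lemma measurable_iid i : measurable_fun setT (Z i).
Proof. by case: hZ. Qed.

Lemma ge0_integral_iid i (f : R -> \bar R) : measurable_fun [set: R] f ->
  (forall x, 0 <= f x)%E ->
  (\int[P]_w f (Z i w) = \int[normal_prob 0 1]_x f x)%E.
Proof.
move=> mf f0; have mZ : measurable_fun setT (Z i : T -> measurableTypeR R) by exact: measurable_iid.
transitivity (\int[P]_(w in Z i @^-1` setT) (f \o Z i) w)%E.
  by rewrite preimage_setT.
rewrite -(ge0_integral_pushforward mZ)//.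
by apply: eq_measure_integral => A mA _; case: hZ => _ h _; exact: h.
Qed.

Lemma iid_sqr_mean i : (\int[P]_w (Z i w ^+ 2)%:E = 1)%E.
Proof.
rewrite (@ge0_integral_iid i (fun x => (x ^+ 2)%:E)) ?normal_sqr_mean//.
  exact: measurable_fun_exprn.
by move=> x; rewrite lee_fin sqr_ge0.
Qed.

Lemma iid_pow4_le i : (\int[P]_w (Z i w ^+ 4)%:E <= 64%:E)%E.
Proof.
rewrite (@ge0_integral_iid i (fun x => (x ^+ 4)%:E)) ?normal_pow4_le//.
  exact: measurable_fun_exprn.
by move=> x; rewrite lee_fin exprn_even_ge0.
Qed.

Lemma iid_mean0 i : (\int[P]_w (Z i w)%:E = 0)%E.
Proof.
rewrite integralE.
have -> : (\int[P]_w (fun w => (Z i w)%:E)^\+ w =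
    \int[normal_prob 0 1]_x (Num.max x 0)%:E)%E.
  rewrite -(@ge0_integral_iid i (fun x => (Num.max x 0)%:E)).
  - by apply: eq_integral => w _; rewrite funeposE EFin_max.
  - by apply/measurable_EFinP; exact: measurable_maxr.
  - by move=> x; rewrite lee_fin le_max lexx orbT.
have -> : (\int[P]_w (fun w => (Z i w)%:E)^\- w =
    \int[normal_prob 0 1]_x (Num.max (- x) 0)%:E)%E.
  rewrite -(@ge0_integral_iid i (fun x => (Num.max (- x) 0)%:E)).
  - by apply: eq_integral => w _; rewrite funenegE EFin_max.
  - by apply/measurable_EFinP; apply: measurable_maxr => //; exact: oppr_measurable.
  - by move=> x; rewrite lee_fin le_max lexx orbT.
(* Cancellation in the extended reals requires finiteness, which comes from [max x 0 <= x^2 + 1]. *)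
rewrite -normal_mean0 subee// ge0_fin_numE; last first.
  by apply: integral_ge0 => x _; rewrite lee_fin le_max lexx orbT.
rewrite -(@ge0_integral_iid i (fun x => (Num.max x 0)%:E)); first last.
- by move=> x; rewrite lee_fin le_max lexx orbT.
- by apply/measurable_EFinP; exact: measurable_maxr.
have mZ := measurable_iid i.
apply: (@le_lt_trans _ _ (\int[P]_w ((Z i w ^+ 2)%:E + 1))%E).
  apply: ge0_le_integral => //.
  - by move=> w _; rewrite lee_fin le_max lexx orbT.
  - by apply/measurable_EFinP; apply: measurable_maxr.
  - by apply: emeasurable_funD => //; apply/measurable_EFinP; apply: measurable_funX.
  - by move=> w _; rewrite -EFinD lee_fin ge_max; apply/andP; split; nra.
rewrite ge0_integralD//.
- by rewrite integral_probability1 iid_sqr_mean ltry.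
- by move=> w _; rewrite lee_fin sqr_ge0.
- by apply/measurable_EFinP; apply: measurable_funX.
Qed.

(** The law of the pair and the product law agree on rectangles, hence coincide; Fubini then
    produces the inner integral of [g], which is 0. Integrability comes from
    [|x y| <= x^2 + y^2]. *)
Lemma iid_orthogonal i j (g : R -> R) : i != j -> measurable_fun [set: R] g ->
  (\int[P]_w (g (Z i w))%:E = 0)%E ->
  (\int[P]_w (g (Z i w) ^+ 2)%:E < +oo)%E ->
  (\int[P]_w (g (Z j w) ^+ 2)%:E < +oo)%E ->
  (\int[P]_w (g (Z i w) * g (Z j w))%:E = 0)%E.
Proof.
move=> ij mg g0 gi2 gj2.
have [mZ0 law ind] := hZ.
have mZ k : measurable_fun setT (Z k : T -> measurableTypeR R) by exact: mZ0.
pose pr w : measurableTypeR R * measurableTypeR R := (Z i w, Z j w).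
have mpr : measurable_fun setT pr by apply: measurable_fun_pair.
pose nu := normal_prob (0 : R) 1.
have jointE (X : set (measurableTypeR R * measurableTypeR R)) : measurable X -> (nu \x nu)%E X = pushforward P pr X.
  move=> mX; apply: (@product_measure_unique _ _ _ _ R nu nu (pushforward P pr)) => // A B mA mB.
  pose Bs k := if k == i then A else B.
  have := ind [:: i; j] Bs; rewrite /= inE ij => /(_ isT).
  rewrite !big_cons big_nil mule1 /Bs eqxx eq_sym (negbTE ij) !law// => <-.
    congr (P _); apply/seteqP; split=> w /=.
      by move=> [wA wB] k /=; rewrite !inE => /orP[]/eqP ->; rewrite ?eqxx// eq_sym (negbTE ij).
    move=> h; split; first by have := h i; rewrite /= inE eqxx => /(_ isT).
    by have := h j; rewrite /= !inE eqxx orbT eq_sym (negbTE ij) => /(_ isT).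
  by move=> k; case: ifP.
pose G (xy : measurableTypeR R * measurableTypeR R) := (g xy.1 * g xy.2)%:E.
have mG : measurable_fun setT G.
  apply/measurable_EFinP; apply: measurable_funM; exact: measurableT_comp.
have intP : P.-integrable setT (G \o pr).
  apply/integrableP; split; first exact: measurableT_comp.
  apply: (@le_lt_trans _ _ (\int[P]_w ((g (Z i w) ^+ 2)%:E + (g (Z j w) ^+ 2)%:E))%E).
    apply: ge0_le_integral => //.
    - by apply: measurableT_comp => //; exact: measurableT_comp.
    - apply: emeasurable_funD; apply/measurable_EFinP; apply: measurable_funX;
        exact: measurableT_comp.
    - move=> w _; rewrite /G /= lee_fin ler_norml; nra.
  rewrite ge0_integralD//; first exact: lte_add_pinfty.
  - by move=> w _; rewrite lee_fin sqr_ge0.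
  - by apply/measurable_EFinP; apply: measurable_funX; exact: measurableT_comp.
  - by move=> w _; rewrite lee_fin sqr_ge0.
  - by apply/measurable_EFinP; apply: measurable_funX; exact: measurableT_comp.
have gi1 : P.-integrable setT (fun w => (g (Z i w))%:E).
  apply/integrableP; split; first by apply/measurable_EFinP; exact: measurableT_comp.
  apply: (@le_lt_trans _ _ (\int[P]_w ((g (Z i w) ^+ 2)%:E + 1))%E).
    apply: ge0_le_integral => //.
    - by apply: measurableT_comp => //; apply/measurable_EFinP; exact: measurableT_comp.
    - by apply: emeasurable_funD => //; apply/measurable_EFinP; apply: measurable_funX;
        exact: measurableT_comp.
    - move=> w _; rewrite /= lee_fin ler_norml; nra.
  rewrite ge0_integralD//.
  - by rewrite integral_probability1 lte_add_pinfty// ltry.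
  - by move=> w _; rewrite lee_fin sqr_ge0.
  - by apply/measurable_EFinP; apply: measurable_funX; exact: measurableT_comp.
have lawE : (\int[nu]_x (g x)%:E = 0)%E.
  rewrite -g0.
  pose g' : measurableTypeR R -> \bar R := fun x => (g x)%:E.
  have mg' : measurable_fun setT g' by exact/measurable_EFinP.
  transitivity (\int[P]_(w in Z i @^-1` setT) (g' \o Z i) w)%E; last by rewrite preimage_setT.
  rewrite -(integral_pushforward (mZ i))// ?preimage_setT//.
  by apply: eq_measure_integral => A mA _; first [exact: law|exact/esym/law].
have intj : (nu \x nu)%E.-integrable setT G.
  have : (pushforward P pr).-integrable setT G.
    by apply: integrable_pushforward => //; rewrite preimage_setT.
  move=> /integrableP[_ h]; apply/integrableP; split => //.
  rewrite (eq_measure_integral (pushforward P pr))// => A mA _.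
  exact: jointE.
transitivity (\int[pushforward P pr]_xy G xy)%E.
  by rewrite integral_pushforward// preimage_setT.
rewrite (eq_measure_integral (nu \x nu)%E); last first.
  by move=> A mA _; first [exact: jointE|exact/esym/jointE].
rewrite -(integral12_prod_meas1 intj).
apply: integral0_eq => x _; rewrite /fubini_F /G /=.
under eq_integral do rewrite EFinM.
rewrite integralZl ?lawE ?mule0//.
apply/integrableP; split; first exact/measurable_EFinP.
move: gi1 => /integrableP[_]; apply: le_lt_trans.
rewrite (@ge0_integral_iid i (fun x => `|(g x)%:E|%E))//.
by apply: measurableT_comp => //; apply/measurable_EFinP.
Qed.

End gaussian_sequence.

(** * Elementary inequalities for the logarithm *)

Section elementary.
Context (R : realType).
Implicit Types x y r s l : R.

Lemma powRD_gt0 x r s : 0 < x -> x `^ (r + s) = x `^ r * x `^ s.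
Proof. by move=> x0; rewrite powRD//; apply/implyP => _; rewrite gt_eqF. Qed.

Lemma ln_ge1BV y : 0 < y -> 1 - y^-1 <= ln y.
Proof.
move=> y0; have yV : 0 < y^-1 by rewrite invr_gt0.
have h : -1 < y^-1 - 1 by lra.
have := le_ln1Dx h; rewrite (_ : 1 + (y^-1 - 1) = y^-1); last by lra.
rewrite lnV ?posrE//; lra.
Qed.

(** With [a = l/(1+l)], the bound [1 - 1/y <= ln y] at [y = 1 + l] only gives [ln (1+l) >= a]. At
    [y = sqrt (1+l)] it also yields the second-order term, through [sqrt (1-a) <= 1 - a/2 - a^2/8].
    The gain [a^2/4] dominates the noise variance and bounds the complexity from below. *)
Lemma ln1D_sub_ge l : 0 <= l ->
  (l / (1 + l)) ^+ 2 / 4 <= ln (1 + l) - l / (1 + l).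
Proof.
move=> l0; have l1 : 0 < 1 + l by lra.
set a := l / (1 + l).
have a0 : 0 <= a by rewrite divr_ge0// ltW.
have aE : (1 + l)^-1 = 1 - a by rewrite /a; field; rewrite gt_eqF.
have a1 : 0 < 1 - a by rewrite -aE invr_gt0.
set q := Num.sqrt (1 - a).
have q0 : 0 < q by rewrite sqrtr_gt0.
have q2 : q ^+ 2 = 1 - a by rewrite sqr_sqrtr// ltW.
have lq : ln (1 + l) = 2 * ln (q^-1).
  have -> : 1 + l = q^-1 ^+ 2 by rewrite exprVn q2 -aE invrK.
  by rewrite expr2 lnM ?posrE ?invr_gt0//; lra.
have := @ln_ge1BV (q^-1); rewrite invr_gt0 invrK => /(_ q0) h.
have qle : q <= 1 - a / 2 - a ^+ 2 / 8.
  have b0 : 0 <= 1 - a / 2 - a ^+ 2 / 8 by nra.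
  rewrite -(@ler_pXn2r _ 2)// ?nnegrE ?(ltW q0)// q2.
  have : 0 <= a ^+ 3 by rewrite exprn_ge0.
  have : 0 <= a ^+ 4 by rewrite exprn_ge0.
  by lra.
lra.
Qed.

Lemma ln1D_sub_le l : 0 <= l ->
  ln (1 + l) - l / (1 + l) <= l / (1 + l) * ln (1 + l).
Proof.
move=> l0; have l1 : 0 < 1 + l by lra.
have h : ln (1 + l) <= l by apply: le_ln1Dx; lra.
have aE : (1 + l)^-1 = 1 - l / (1 + l) by field; rewrite gt_eqF.
have i0 : 0 < (1 + l)^-1 by rewrite invr_gt0.
have : (1 + l)^-1 * ln (1 + l) <= (1 + l)^-1 * l by rewrite ler_wpM2l// ltW.
rewrite {1}aE mulrBl mul1r [(1 + l)^-1 * l]mulrC; lra.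
Qed.

Lemma ln1D_dist l : 0 <= l -> `|ln (1 + l) - l| <= l ^+ 2.
Proof.
move=> l0; have l1 : 0 < 1 + l by lra.
have h : ln (1 + l) <= l by apply: le_ln1Dx; lra.
have h2 := ln_ge1BV l1.
have : l - l ^+ 2 <= 1 - (1 + l)^-1.
  have -> : 1 - (1 + l)^-1 = l - l ^+ 2 / (1 + l) by field; rewrite gt_eqF.
  rewrite lerB// ler_pdivrMr//; have := sqr_ge0 l; nra.
rewrite ler_norml; have := sqr_ge0 l; move=> *; apply/andP; split; lra.
Qed.

(** From the factorisation [1 + r l = (1 + l)(1 + (r-1) l/(1+l))]. The error is a multiple of a
    shrinkage factor, which is what the complexity can absorb. *)
Lemma ln1D_scale l r : 0 <= l -> 1 <= r ->
  ln (1 + r * l) <= ln (1 + l) + (r - 1) * (l / (1 + l)).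
Proof.
move=> l0 r1; have l1 : 0 < 1 + l by lra.
set x := (r - 1) * (l / (1 + l)).
have x0 : 0 <= x by rewrite mulr_ge0 ?divr_ge0//; lra.
have -> : 1 + r * l = (1 + l) * (1 + x) by rewrite /x; field; rewrite gt_eqF.
rewrite lnM ?posrE//; last lra.
rewrite lerD2l; apply: le_ln1Dx; lra.
Qed.

Lemma harmonic_le (N : nat) :
  \sum_(1 <= i < N.+2) (i%:R^-1 : R) <= 1 + ln N.+1%:R.
Proof.
elim: N => [|N IH]; first by rewrite big_nat1 invr1 ln1; lra.
rewrite big_nat_recr//=.
have N0 : 0 < N.+1%:R :> R by rewrite ltr0n.
have N1 : 0 < N.+2%:R :> R by rewrite ltr0n.
have h := @ln_ge1BV (N.+2%:R / N.+1%:R) (divr_gt0 N1 N0).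
rewrite ln_div ?posrE// invf_div in h.
have e : 1 - N.+1%:R / N.+2%:R = N.+2%:R^-1 :> R.
  have -> : N.+1%:R = N.+2%:R - 1 :> R by rewrite -[N.+2%:R]natr1 addrK.
  by field; rewrite gt_eqF.
rewrite e in h; apply: (le_trans (lerD IH h)); lra.
Qed.

End elementary.

(** * The likelihood criterion *)

Section coefficients.
Context (R : realType) (p C : R) (kappa : nat -> R).
Hypotheses (hp : 0 <= p) (hC : 1 <= C).
Hypothesis hkappa : forall i : nat, (0 < i)%N ->
     C^-1 * (i%:R `^ (- p)) <= kappa i /\ kappa i <= C * (i%:R `^ (- p)).
Implicit Types al be : R.
Local Notation t := (tcoef kappa).
Local Notation ex al := (1 + 2 * al + 2 * p).

Let C0 : 0 < C. Proof. exact: lt_le_trans hC. Qed.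

Lemma kappa_gt0 i : (0 < i)%N -> 0 < kappa i.
Proof.
move=> i0; have [h _] := hkappa i0; apply: lt_le_trans h.
by rewrite mulr_gt0 ?invr_gt0// powR_gt0// ltr0n.
Qed.

Lemma tcoef_gt0 al i : (0 < i)%N -> 0 < t al i.
Proof.
move=> i0; rewrite /tcoef mulr_gt0 ?powR_gt0 ?ltr0n// invr_gt0 exprn_gt0//.
exact: kappa_gt0.
Qed.

Lemma powR_ex al i : (0 < i)%N ->
  i%:R `^ ex al = i%:R `^ (1 + 2 * al) * (i%:R `^ (- p)) ^- 2.
Proof.
move=> i0; rewrite powRD_gt0 ?ltr0n//; congr (_ * _).
by rewrite powRN exprVn invrK mulrC powRrM powR_mulrn ?powR_ge0.
Qed.

Lemma tcoef_le al i : (0 < i)%N -> t al i <= C ^+ 2 * i%:R `^ ex al.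
Proof.
move=> i0; rewrite powR_ex// mulrCA /tcoef ler_wpM2l ?powR_ge0//.
have [h _] := hkappa i0.
have e0 : 0 < i%:R `^ (- p) by rewrite powR_gt0 ?ltr0n.
have k0 := kappa_gt0 i0.
have -> : C ^+ 2 * (i%:R `^ (- p)) ^- 2 = (C^-1 * i%:R `^ (- p)) ^- 2.
  by field; rewrite !gt_eqF.
rewrite lef_pV2 ?posrE ?exprn_gt0 ?mulr_gt0 ?invr_gt0//.
by rewrite ler_pXn2r// nnegrE ?(ltW k0)// ltW// mulr_gt0// invr_gt0.
Qed.

Lemma tcoef_ge al i : (0 < i)%N -> C ^- 2 * i%:R `^ ex al <= t al i.
Proof.
move=> i0; rewrite powR_ex// mulrCA /tcoef ler_wpM2l ?powR_ge0//.
have [_ h] := hkappa i0.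
have e0 : 0 < i%:R `^ (- p) by rewrite powR_gt0 ?ltr0n.
have k0 := kappa_gt0 i0.
have -> : C ^- 2 * (i%:R `^ (- p)) ^- 2 = (C * i%:R `^ (- p)) ^- 2.
  by field; rewrite !gt_eqF.
rewrite lef_pV2 ?posrE ?exprn_gt0 ?mulr_gt0//.
by rewrite ler_pXn2r// nnegrE ?(ltW k0)// ltW// mulr_gt0.
Qed.

Lemma tcoef_homo al be i : (0 < i)%N -> al <= be -> t al i <= t be i.
Proof.
move=> i0 ab; rewrite /tcoef ler_wpM2r ?invr_ge0 ?sqr_ge0//.
by apply: ler_powR; rewrite ?ler1n//; lra.
Qed.

Lemma tcoef_shift al be i I : (0 < i)%N -> (i <= I)%N -> al <= be ->
  t be i <= I%:R `^ (2 * (be - al)) * t al i.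
Proof.
move=> i0 iI ab; rewrite /tcoef mulrA ler_wpM2r ?invr_ge0 ?sqr_ge0//.
have -> : 1 + 2 * be = 2 * (be - al) + (1 + 2 * al) by ring.
rewrite powRD_gt0 ?ltr0n// ler_wpM2r ?powR_ge0//.
by apply: ge0_ler_powR; rewrite ?nnegrE ?ler0n ?ler_nat//; lra.
Qed.

Variables (n : nat) (n0 : (0 < n)%N).

Definition shrink al i : R := n%:R / (t al i + n%:R).

Let nR0 : 0 < n%:R :> R. Proof. by rewrite ltr0n. Qed.

Let tn0 al i : (0 < i)%N -> 0 < t al i + n%:R.
Proof. by move=> i0; rewrite addr_gt0// tcoef_gt0. Qed.

Lemma shrink_gt0 al i : (0 < i)%N -> 0 < shrink al i.
Proof. by move=> i0; rewrite /shrink divr_gt0// tn0. Qed.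

Lemma shrinkC al i : (0 < i)%N -> 1 - shrink al i = t al i / (t al i + n%:R).
Proof. by move=> i0; rewrite /shrink; field; rewrite gt_eqF// tn0. Qed.

Lemma shrink_lt1 al i : (0 < i)%N -> shrink al i < 1.
Proof.
by move=> i0; rewrite -subr_gt0 shrinkC// divr_gt0 ?tn0// tcoef_gt0.
Qed.

Lemma shrink_homo al be i : (0 < i)%N -> al <= be -> shrink be i <= shrink al i.
Proof.
move=> i0 ab; rewrite /shrink (ler_wpM2l (ltW nR0))// lef_pV2 ?posrE ?tn0//.
by rewrite lerD2r tcoef_homo.
Qed.

Lemma shrinkE al i : (0 < i)%N ->
  shrink al i = (n%:R / t al i) / (1 + n%:R / t al i).
Proof.
move=> i0; have t0 := tcoef_gt0 al i0; rewrite /shrink; field.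
by rewrite !gt_eqF// tn0.
Qed.

(** The index at which [tcoef] reaches the order of n: lower coordinates are kept by the shrinkage,
    higher ones are damped. *)
Definition cutoff al : R := n%:R `^ (ex al)^-1.

Lemma cutoff_gt0 al : 0 < cutoff al.
Proof. by rewrite powR_gt0. Qed.

Lemma ex_ge1 al : 0 <= al -> 1 <= ex al.
Proof. by move=> a0; move: hp; lra. Qed.

Lemma cutoff_ex al : 0 <= al -> cutoff al `^ ex al = n%:R.
Proof.
move=> a0; rewrite /cutoff -powRrM mulVf ?powRr1// gt_eqF//.
by have := ex_ge1 a0; lra.
Qed.

Lemma cutoff_ge1 al : 0 <= al -> 1 <= cutoff al.
Proof.
move=> a0; rewrite -[leLHS](powRr0 n%:R); apply: ler_powR; first by rewrite ler1n.
by rewrite invr_ge0; have := ex_ge1 a0; lra.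
Qed.

Lemma cutoff_le al : 0 <= al -> cutoff al <= n%:R.
Proof.
move=> a0; rewrite -[leRHS](@powRr1 _ n%:R)//; apply: ler_powR; first by rewrite ler1n.
by rewrite invf_le1 ?ex_ge1//; have := ex_ge1 a0; lra.
Qed.

Lemma cutoff_homo al be : 0 <= al -> al <= be -> cutoff be <= cutoff al.
Proof.
move=> a0 ab; apply: ler_powR; first by rewrite ler1n.
have e1 := ex_ge1 a0; have e2 : ex al <= ex be by lra.
have e3 : 0 < ex al by lra.
by rewrite lef_pV2 ?posrE// (lt_le_trans e3).
Qed.

(** Below the cutoff the factor is at most 1; beyond it, it is at most [C^2 n i^(-ex)], and
    [n = J^ex] with [ex >= 1]. The bound serves twice: divided by [i] it sums the factors, and
    through [signal_bias] it controls the bias. *)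
Lemma mul_shrink_le al i : 0 <= al -> (0 < i)%N ->
  i%:R * shrink al i <= C ^+ 2 * cutoff al.
Proof.
move=> a0 i0.
have J0 := cutoff_gt0 al; have e1 := ex_ge1 a0.
have iR : 0 < i%:R :> R by rewrite ltr0n.
have C1 : 1 <= C ^+ 2 by exact: exprn_ege1.
have [iJ|Ji] := leP i%:R (cutoff al).
  apply: (@le_trans _ _ (1 * cutoff al)); last by rewrite ler_wpM2r// (ltW J0).
  rewrite [leRHS]mulrC ler_pM// ?(ltW iR)// ltW ?shrink_gt0// shrink_lt1//.
have h : i%:R * shrink al i <= i%:R * (n%:R / (C ^- 2 * i%:R `^ ex al)).
  rewrite (ler_wpM2l (ltW iR))// /shrink (ler_wpM2l (ltW nR0))//.
  rewrite lef_pV2 ?posrE ?tn0// ?mulr_gt0 ?powR_gt0 ?invr_gt0 ?exprn_gt0//.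
  by apply: (le_trans (tcoef_ge _ i0)); rewrite lerDl (ltW nR0).
apply: (le_trans h).
have -> : i%:R * (n%:R / (C ^- 2 * i%:R `^ ex al)) =
   C ^+ 2 * (n%:R / i%:R `^ (ex al - 1)) :> R.
  have -> : i%:R `^ ex al = i%:R `^ (ex al - 1) * i%:R :> R.
    by rewrite -[X in _ = _ * X](@powRr1 _ i%:R) ?(ltW iR)// -powRD_gt0// subrK.
  have q0 : 0 < i%:R `^ (ex al - 1) :> R by rewrite powR_gt0.
  by field; rewrite !gt_eqF.
rewrite ler_wpM2l ?sqr_ge0// ler_pdivrMr ?powR_gt0//.
have {1}-> : n%:R = cutoff al * cutoff al `^ (ex al - 1).
  rewrite -[X in X * _](@powRr1 _ (cutoff al)) ?(ltW J0)// -powRD_gt0//.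
  by rewrite addrC subrK cutoff_ex.
rewrite (ler_wpM2l (ltW J0))//; apply: ge0_ler_powR; rewrite ?nnegrE ?(ltW J0) ?(ltW iR) ?(ltW Ji)//; lra.
Qed.

(** For [al = p = 0] the factors decay like [1/i] and the sum is unbounded in [N]. The logarithm is
    harmless since the truncation point will be a power of n. *)
Lemma sum_shrink_le al N : 0 <= al ->
  \sum_(1 <= i < N.+2) shrink al i <= C ^+ 2 * cutoff al * (1 + ln N.+1%:R).
Proof.
move=> a0; have J0 := cutoff_gt0 al.
apply: (@le_trans _ _ (\sum_(1 <= i < N.+2) C ^+ 2 * cutoff al * i%:R^-1)).
  rewrite big_seq [leRHS]big_seq; apply: ler_sum => i.
  rewrite mem_index_iota => /andP[i0 _].
  by rewrite ler_pdivlMr ?ltr0n// mulrC mul_shrink_le.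
rewrite -mulr_sumr ler_wpM2l ?harmonic_le// mulr_ge0 ?sqr_ge0// (ltW J0)//.
Qed.

Lemma shrink_ge al i : 0 <= al -> (0 < i)%N -> i%:R <= cutoff al ->
  (1 + C ^+ 2)^-1 <= shrink al i.
Proof.
move=> a0 i0 iJ.
have C1 : 0 < C ^+ 2 by rewrite exprn_gt0.
have h : t al i <= C ^+ 2 * n%:R.
  apply: (le_trans (tcoef_le _ i0)); rewrite ler_wpM2l ?sqr_ge0//.
  rewrite -[leRHS](cutoff_ex a0); apply: ge0_ler_powR; rewrite ?nnegrE ?ler0n//.
    by have := ex_ge1 a0; lra.
  exact/ltW/cutoff_gt0.
rewrite /shrink ler_pdivlMr ?tn0// mulrC ler_pdivrMr; lra.
Qed.

End coefficients.

Lemma sum_trunc_le (R : realDomainType) (f : nat -> R) (N M : nat) :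
  (forall i, (0 < i)%N -> 0 <= f i) ->
  \sum_(1 <= i < N) (if (i < M)%N then f i else 0) <= \sum_(1 <= i < M) f i.
Proof.
move=> f0; have [NM|MN] := leqP N M.
  have -> : \sum_(1 <= i < N) (if (i < M)%N then f i else 0) = \sum_(1 <= i < N) f i.
    by apply: eq_big_nat => i /andP[_ iN]; rewrite (leq_trans iN NM).
  have [N1|N1] := leqP N 1.
    by rewrite big_geq// big_seq sumr_ge0// => i; rewrite mem_index_iota => /andP[/f0].
  rewrite (big_cat_nat (n := N) (ltnW N1) NM)/= lerDl big_seq sumr_ge0// => i.
  by rewrite mem_index_iota => /andP[Ni _]; apply: f0; exact: leq_trans (ltnW N1) Ni.
have [M1|M1] := leqP M 1.
  rewrite [leRHS]big_geq// big_seq big1// => i; rewrite mem_index_iota => /andP[i1 _].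
  by rewrite ltnNge (leq_trans M1 i1).
rewrite (big_cat_nat (n := M) (ltnW M1) (ltnW MN))/= [X in _ + X]big_seq [X in _ + X]big1 ?addr0.
  by rewrite le_eqVlt; apply/orP; left; apply/eqP; apply: eq_big_nat => i /andP[_ ->].
by move=> i; rewrite mem_index_iota => /andP[Mi _]; rewrite ltnNge Mi.
Qed.

Section criterion.
Context (R : realType) (p C : R) (kappa : nat -> R).
Hypotheses (hp : 0 <= p) (hC : 1 <= C).
Hypothesis hkappa : forall i : nat, (0 < i)%N ->
     C^-1 * (i%:R `^ (- p)) <= kappa i /\ kappa i <= C * (i%:R `^ (- p)).
Variables (n : nat) (n0 : (0 < n)%N).
Implicit Types al be : R.
Implicit Types th z mu : nat -> R.
Local Notation t := (tcoef kappa).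
Local Notation a := (shrink kappa n).
Local Notation J := (cutoff p n).
Local Notation ex al := (1 + 2 * al + 2 * p).

Let C0 : 0 < C. Proof. exact: lt_le_trans hC. Qed.
Let nR0 : 0 < n%:R :> R. Proof. by rewrite ltr0n. Qed.
Let C2 : 1 <= C ^+ 2. Proof. exact: exprn_ege1. Qed.

Definition lik_term al (x : nat -> R) i : R :=
  ln (1 + n%:R / t al i) - a al i * x i ^+ 2.

Definition complexity I al th : R :=
  \sum_(1 <= i < I) (ln (1 + n%:R / t al i) - a al i + (1 - a al i) * th i ^+ 2).

Definition fluct I al th z : R :=
  \sum_(1 <= i < I) (a al i * (z i ^+ 2 - 1) - 2 * (1 - a al i) * th i * z i).

(** The last sum does not involve [al], so it cancels when two values of the criterion are
    compared. *)
Lemma lik_sumE I al th z :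
  \sum_(1 <= i < I) lik_term al (fun i => th i + z i) i =
  complexity I al th - fluct I al th z - \sum_(1 <= i < I) (th i ^+ 2 + 2 * th i * z i).
Proof.
rewrite /complexity /fluct -!sumrB; apply: eq_bigr => i _; rewrite /lik_term; ring.
Qed.

(** The quadratic term moves in the right direction by monotonicity of the shrinkage factor,
    whatever the data; only the deterministic logarithm costs something. The comparison is
    one-sided, from a grid point to values on its right. *)
Lemma lik_term_shift al be x i I : (0 < i)%N -> (i <= I)%N -> al <= be ->
  lik_term al x i <= lik_term be x i + (I%:R `^ (2 * (be - al)) - 1) * a al i.
Proof.
move=> i0 iI ab; rewrite /lik_term.
have ha := shrink_homo hC hkappa n0 i0 ab.
have tb0 := tcoef_gt0 hC hkappa be i0.
have ta0 := tcoef_gt0 hC hkappa al i0.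
have ht := tcoef_shift kappa i0 iI ab.
set r := I%:R `^ _ in ht *.
have r1 : 1 <= r.
  rewrite -[leLHS](powRr0 I%:R); apply: ler_powR; last by lra.
  by rewrite ler1n (leq_trans i0 iI).
have l0 : 0 <= n%:R / t be i by rewrite divr_ge0// ltW.
have h1 : n%:R / t al i <= r * (n%:R / t be i).
  by rewrite mulrCA ler_wpM2l ?ler0n// ler_pdivlMr// mulrC ler_pdivrMr.
have la0 : 0 <= n%:R / t al i by rewrite divr_ge0// ltW.
have h2 : ln (1 + n%:R / t al i) <= ln (1 + r * (n%:R / t be i)).
  by rewrite ler_ln ?posrE; lra.
have h3 := ln1D_scale l0 r1.
rewrite -(shrinkE hC hkappa n0 be i0) in h3.
have h4 : (r - 1) * a be i <= (r - 1) * a al i by rewrite ler_wpM2l// subr_ge0.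
have h5 : a be i * x i ^+ 2 <= a al i * x i ^+ 2 by rewrite ler_wpM2r// sqr_ge0.
lra.
Qed.

Lemma complexity_term_ge al th i : (0 < i)%N ->
  a al i ^+ 2 / 4 + (1 - a al i) * th i ^+ 2 <=
  ln (1 + n%:R / t al i) - a al i + (1 - a al i) * th i ^+ 2.
Proof.
move=> i0; rewrite lerD2r (shrinkE hC hkappa n0)//; apply: ln1D_sub_ge.
by rewrite divr_ge0// ltW// (tcoef_gt0 hC hkappa).
Qed.

Lemma shrinkC_gt0 al i : (0 < i)%N -> 0 < 1 - a al i.
Proof. by move=> i0; rewrite subr_gt0 (shrink_lt1 hC hkappa). Qed.

Lemma complexity_ge_noise I al th :
  \sum_(1 <= i < I) (a al i ^+ 2 / 4 + (1 - a al i) * th i ^+ 2) <= complexity I al th.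
Proof.
rewrite /complexity big_seq [leRHS]big_seq; apply: ler_sum => i.
by rewrite mem_index_iota => /andP[i0 _]; exact: complexity_term_ge.
Qed.

Lemma complexity_ge_bias I al th :
  \sum_(1 <= i < I) ((1 - a al i) * th i ^+ 2) <= complexity I al th.
Proof.
apply: le_trans (complexity_ge_noise _ _ _); apply: ler_sum => i _.
by rewrite lerDr divr_ge0// sqr_ge0.
Qed.

(** At least [J/2] indices lie below the cutoff; each has factor at least [1/(1 + C^2)] and
    contributes [a^2/4], whence 8. A small complexity thus forces a small cutoff, that is, a large
    [al]. *)
Lemma complexity_ge I al th : 0 <= al -> (n <= I)%N ->
  J al / (8 * (1 + C ^+ 2) ^+ 2) <= complexity I.+1 al th.
Proof.
move=> al0 nI; apply: le_trans (complexity_ge_noise _ _ _).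
have J1 := cutoff_ge1 hp n0 al0.
have Jn := cutoff_le hp n0 al0.
pose N := Num.truncn (J al).
have /andP[NJ JN] : N%:R <= J al < N.+1%:R by apply: truncn_itv; lra.
have N1 : (0 < N)%N by rewrite truncn_gt0.
have NI : (N.+1 <= I.+1)%N.
  by rewrite ltnS (leq_trans _ nI)// -(@ler_nat R) (le_trans NJ).
have K0 : 0 < (1 + C ^+ 2)^-1 by rewrite invr_gt0 addr_gt0// (lt_le_trans ltr01 C2).
have hN : N.+1%:R <= 2 * N%:R :> R.
  by rewrite -natrM ler_nat mul2n -addnn -addn1 leq_add2l.
apply: (@le_trans _ _ (\sum_(1 <= i < N.+1) ((1 + C ^+ 2)^-1 ^+ 2 / 4))).
  rewrite big_const_nat subn1 iter_addr_0 -mulr_natr.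
  rewrite invfM exprVn.
  set k := ((1 + C ^+ 2) ^+ 2)^-1; have k0 : 0 <= k by rewrite invr_ge0 sqr_ge0.
  rewrite /= mulrA mulrC; have := ler_wpM2l k0 (ltW JN); have := ler_wpM2l k0 hN; lra.
apply: (@le_trans _ _ (\sum_(1 <= i < N.+1) (a al i ^+ 2 / 4 + (1 - a al i) * th i ^+ 2))).
  rewrite big_seq [leRHS]big_seq; apply: ler_sum => i.
  rewrite mem_index_iota => /andP[i0 iN].
  have iJ : i%:R <= J al by rewrite (le_trans _ NJ)// ler_nat.
  have h := shrink_ge hp hC hkappa n0 al0 i0 iJ.
  have : (1 + C ^+ 2)^-1 ^+ 2 <= a al i ^+ 2.
    by rewrite ler_pXn2r// nnegrE ?(ltW K0)// (le_trans (ltW K0) h).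
  have := mulr_ge0 (ltW (shrinkC_gt0 al i0)) (sqr_ge0 (th i)); lra.
rewrite [leRHS](big_cat_nat (n := N.+1))//= lerDl big_seq sumr_ge0// => i.
rewrite mem_index_iota => /andP[Ni _]; have i0 : (0 < i)%N by apply: leq_trans Ni.
by rewrite addr_ge0 ?divr_ge0 ?sqr_ge0// mulr_ge0 ?sqr_ge0// ltW// shrinkC_gt0.
Qed.

Definition signal mu i : R := Num.sqrt n%:R * kappa i * mu i.

(** Combines [1 - a = a t / n] with [t kappa^2 = i^(1 + 2 be)]. When [be] is the smoothness of the
    ball, the second factor is the term of the Sobolev norm. *)
Lemma signal_bias be mu i : (0 < i)%N ->
  (1 - a be i) * signal mu i ^+ 2 =
  i%:R * a be i * (i%:R `^ (2 * be) * mu i ^+ 2).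
Proof.
move=> i0; rewrite /signal !exprMn sqr_sqrtr ?ler0n// (shrinkC hC hkappa)//.
have t0 := tcoef_gt0 hC hkappa be i0; have k0 := kappa_gt0 hC hkappa i0.
have tk : t be i * kappa i ^+ 2 = i%:R * i%:R `^ (2 * be).
  rewrite /tcoef powRD_gt0 ?ltr0n// powRr1 ?ler0n//; field; rewrite gt_eqF//.
rewrite /shrink.
transitivity (n%:R * (t be i * kappa i ^+ 2) * mu i ^+ 2 / (t be i + n%:R)).
  by field; rewrite gt_eqF// addr_gt0.
by rewrite tk; field; rewrite gt_eqF// addr_gt0.
Qed.

Lemma complexity_le N be mu S : 0 <= be ->
  \sum_(1 <= i < N.+2) (i%:R `^ (2 * be) * mu i ^+ 2) <= S ->
  complexity N.+2 be (signal mu) <=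
  C ^+ 2 * J be * ((1 + ln N.+1%:R) * ln (1 + C ^+ 2 * n%:R) + S).
Proof.
move=> be0 hS; have J0 := cutoff_gt0 p n0 be.
set Ln := ln (1 + C ^+ 2 * n%:R).
have Cn : 0 <= C ^+ 2 * n%:R by rewrite mulr_ge0 ?sqr_ge0.
have Ln0 : 0 <= Ln by apply: ln_ge0; lra.
apply: (@le_trans _ _ (Ln * \sum_(1 <= i < N.+2) a be i +
    C ^+ 2 * J be * \sum_(1 <= i < N.+2) (i%:R `^ (2 * be) * mu i ^+ 2))).
  rewrite /complexity !mulr_sumr -big_split/= big_seq [leRHS]big_seq.
  apply: ler_sum => i; rewrite mem_index_iota => /andP[i0 _].
  have t0 := tcoef_gt0 hC hkappa be i0.
  have l0 : 0 <= n%:R / t be i by rewrite divr_ge0// ltW.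
  have h := ln1D_sub_le l0; rewrite -(shrinkE hC hkappa n0 be i0) in h.
  apply: lerD.
    apply: (le_trans h); rewrite mulrC ler_wpM2r//.
      by rewrite ltW// (shrink_gt0 hC hkappa).
    rewrite ler_ln ?posrE; [|lra|lra].
    rewrite lerD2l ler_pdivrMr// mulrAC ler_peMl//.
    apply: (@le_trans _ _ (C ^+ 2 * (C ^- 2 * i%:R `^ ex be))).
      rewrite mulrA divff ?gt_eqF ?exprn_gt0// mul1r.
      rewrite -[leLHS](powRr0 i%:R); apply: ler_powR; first by rewrite ler1n.
      by have := ex_ge1 hp be0; lra.
    by rewrite ler_wpM2l ?sqr_ge0// (tcoef_ge hC hkappa).
  rewrite signal_bias//; apply: ler_wpM2r; first by rewrite mulr_ge0 ?powR_ge0// sqr_ge0.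
  exact: (mul_shrink_le hp hC hkappa).
have h1 := sum_shrink_le hp hC hkappa n0 N be0.
have h2 := ler_wpM2l Ln0 h1.
have CJ : 0 <= C ^+ 2 * J be by rewrite mulr_ge0 ?sqr_ge0// ltW.
have h3 := ler_wpM2l CJ hS.
lra.
Qed.

Lemma shrinkC_shift al be i I r : (0 < i)%N -> (i <= I)%N -> al <= be ->
  I%:R `^ (2 * (be - al)) <= r ->
  1 - a be i <= r * (1 - a al i).
Proof.
move=> i0 iI ab hr; rewrite !(shrinkC hC hkappa)//.
have ta0 := tcoef_gt0 hC hkappa al i0; have tb0 := tcoef_gt0 hC hkappa be i0.
have tab := tcoef_homo kappa i0 ab.
have ht := tcoef_shift kappa i0 iI ab.
have htr : t be i <= r * t al i by apply: (le_trans ht); rewrite ler_wpM2r// ltW.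
rewrite mulrA; apply: (@le_trans _ _ (r * t al i / (t be i + n%:R))).
  by rewrite ler_wpM2r// invr_ge0 ltW// addr_gt0.
rewrite ler_wpM2l; last by rewrite lef_pV2 ?posrE ?addr_gt0// lerD2r.
  by [].
by apply: le_trans htr; exact: ltW.
Qed.

(** In use, [be] is the estimate, [al] the grid point below it and [b] the smoothness of the ball.
    Up to [K] the bias is read off the complexity at [al], because [mu_i^2] is the squared signal
    over [n kappa_i^2]; beyond [K] the bound [1 - a <= 1] and the Sobolev ball suffice. This covers
    estimates far above [b]. *)
Lemma bias_le I N al be b mu K S : 0 <= b -> 0 < K -> K <= I%:R -> al <= be ->
  I%:R `^ (2 * (be - al)) <= 2 ->
  (forall M, \sum_(1 <= i < M) (i%:R `^ (2 * b) * mu i ^+ 2) <= S) ->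
  \sum_(1 <= i < N) ((1 - a be i) ^+ 2 * mu i ^+ 2) <=
  2 * C ^+ 2 * K `^ (2 * p) / n%:R * complexity I.+1 al (signal mu) + K `^ (- (2 * b)) * S.
Proof.
move=> b0 K0 KI ab r2 hS.
set k := 2 * C ^+ 2 * K `^ (2 * p) / n%:R.
have k0 : 0 <= k by rewrite /k divr_ge0// mulr_ge0 ?powR_ge0// mulr_ge0 ?sqr_ge0.
pose A i := k * ((1 - a al i) * signal mu i ^+ 2).
pose B i := K `^ (- (2 * b)) * (i%:R `^ (2 * b) * mu i ^+ 2).
have A0 i : (0 < i)%N -> 0 <= A i.
  by move=> i0; rewrite mulr_ge0// mulr_ge0 ?sqr_ge0// ltW// shrinkC_gt0.
apply: (@le_trans _ _ (\sum_(1 <= i < N) (if (i < I.+1)%N then A i else 0) +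
    \sum_(1 <= i < N) B i)); last first.
  apply: lerD.
    apply: (le_trans (sum_trunc_le _ _ A0)); rewrite -mulr_sumr ler_wpM2l//.
    exact: complexity_ge_bias.
  by rewrite -mulr_sumr ler_wpM2l ?powR_ge0.
rewrite -big_split/= big_seq [leRHS]big_seq; apply: ler_sum => i.
rewrite mem_index_iota => /andP[i0 _].
have m0 := sqr_ge0 (mu i).
have B0 : 0 <= B i by rewrite mulr_ge0 ?powR_ge0// mulr_ge0 ?powR_ge0.
have iR : 0 < i%:R :> R by rewrite ltr0n.
have d0 := shrinkC_gt0 be i0.
have d1 : 1 - a be i <= 1 by have := shrink_gt0 hC hkappa n0 be i0; lra.
have d2 : (1 - a be i) ^+ 2 <= 1 - a be i by nra.
have [iK|Ki] := leP i%:R K.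
  have iI : (i <= I)%N by rewrite -(@ler_nat R) (le_trans iK).
  rewrite ltnS iI; apply: (@le_trans _ _ (A i)); last by rewrite lerDl.
  apply: (@le_trans _ _ ((2 * (1 - a al i)) * mu i ^+ 2)).
    rewrite ler_wpM2r//; apply: (le_trans d2).
    exact: (shrinkC_shift i0 iI ab r2).
  rewrite /A /k /signal !exprMn sqr_sqrtr ?ler0n//.
  have c0 := ltW (shrinkC_gt0 al i0).
  have hk : 1 <= C ^+ 2 * K `^ (2 * p) * kappa i ^+ 2.
    have [kk _] := hkappa i0.
    have e0 : 0 < i%:R `^ (- p) :> R by rewrite powR_gt0.
    apply: (@le_trans _ _ (C ^+ 2 * K `^ (2 * p) * (C^-1 * i%:R `^ (- p)) ^+ 2)); last first.
      apply: ler_wpM2l; first by apply: mulr_ge0; [exact: sqr_ge0|exact: powR_ge0].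
      rewrite ler_pXn2r// nnegrE; last exact/ltW/(kappa_gt0 hC hkappa).
      by apply: mulr_ge0; [rewrite invr_ge0 ltW|exact: ltW].
    rewrite exprMn exprVn mulrACA divff ?gt_eqF ?exprn_gt0// mul1r.
    rewrite -(powR_mulrn 2 (ltW e0)) -powRrM.
    have -> : - p * 2 = - (2 * p) by ring.
    rewrite powRN ler_pdivlMr ?powR_gt0// mul1r.
    by apply: ge0_ler_powR; rewrite ?nnegrE ?(ltW iR) ?(ltW K0)//; rewrite mulr_ge0.
  have -> : 2 * C ^+ 2 * K `^ (2 * p) / n%:R * ((1 - a al i) * (n%:R * kappa i ^+ 2 * mu i ^+ 2)) =
     2 * (1 - a al i) * mu i ^+ 2 * (C ^+ 2 * K `^ (2 * p) * kappa i ^+ 2).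
    by field; rewrite gt_eqF.
  by rewrite ler_peMr// mulr_ge0// mulr_ge0.
apply: (@le_trans _ _ (B i)); last by rewrite lerDr; case: ifP => // _; exact: A0.
apply: (@le_trans _ _ (1 * mu i ^+ 2)); first by rewrite ler_wpM2r//; lra.
rewrite /B mulrA ler_wpM2r// powRN mulrC ler_pdivlMr ?powR_gt0// mul1r.
by apply: ge0_ler_powR; rewrite ?nnegrE ?(ltW iR) ?(ltW K0) ?(ltW Ki)//; rewrite mulr_ge0.
Qed.

End criterion.

(** * Tails of conditionally convergent series *)

Section tail.
Context (R : realType).
Implicit Types (w e u q h : nat -> R).

(** Summation by parts as an invariant: the weighted sum minus [w_k] times the plain partial sum
    stays within [(w_m - w_k) B]. The resulting bound is the same for all admissible weights, which
    gives uniformity in [alpha]. *)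
Lemma abel_le w e m N B : (forall i, (m <= i)%N -> 0 <= w i.+1 <= w i) ->
  0 <= w m <= 1 -> 0 <= B ->
  (forall k, `|\sum_(m <= i < k) e i| <= B) ->
  `|\sum_(m <= i < N) w i * e i| <= B.
Proof.
move=> wd /andP[wm0 wm1] B0 eB.
have [Nm|mN] := leqP N m; first by rewrite big_geq// normr0.
rewrite -(subnKC (ltnW mN)); move: (N - m)%N => k {N mN}.
suff : 0 <= w (m + k)%N /\
   `|\sum_(m <= i < m + k) w i * e i - w (m + k)%N * \sum_(m <= i < m + k) e i|
     <= (w m - w (m + k)%N) * B.
  move=> [wk0 h]; rewrite -[X in `|X|](subrK (w (m + k)%N * \sum_(m <= i < m + k) e i)).
  apply: (le_trans (ler_normD _ _)); rewrite normrM (ger0_norm wk0).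
  have := ler_wpM2l wk0 (eB (m + k)%N); have := ler_wpM2r B0 wm1; lra.
elim: k => [|k [wk0 IH]].
  by rewrite addn0 !big_geq// mulr0 subrr normr0 subrr mul0r.
have /andP[w1 w2] := wd (m + k)%N (leq_addr _ _).
rewrite addnS; split => //.
rewrite !big_nat_recr ?leq_addr//=; set A := \sum_(_ <= _ < _) _ in IH *.
set S := \sum_(_ <= _ < _) e _ in IH *.
have hS : `|S + e (m + k)%N| <= B.
  by have := eB (m + k).+1; rewrite big_nat_recr ?leq_addr.
have -> : A + w (m + k)%N * e (m + k)%N - w (m + k).+1 * (S + e (m + k)%N) =
   (A - w (m + k)%N * S) + (w (m + k)%N - w (m + k).+1) * (S + e (m + k)%N) by ring.
apply: (le_trans (ler_normD _ _)); rewrite normrM [X in _ + X * _]ger0_norm ?subr_ge0//.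
have w3 : 0 <= w (m + k)%N - w (m + k).+1 by rewrite subr_ge0.
have := ler_wpM2l w3 hS; lra.
Qed.

Lemma ler_norm_sum_nat e m N : `|\sum_(m <= i < N) e i| <= \sum_(m <= i < N) `|e i|.
Proof. exact: ler_norm_sum. Qed.

Lemma sum_nat_ge0 e m N : (forall i, (m <= i)%N -> 0 <= e i) ->
  0 <= \sum_(m <= i < N) e i.
Proof.
by move=> e0; rewrite big_seq sumr_ge0// => i; rewrite mem_index_iota => /andP[/e0].
Qed.

Lemma sum_nat_sub_le e m N N' : (forall i, (m <= i)%N -> 0 <= e i) -> (N <= N')%N ->
  \sum_(m <= i < N) e i <= \sum_(m <= i < N') e i.
Proof.
move=> e0 NN'; have [Nm|mN] := leqP N m.
  by rewrite big_geq//; exact: sum_nat_ge0.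
rewrite (big_cat_nat (n := N) (ltnW mN) NN')/= lerDl sum_nat_ge0// => i Ni.
by apply: e0; exact: leq_trans (ltnW mN) Ni.
Qed.

Lemma sum_cube_blocks e l0 l : (l0 <= l)%N ->
  \sum_(l0 ^ 3 <= i < l ^ 3) e i = \sum_(l0 <= j < l) \sum_(j ^ 3 <= i < j.+1 ^ 3) e i.
Proof.
move=> l0l; rewrite -(subnKC l0l); elim: (l - l0)%N => [|k IH].
  by rewrite addn0 !big_geq.
rewrite addnS [RHS]big_nat_recr ?leq_addr//= -IH (big_cat_nat (n := ((l0 + k) ^ 3)%N))//=.
  by rewrite leq_exp2r// leq_addr.
by rewrite leq_exp2r.
Qed.

Lemma cube_floor k : exists l, (l ^ 3 <= k < l.+1 ^ 3)%N.
Proof.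
have h : exists l, (l ^ 3 <= k)%N by exists 0%N.
have b l : (l ^ 3 <= k)%N -> (l <= k)%N.
  move=> /(leq_trans _)-> //; case: l => // l.
  by rewrite -{1}(expn1 l.+1) leq_pexp2l.
case: (ex_maxnP h b) => l lk lmax; exists l; rewrite lk/= ltnNge.
by apply/negP => /lmax; rewrite ltnn.
Qed.

(** Complete blocks are counted by the modulus of their sum; in the last, incomplete block
    cancellation is lost and the sum of moduli, at most [sqrt tau], has to do. Cubes serve both
    needs: a block has about [3 l^2] terms of size [n / l^3], so its sum has deviation of order
    [n l^-2], which is summable, and its moduli add up to order [n / l], which is square
    summable. *)
Lemma cube_blocks_le e h l0 k tau :
  (forall l, (l0 <= l)%N -> `|\sum_(l ^ 3 <= i < l.+1 ^ 3) e i| <= h l) ->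
  (forall l, (l0 <= l)%N -> (\sum_(l ^ 3 <= i < l.+1 ^ 3) `|e i|) ^+ 2 <= h l) ->
  (forall N, \sum_(l0 <= l < N) h l <= tau) ->
  `|\sum_(l0 ^ 3 <= i < k) e i| <= tau + Num.sqrt tau.
Proof.
move=> h1 h2 ht.
have h0 l : (l0 <= l)%N -> 0 <= h l by move=> /h1; apply: le_trans.
have t0 : 0 <= tau by apply: le_trans (ht 0%N); rewrite big_geq.
have [kl|lk] := leqP k (l0 ^ 3).
  by rewrite big_geq// normr0 addr_ge0// sqrtr_ge0.
have [l /andP[lk1 lk2]] := cube_floor k.
have l0l : (l0 <= l)%N.
  by rewrite -ltnS -(@ltn_exp2r _ _ 3)// (ltn_trans lk).
rewrite (big_cat_nat (n := (l ^ 3)%N))//=; last by rewrite leq_exp2r.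
apply: (le_trans (ler_normD _ _)); apply: lerD.
  rewrite sum_cube_blocks//; apply: (le_trans (ler_norm_sum_nat _ _ _)).
  apply: le_trans (ht l); rewrite big_seq [leRHS]big_seq; apply: ler_sum => j.
  by rewrite mem_index_iota => /andP[l0j _]; exact: h1.
apply: (le_trans (ler_norm_sum_nat _ _ _)).
have hb : h l <= tau.
  apply: le_trans (ht l.+1); rewrite big_nat_recr//= lerDr sum_nat_ge0//.
set s := \sum_(_ <= _ < _) _.
have s0 : 0 <= s by apply: sum_nat_ge0.
rewrite -(ger0_norm s0) -sqrtr_sqr; apply: ler_wsqrtr.
apply: le_trans hb; apply: le_trans (h2 l l0l).
rewrite ler_pXn2r// ?nnegrE ?sum_nat_ge0//.
by apply: sum_nat_sub_le => //; exact: ltnW.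
Qed.

Lemma weighted_tail_le w e u q h l0 k tau : (0 < l0)%N ->
  (forall i, (0 < i)%N -> 0 <= w i.+1 <= w i) -> w 1%N <= 1 ->
  (forall i, (0 < i)%N -> `|u i + w i * e i| <= q i) ->
  (forall l, (l0 <= l)%N -> `|\sum_(l ^ 3 <= i < l.+1 ^ 3) e i| <= h l) ->
  (forall l, (l0 <= l)%N -> (\sum_(l ^ 3 <= i < l.+1 ^ 3) `|e i|) ^+ 2 <= h l) ->
  (forall l, (l0 <= l)%N -> \sum_(l ^ 3 <= i < l.+1 ^ 3) q i <= h l) ->
  (forall N, \sum_(l0 <= l < N) h l <= tau) ->
  `|\sum_(l0 ^ 3 <= i < k) u i| <= 2 * tau + Num.sqrt tau.
Proof.
move=> l00 wd w1 uq h1 h2 h3 ht.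
have t0 : 0 <= tau by apply: le_trans (ht 0%N); rewrite big_geq.
have L0 : (0 < l0 ^ 3)%N by rewrite expn_gt0 l00.
have q0 i : (0 < i)%N -> 0 <= q i by move=> /uq; apply: le_trans.
have wm : forall i, (0 < i)%N -> 0 <= w i <= 1.
  move=> [//|i _]; elim: i => [|i /andP[a b]].
    by rewrite w1 andbT; have /andP[a b] := wd 1%N isT; exact: le_trans b.
  by have /andP[-> c] := wd i.+1 isT; exact: le_trans b.
have -> : \sum_(l0 ^ 3 <= i < k) u i =
   \sum_(l0 ^ 3 <= i < k) (u i + w i * e i) - \sum_(l0 ^ 3 <= i < k) w i * e i.
  by rewrite -sumrB; apply: eq_bigr => i _; rewrite addrK.
apply: (le_trans (ler_normB _ _)).
have -> : 2 * tau + Num.sqrt tau = tau + (tau + Num.sqrt tau) by ring.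
apply: lerD.
  apply: (le_trans (ler_norm_sum_nat _ _ _)).
  apply: (@le_trans _ _ (\sum_(l0 ^ 3 <= i < k) q i)).
    rewrite big_seq [leRHS]big_seq; apply: ler_sum => i.
    by rewrite mem_index_iota => /andP[li _]; apply: uq; exact: leq_trans li.
  have kk : (k <= (l0 + k) ^ 3)%N.
    apply: (@leq_trans (l0 + k)); first exact: leq_addl.
    by rewrite -{1}(expn1 (l0 + k)) leq_pexp2l// addn_gt0 l00.
  apply: (@le_trans _ _ (\sum_(l0 ^ 3 <= i < (l0 + k) ^ 3) q i)).
    by apply: sum_nat_sub_le => // i li; apply: q0; exact: leq_trans li.
  rewrite sum_cube_blocks ?leq_addr//; apply: le_trans (ht (l0 + k)%N).
  rewrite big_seq [leRHS]big_seq; apply: ler_sum => j.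
  by rewrite mem_index_iota => /andP[l0j _]; exact: h3.
apply: abel_le => //.
- by move=> i li; apply: wd; exact: leq_trans li.
- exact: wm.
- by rewrite addr_ge0// sqrtr_ge0.
- by move=> j; exact: cube_blocks_le h1 h2 ht.
Qed.

Lemma cvgn_of_tail (s : nat -> R) :
  (forall eps : R, 0 < eps -> exists K, forall k, (K <= k)%N -> `|s k - s K| <= eps) ->
  cvgn s.
Proof.
move=> hs; apply: cauchy_cvg; apply: cauchy_exP => eps e0.
have e20 : 0 < eps / 2 by lra.
have [K hK] := hs _ e20; exists (s K); exists K => // k /= Kk.
by rewrite /ball /= distrC (le_lt_trans (hK k Kk))//; lra.
Qed.

Lemma limn_dist_le (s : nat -> R) K B : cvgn s ->
  (forall k, (K <= k)%N -> `|s k - s K| <= B) -> `|limn s - s K| <= B.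
Proof.
move=> cs hs; rewrite ler_norml; apply/andP; split.
  rewrite lerBrDr; apply: limr_ge => //; exists K => // k /= Kk.
  by have := hs k Kk; rewrite ler_norml; lra.
rewrite lerBlDr; apply: limr_le => //; exists K => // k /= Kk.
by have := hs k Kk; rewrite ler_norml; lra.
Qed.

Lemma small_tail h m tau eps : (forall l, (m <= l)%N -> 0 <= h l) -> 0 < eps ->
  (forall N, \sum_(m <= l < N) h l <= tau) ->
  exists2 l0, (m <= l0)%N & forall N, \sum_(l0 <= l < N) h l <= eps.
Proof.
move=> h0 e0 ht; pose s N := \sum_(m <= l < N) h l.
have nd : nondecreasing_seq s by move=> a b ab; exact: sum_nat_sub_le.
have cs : cvgn s.
  by apply: nondecreasing_is_cvgn => //; exists tau => _ [N _ <-]; exact: ht.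
have e1 : limn s - eps < limn s by rewrite ltrBlDr ltrDl.
have [K _ hK] : \forall N \near \oo, limn s - eps < s N.
  by apply: (cvgr_gt _ cs); exact: e1.
exists (maxn m K); first exact: leq_maxl.
move=> N; have [NK|KN] := leqP N (maxn m K); first by rewrite big_geq// ltW.
have h1 : s N <= limn s by apply: nondecreasing_cvgn_le.
have h2 := hK (maxn m K) (leq_maxr _ _).
have : s N = s (maxn m K) + \sum_(maxn m K <= l < N) h l.
  by rewrite /s (big_cat_nat (n := maxn m K))//= ?leq_maxl// ltnW.
by move: h2 => /=; lra.
Qed.

(** The limit of a divergent sequence is a default value, so convergence has to be proved before
    [limn] can be compared with a truncated sum. Both claims come from [weighted_tail_le], started
    at a late block for convergence and at [m] for the bound, where [sqrt Delta <= Delta]. *)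
Lemma weighted_tail_cvg w e u q h m Delta : (0 < m)%N -> 1 <= Delta ->
  (forall i, (0 < i)%N -> 0 <= w i.+1 <= w i) -> w 1%N <= 1 ->
  (forall i, (0 < i)%N -> `|u i + w i * e i| <= q i) ->
  (forall l, (m <= l)%N -> `|\sum_(l ^ 3 <= i < l.+1 ^ 3) e i| <= h l) ->
  (forall l, (m <= l)%N -> (\sum_(l ^ 3 <= i < l.+1 ^ 3) `|e i|) ^+ 2 <= h l) ->
  (forall l, (m <= l)%N -> \sum_(l ^ 3 <= i < l.+1 ^ 3) q i <= h l) ->
  (forall N, \sum_(m <= l < N) h l <= Delta) ->
  cvgn (fun N => \sum_(1 <= i < N) u i) /\
  `|limn (fun N => \sum_(1 <= i < N) u i) - \sum_(1 <= i < m ^ 3) u i| <= 3 * Delta.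
Proof.
move=> m0 D1 wd w1 uq h1 h2 h3 ht.
pose s N := \sum_(1 <= i < N) u i.
have split l0 k : (0 < l0)%N -> (l0 ^ 3 <= k)%N -> s k - s (l0 ^ 3)%N = \sum_(l0 ^ 3 <= i < k) u i.
  move=> l00 lk; rewrite /s (big_cat_nat (n := (l0 ^ 3)%N))//= ?expn_gt0 ?l00//.
  by rewrite addrAC subrr add0r.
have hm l : (m <= l)%N -> 0 <= h l by move=> /h1; apply: le_trans.
have cs : cvgn s.
  apply: cvgn_of_tail => eps e0.
  (* The tail bound is [2 d + sqrt d], at most [3/4 eps] with this choice. *)
  pose d := Num.min (eps / 4) ((eps / 4) ^+ 2).
  have d0 : 0 < d by rewrite lt_min; apply/andP; split; [|apply: exprn_gt0]; lra.
  have [l0 ml0 hl0] := small_tail hm d0 ht.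
  have l00 : (0 < l0)%N by exact: leq_trans ml0.
  exists (l0 ^ 3)%N => k lk; rewrite split//.
  have := @weighted_tail_le w e u q h l0 k d l00 wd w1 uq
     (fun l ll => h1 l (leq_trans ml0 ll)) (fun l ll => h2 l (leq_trans ml0 ll))
     (fun l ll => h3 l (leq_trans ml0 ll)) hl0.
  move=> /le_trans; apply.
  have d1 : d <= eps / 4 by rewrite ge_min lexx.
  have : Num.sqrt d <= eps / 4.
    rewrite -[leRHS]ger0_norm; last by lra.
    by rewrite -sqrtr_sqr; apply: ler_wsqrtr; rewrite ge_min lexx orbT.
  lra.
split => //; apply: limn_dist_le => // k mk; rewrite split//.
apply: (le_trans (weighted_tail_le _ m0 wd w1 uq h1 h2 h3 ht)).
have : Num.sqrt Delta <= Delta.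
  have D0 : 0 <= Delta by lra.
  rewrite -[leRHS](ger0_norm D0) -sqrtr_sqr; apply: ler_wsqrtr; nra.
lra.
Qed.

End tail.

(** * The oracle inequality *)

Section oracle.
Context (R : realType) (p C : R) (kappa : nat -> R).
Hypotheses (hp : 0 <= p) (hC : 1 <= C).
Hypothesis hkappa : forall i : nat, (0 < i)%N ->
     C^-1 * (i%:R `^ (- p)) <= kappa i /\ kappa i <= C * (i%:R `^ (- p)).
Variables (n : nat) (n0 : (0 < n)%N).
Local Notation a := (shrink kappa n).
Local Notation J := (cutoff p n).
Local Notation D := (complexity kappa n).
Local Notation c1 := (8 * (1 + C ^+ 2) ^+ 2).

(* [V] stands for -2 times the log-likelihood, up to an additive constant. *)
Lemma oracle_risk_le (I K G : nat) (V : R -> R) (mu z : nat -> R)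
    (al' be alh M eta Delta X S : R) :
  (n <= I)%N -> (0 < G)%N -> 0 <= al' -> 0 <= be <= M -> 0 <= alh <= M ->
  M * G%:R < K%:R -> 0 <= eta <= 1 -> I%:R `^ (2 / G%:R) <= 1 + eta ->
  4 * c1 * C ^+ 2 * (1 + ln I%:R) * eta <= 1 ->
  (forall j, (j < K)%N -> `|fluct kappa n I.+1 (j%:R / G%:R) (signal kappa n mu) z| <=
      D I.+1 (j%:R / G%:R) (signal kappa n mu) / 4 + Delta) ->
  `|fluct kappa n I.+1 be (signal kappa n mu) z| <=
      D I.+1 be (signal kappa n mu) / 4 + Delta ->
  (forall al, 0 <= al ->
    `|V al - \sum_(1 <= i < I.+1) lik_term kappa n al (fun i => signal kappa n mu i + z i) i|
      <= 3 * Delta) ->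
  V alh <= V be ->
  5 / 2 * D I.+1 be (signal kappa n mu) + 16 * Delta <= X ->
  X < J al' / c1 ->
  (forall N, \sum_(1 <= i < N) (i%:R `^ (2 * be) * mu i ^+ 2) <= S) ->
  al' <= alh /\ forall N, \sum_(1 <= i < N) ((1 - a alh i) ^+ 2 * mu i ^+ 2) <=
     2 * C ^+ 2 * J be `^ (2 * p) / n%:R * X + J be `^ (- (2 * be)) * S.
Proof.
move=> nI G0 al'0 /andP[be0 beM] /andP[ah0 ahM] MK /andP[eta0 eta1] hI heta hgrid hbe hV Vle hX XJ hS.
have I0 : (0 < I)%N by exact: leq_trans nI.
have GR : 0 < G%:R :> R by rewrite ltr0n.
(* The largest grid point not above [alh], as [lik_term_shift] goes from left to right. *)
pose j := Num.truncn (alh * G%:R).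
have /andP[j1 j2] : j%:R <= alh * G%:R < j.+1%:R by apply: truncn_itv; rewrite mulr_ge0// ltW.
have jK : (j < K)%N.
  rewrite -(@ltr_nat R) (le_lt_trans j1)// (le_lt_trans _ MK)//.
  by rewrite ler_wpM2r// ltW.
pose aj : R := j%:R / G%:R.
have aj0 : 0 <= aj by rewrite divr_ge0// ltW.
have ajh : aj <= alh by rewrite ler_pdivrMr.
have hd : alh - aj <= G%:R^-1.
  rewrite lerBlDr -[X in X + _]mul1r -mulrDl ler_pdivlMr// addrC natr1.
  exact: ltW.
have hr : I%:R `^ (2 * (alh - aj)) <= 1 + eta.
  apply: le_trans hI; apply: ler_powR; first by rewrite ler1n.
  by rewrite ler_wpM2l.
set th := signal kappa n mu in hgrid hbe hV hX *.
have c10 : 0 < c1.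
  by rewrite mulr_gt0// exprn_gt0// addr_gt0// exprn_gt0// (lt_le_trans _ hC).
have hDlow := complexity_ge hp hC hkappa n0 th aj0 nI.
have J0 := cutoff_gt0 p n0 aj.
(* The cost of rounding to the grid: the condition on [eta] brings it below [J aj / (4 c1)], and
   [J aj / c1] is a lower bound for the complexity at [aj]. *)
have sumeta : eta * \sum_(1 <= i < I.+1) a aj i <= D I.+1 aj th / 4.
  have := sum_shrink_le hp hC hkappa n0 I.-1 aj0.
  rewrite prednK// => /(ler_wpM2l eta0) /le_trans; apply.
  have lI : 0 <= ln (I%:R : R) by rewrite ln_ge0// ler1n.
  have : J aj / c1 * (4 * c1 * C ^+ 2 * (1 + ln I%:R) * eta) <= J aj / c1 * 1.
    by apply: ler_wpM2l => //; rewrite divr_ge0// ltW.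
  have -> : J aj / c1 * (4 * c1 * C ^+ 2 * (1 + ln I%:R) * eta) =
     4 * (eta * (C ^+ 2 * J aj * (1 + ln I%:R))).
    by field; rewrite gt_eqF// addr_gt0// exprn_gt0// (lt_le_trans _ hC).
  lra.
pose x i := th i + z i.
have shift : \sum_(1 <= i < I.+1) lik_term kappa n aj x i <=
    \sum_(1 <= i < I.+1) lik_term kappa n alh x i + eta * \sum_(1 <= i < I.+1) a aj i.
  rewrite mulr_sumr -big_split/= big_seq [leRHS]big_seq; apply: ler_sum => i.
  rewrite mem_index_iota ltnS => /andP[i0 iI].
  apply: (le_trans (lik_term_shift hC hkappa n0 x i0 iI ajh)).
  rewrite lerD2l ler_wpM2r//; first by rewrite ltW// (shrink_gt0 hC hkappa).
  lra.
(* Passing from [V] to truncated sums at [alh] and [be] costs [6 Delta], the noise at [aj] and [be]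
   a quarter of each complexity and [2 Delta], the rounding another quarter at [aj]. Hence
   [D(aj)/2 <= 5/4 D(be) + 8 Delta]. *)
have DX : D I.+1 aj th <= X.
  have e1 := lik_sumE kappa n I.+1 aj th z.
  have e2 := lik_sumE kappa n I.+1 be th z.
  rewrite -/x in e1 e2.
  have h1 := hV alh ah0; have h2 := hV be be0; rewrite -/x in h1 h2.
  move: h1 h2 (hgrid j jK) hbe; rewrite -/aj !ler_norml.
  move=> /andP[h1 h1'] /andP[h2 h2'] /andP[h3 h3'] /andP[h4 h4'].
  lra.
(* Otherwise [J al' <= J aj <= c1 D(aj) <= c1 X < J al']. *)
have al'j : al' <= aj.
  rewrite leNgt; apply/negP => lt; have := cutoff_homo hp n0 aj0 (ltW lt).
  have : J aj / c1 < J al' / c1 by apply: le_lt_trans XJ; exact: le_trans DX.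
  by rewrite ltr_pM2r ?invr_gt0// => /lt_le_trans/[apply]; rewrite ltxx.
split; first exact: le_trans ajh.
move=> N; have KI : J be <= I%:R.
  by apply: (le_trans (cutoff_le hp n0 be0)); rewrite ler_nat.
have r2 : I%:R `^ (2 * (alh - aj)) <= 2 by lra.
apply: (le_trans (bias_le hp hC hkappa n0 N be0 (cutoff_gt0 p n0 be) KI ajh r2 hS)).
rewrite lerD2r; apply: ler_wpM2l => //.
by apply: divr_ge0 => //; apply: mulr_ge0; [rewrite mulr_ge0// sqr_ge0|exact: powR_ge0].
Qed.

End oracle.

(** * Mean bounds *)

Section mean_le.
Context d (T : measurableType d) (R : realType) (P : probability T R).
Implicit Types (f g : T -> \bar R) (c : R).
Local Open Scope ereal_scope.

(** Measurability and sign travel with the bound, so that bounds can be added, scaled and summed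
    without side conditions. *)
Definition mean_le f c :=
  [/\ measurable_fun setT f, forall w, 0 <= f w & \int[P]_w f w <= c%:E].

Lemma mean_leD f g c c' : mean_le f c -> mean_le g c' ->
  mean_le (fun w => f w + g w) (c + c')%R.
Proof.
move=> [mf f0 fc] [mg g0 gc]; split.
- exact: emeasurable_funD.
- by move=> w; exact: adde_ge0.
- by rewrite ge0_integralD// EFinD; exact: leeD.
Qed.

Lemma mean_leZ f c (k : R) : (0 <= k)%R -> mean_le f c ->
  mean_le (fun w => k%:E * f w) (k * c)%R.
Proof.
move=> k0 [mf f0 fc]; split.
- by apply: emeasurable_funM.
- by move=> w; apply: mule_ge0.
- by rewrite ge0_integralZl_EFin// EFinM lee_wpmul2l.
Qed.

Lemma mean_le_mono f g c : measurable_fun setT f -> (forall w, 0 <= f w <= g w) ->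
  mean_le g c -> mean_le f c.
Proof.
move=> mf fg [mg g0 gc]; split => //.
- by move=> w; have /andP[] := fg w.
- apply: le_trans gc; apply: ge0_le_integral => //.
  + by move=> w _; have /andP[] := fg w.
  + by move=> w _; have /andP[] := fg w.
Qed.

Lemma mean_le_weaken f c c' : (c <= c')%R -> mean_le f c -> mean_le f c'.
Proof. by move=> cc' [mf f0 fc]; split => //; apply: (le_trans fc); rewrite lee_fin. Qed.

Lemma mean_le0 : mean_le (fun=> 0) 0%R.
Proof. by split => //; rewrite integral0. Qed.

Lemma mean_le_cst (k : R) : (0 <= k)%R -> mean_le (fun=> k%:E) k.
Proof.
move=> k0; split => //.
by rewrite integral_cst//= [X in _ * X](_ : _ = 1) ?mule1//; exact: probability_setT.
Qed.

Lemma mean_le_sum (f : nat -> T -> \bar R) (c : nat -> R) (s : seq nat) :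
  (forall i, i \in s -> mean_le (f i) (c i)) ->
  mean_le (fun w => \sum_(i <- s) f i w) (\sum_(i <- s) c i)%R.
Proof.
elim: s => [|i s IH] h.
  under eq_fun do rewrite big_nil; rewrite big_nil; exact: mean_le0.
under eq_fun do rewrite big_cons; rewrite big_cons; apply: mean_leD.
  by apply: h; rewrite inE eqxx.
by apply: IH => j js; apply: h; rewrite inE js orbT.
Qed.

Lemma mean_le_series (f : nat -> T -> \bar R) (c : nat -> R) m B :
  (forall i, (m <= i)%N -> mean_le (f i) (c i)) ->
  (forall N, \sum_(m <= i < N) c i <= B)%R ->
  mean_le (fun w => \sum_(m <= i <oo) f i w) B.
Proof.
move=> h hB; pose g i w := if (m <= i)%N then f i w else 0.
have hg i : mean_le (g i) (if (m <= i)%N then c i else 0%R).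
  by rewrite /g; case: ifP => [/h//|_]; exact: mean_le0.
have g0 i w : 0 <= g i w by case: (hg i).
have mg i : measurable_fun setT (g i) by case: (hg i).
have from0 (u : nat -> \bar R) : (forall i, 0 <= u i) -> (forall i, (i < m)%N -> u i = 0) ->
    \sum_(m <= i <oo) u i = \sum_(0 <= i <oo) u i.
  move=> u0 um; rewrite (@nneseries_split _ u 0%N m)// big_nat big1 ?add0e ?add0n//.
have gm i : (i < m)%N -> g i = cst 0.
  by move=> im; apply/funext => w; rewrite /g leqNgt im.
have -> : (fun w => \sum_(m <= i <oo) f i w) = (fun w => \sum_(0 <= i <oo) g i w).
  apply/funext => w; rewrite -from0//; last by move=> i /gm ->.
  congr (limn _); apply/funext => N.
  by apply: eq_big_nat => i /andP[mi _]; rewrite /g mi.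
split.
- by apply: ge0_emeasurable_sum.
- by move=> w; apply: nneseries_ge0.
rewrite integral_nneseries//.
have ig0 i : 0 <= \int[P]_w g i w by exact: integral_ge0.
rewrite -from0//; last by move=> i /gm ->; rewrite integral0.
apply: lime_le; first by apply: is_cvg_nneseries.
apply: nearW => N; apply: (@le_trans _ _ ((\sum_(m <= i < N) c i)%:E)); last by rewrite lee_fin.
rewrite -sumEFin big_nat [leRHS]big_nat; apply: lee_sum => i /andP[mi _].
by have [_ _] := hg i; rewrite mi.
Qed.

(* [F] is not assumed measurable: its integral is then a lower integral. *)
Lemma integral_le_bad_event (F H : T -> \bar R) c c' : (0 <= c')%R ->
  (forall w, 0 <= F w <= 1) -> mean_le H c ->
  {ae P, forall w, H w <= 1 -> F w <= c'%:E} ->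
  \int[P]_w F w <= (c + c')%:E.
Proof.
move=> c'0 F01 hH [N [mN N0 hN]].
have [mH H0 Hc] := hH.
(* A measurable majorant of [F]: where [H <= 1] off the null set, [c'] suffices; where [H > 1],
   [F <= 1 < H]; on the null set the indicator suffices. *)
pose G w := (H w + c'%:E) + (\1_N w)%:E.
have c'0' : 0 <= c'%:E :> \bar R by rewrite lee_fin.
have I0 w : 0 <= (\1_N w)%:E :> \bar R by rewrite lee_fin.
have Hc0 w : 0 <= H w + c'%:E by exact: adde_ge0.
have mI : measurable_fun setT (fun w => (\1_N w)%:E : \bar R).
  by apply/measurable_EFinP; exact: measurable_indic.
have mHc : measurable_fun setT (fun w => H w + c'%:E) by exact: emeasurable_funD.
have mG : measurable_fun setT G by exact: emeasurable_funD.
have FG w : F w <= G w.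
  have /andP[F0 F1] := F01 w.
  have [wN|wN] := pselect (N w).
    by apply: (le_trans F1); rewrite /G indicE mem_set//= leeDr.
  rewrite /G indicE memNset// adde0.
  have [H1|H1] := leP (H w) 1.
    have Fc : F w <= c'%:E.
      by apply: contrapT => /= nF; apply: wN; apply: hN => /= h; apply: nF; exact: h.
    by apply: (le_trans Fc); rewrite leeDr.
  by apply: (le_trans F1); apply: (le_trans (ltW H1)); rewrite leeDl.
apply: (@le_trans _ _ (\int[P]_w G w)).
  (* Unfolded as suprema over simple functions from below, the integrals are monotone without
     measurability of [F]. *)
  rewrite ge0_integralTE//; last by move=> w; have /andP[] := F01 w.
  rewrite ge0_integralTE//; last by move=> w; exact: adde_ge0.
  apply: ereal_sup_le => _ [h hF <-].
  by exists h => // w; apply: le_trans (FG w); exact: hF.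
rewrite ge0_integralD// integral_indic// setIT [X in _ + X]N0 adde0.
by case: (mean_leD hH (mean_le_cst c'0)).
Qed.

End mean_le.

(** * Second moments of linear and centred quadratic forms *)

Section second_moments.
Context d (T : measurableType d) (R : realType) (P : probability T R).
Variables (Z : nat -> T -> R) (hZ : iid_std_normal P Z).

Let mZ i : measurable_fun setT (Z i). Proof. exact: measurable_iid hZ i. Qed.

Lemma integrable_dom (f g : T -> R) : measurable_fun setT f ->
  P.-integrable setT (EFin \o g) -> (forall w, `|f w| <= g w) ->
  P.-integrable setT (EFin \o f).
Proof.
move=> mf ig fg; apply: (le_integrable measurableT _ _ ig).
  exact/measurable_EFinP.
move=> w _ /=; rewrite lee_fin; apply: (le_trans (fg w)); exact: ler_norm.
Qed.

Lemma iid_sqr_integrable i : P.-integrable setT (fun w => (Z i w ^+ 2)%:E).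
Proof.
apply/integrableP; split.
  by apply/measurable_EFinP; apply: measurable_funX.
under eq_integral do rewrite gee0_abs ?lee_fin ?sqr_ge0//.
by rewrite (iid_sqr_mean hZ) ltry.
Qed.

Lemma iid_centered_sqr_mean0 i : (\int[P]_w (Z i w ^+ 2 - 1)%:E = 0)%E.
Proof.
under eq_integral do rewrite EFinB.
rewrite integralB//=.
- by rewrite (iid_sqr_mean hZ) integral_probability1 subee.
- exact: iid_sqr_integrable.
- exact: finite_measure_integrable_cst.
Qed.

Lemma iid_centered_sqr_moment i : (\int[P]_w ((Z i w ^+ 2 - 1) ^+ 2)%:E <= 65%:E)%E.
Proof.
apply: (@le_trans _ _ (\int[P]_w ((Z i w ^+ 4)%:E + 1))%E).
  apply: ge0_le_integral => //.
  - by move=> w _; rewrite lee_fin sqr_ge0.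
  - apply/measurable_EFinP; apply: measurable_funX.
    by apply: measurable_funB => //; apply: measurable_funX.
  - by apply: emeasurable_funD => //; apply/measurable_EFinP; apply: measurable_funX.
  - move=> w _; rewrite -EFinD lee_fin; have := sqr_ge0 (Z i w).
    have -> : Z i w ^+ 4 = (Z i w ^+ 2) ^+ 2 by rewrite -exprM.
    lra.
rewrite ge0_integralD//.
- rewrite integral_probability1; have := iid_pow4_le hZ i => /leeD2r h.
  by apply: (le_trans (h 1%E)); rewrite -EFinD lee_fin; lra.
- by move=> w _; rewrite lee_fin exprn_even_ge0.
- by apply/measurable_EFinP; apply: measurable_funX.
Qed.

Section orthogonal_sum.
Variables (g : R -> R) (v : R).
Hypotheses (mg : measurable_fun [set: R] g).
Hypothesis g0 : forall i, (\int[P]_w (g (Z i w))%:E = 0)%E.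
Hypothesis gv : forall i, (\int[P]_w (g (Z i w) ^+ 2)%:E <= v%:E)%E.

Let mgZ i : measurable_fun setT (fun w => g (Z i w)).
Proof. exact: measurableT_comp. Qed.

Let g2 i : P.-integrable setT (fun w => (g (Z i w) ^+ 2)%:E).
Proof.
apply/integrableP; split; first by apply/measurable_EFinP; apply: measurable_funX.
under eq_integral do rewrite gee0_abs ?lee_fin ?sqr_ge0//.
by apply: le_lt_trans (gv i) _; rewrite ltry.
Qed.

Let gg i j : P.-integrable setT (fun w => (g (Z i w) * g (Z j w))%:E).
Proof.
apply: (@integrable_dom _ (fun w => g (Z i w) ^+ 2 + g (Z j w) ^+ 2)).
- exact: measurable_funM.
- have -> : EFin \o (fun w => g (Z i w) ^+ 2 + g (Z j w) ^+ 2) =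
    ((fun w => (g (Z i w) ^+ 2)%:E) \+ (fun w => (g (Z j w) ^+ 2)%:E))%E by [].
  exact: integrableD.
- by move=> w; rewrite ler_norml; nra.
Qed.

Lemma orthogonal_cross (c : nat -> R) i s : i \notin s ->
  P.-integrable setT (fun w => (g (Z i w) * \sum_(j <- s) c j * g (Z j w))%:E) /\
  (\int[P]_w (g (Z i w) * \sum_(j <- s) c j * g (Z j w))%:E = 0)%E.
Proof.
elim: s => [|j s IH].
  move=> _; under eq_fun do rewrite big_nil mulr0.
  split; first exact: integrable0.
  by rewrite integral0.
rewrite inE negb_or => /andP[ij /IH [I1 I2]].
have E : (fun w => (g (Z i w) * \sum_(k <- j :: s) c k * g (Z k w))%:E) =
  ((fun w => (c j)%:E * (g (Z i w) * g (Z j w))%:E) \+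
   (fun w => (g (Z i w) * \sum_(k <- s) c k * g (Z k w))%:E))%E.
  by apply/funext => w /=; rewrite big_cons -EFinM -EFinD; congr (_%:E); ring.
have I3 : P.-integrable setT (fun w => (c j)%:E * (g (Z i w) * g (Z j w))%:E)%E.
  exact: integrableZl.
rewrite E; split; first exact: integrableD.
rewrite (integralD measurableT I3 I1) I2 adde0 integralZl//.
rewrite (iid_orthogonal hZ ij mg (g0 i)) ?mule0//.
  by apply: le_lt_trans (gv i) _; rewrite ltry.
by apply: le_lt_trans (gv j) _; rewrite ltry.
Qed.

Lemma mean_le_sqr_sum (c : nat -> R) s : uniq s ->
  mean_le P (fun w => ((\sum_(i <- s) c i * g (Z i w)) ^+ 2)%:E)
    (v * \sum_(i <- s) c i ^+ 2).
Proof.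
have mS s' : measurable_fun setT (fun w => \sum_(i <- s') c i * g (Z i w)).
  by apply: measurable_sum => i; exact: measurable_funM.
move=> us; split.
- by apply/measurable_EFinP; apply: measurable_funX.
- by move=> w; rewrite lee_fin sqr_ge0.
elim: s us => [_|i s IH /= /andP[is_ us]].
  under eq_integral do rewrite big_nil expr0n/=.
  by rewrite integral0 big_nil mulr0.
have [I1 I2] := orthogonal_cross c is_.
have E w : ((\sum_(k <- i :: s) c k * g (Z k w)) ^+ 2)%:E =
   ((c i ^+ 2)%:E * (g (Z i w) ^+ 2)%:E + ((\sum_(k <- s) c k * g (Z k w)) ^+ 2)%:E +
    (2 * c i)%:E * (g (Z i w) * \sum_(k <- s) c k * g (Z k w))%:E)%E.
  by rewrite big_cons -!EFinM -!EFinD; congr (_%:E); ring.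
under eq_integral do rewrite E.
have IS : P.-integrable setT (fun w => ((\sum_(k <- s) c k * g (Z k w)) ^+ 2)%:E).
  apply/integrableP; split; first by apply/measurable_EFinP; apply: measurable_funX.
  under eq_integral do rewrite gee0_abs ?lee_fin ?sqr_ge0//.
  by apply: le_lt_trans (IH us) _; rewrite ltry.
have Ig : P.-integrable setT (fun w => (c i ^+ 2)%:E * (g (Z i w) ^+ 2)%:E)%E.
  exact: integrableZl.
have IgS := integrableD measurableT Ig IS.
have Ic : P.-integrable setT (fun w => (2 * c i)%:E *
   (g (Z i w) * \sum_(k <- s) c k * g (Z k w))%:E)%E by exact: integrableZl.
rewrite (integralD measurableT IgS Ic) (integralD measurableT Ig IS).
rewrite [X in (_ + X)%E]integralZl// I2 mule0 adde0 integralZl//.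
rewrite big_cons mulrDr EFinD; apply: leeD; last exact: IH.
have -> : (v * c i ^+ 2)%:E = ((c i ^+ 2)%:E * v%:E)%E by rewrite -EFinM mulrC.
by apply: lee_wpmul2l => //; rewrite lee_fin sqr_ge0.
Qed.

End orthogonal_sum.

Lemma mean_le_iid_sqr i : mean_le P (fun w => (Z i w ^+ 2)%:E) 1.
Proof.
split; first by apply/measurable_EFinP; apply: measurable_funX.
  by move=> w; rewrite lee_fin sqr_ge0.
by rewrite (iid_sqr_mean hZ).
Qed.

Lemma mean_le_centered_sqr_sum (c : nat -> R) s : uniq s ->
  mean_le P (fun w => ((\sum_(i <- s) c i * (Z i w ^+ 2 - 1)) ^+ 2)%:E)
    (65 * \sum_(i <- s) c i ^+ 2).
Proof.
apply: (@mean_le_sqr_sum (fun x => x ^+ 2 - 1)).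
- by apply: measurable_funB => //; apply: measurable_funX.
- exact: iid_centered_sqr_mean0.
- exact: iid_centered_sqr_moment.
Qed.

Lemma mean_le_linear_sqr_sum (c : nat -> R) s : uniq s ->
  mean_le P (fun w => ((\sum_(i <- s) c i * Z i w) ^+ 2)%:E)
    (\sum_(i <- s) c i ^+ 2).
Proof.
move=> us; rewrite -[X in mean_le _ _ X]mul1r.
apply: (@mean_le_sqr_sum id) => //.
- exact: iid_mean0 hZ.
- by move=> i; rewrite (iid_sqr_mean hZ).
Qed.

End second_moments.

(** Integral comparison in discrete form: once [z^-1 k^(-z)], the integral of the tail, is added,
    the partial sums are nonincreasing. With [y = x + 1] the step is [(y/x)^z >= 1 + z/y]. *)
Lemma zeta_sum_le (R : realType) (z : R) N : 0 < z ->
  \sum_(1 <= i < N) (i%:R `^ (- (1 + z))) <= 1 + z^-1.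
Proof.
move=> z0.
suff H k : \sum_(1 <= i < k.+2) (i%:R `^ (- (1 + z))) + z^-1 * k.+1%:R `^ (- z) <= 1 + z^-1.
  have zi : 0 <= z^-1 by rewrite invr_ge0 ltW.
  have [N2|N2] := leqP N 1; first by rewrite big_geq// addr_ge0.
  have -> : N = (N - 2).+2 by case: N N2 => [|[|N]]// _; rewrite !subSS subn0.
  by apply: (le_trans _ (H (N - 2)%N)); rewrite lerDl mulr_ge0 ?powR_ge0.
elim: k => [|k IH]; first by rewrite big_nat1 !powR1 mulr1.
rewrite big_nat_recr//=; apply: le_trans IH.
rewrite -addrA lerD2l.
have k1 : 0 < k.+1%:R :> R by rewrite ltr0n.
have k2 : 0 < k.+2%:R :> R by rewrite ltr0n.
set y := k.+2%:R in k2 *; set x := k.+1%:R in k1 *.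
have yx : y = x + 1 by rewrite /y -natr1.
have h : 1 + z / y <= (y / x) `^ z.
  rewrite /powR gt_eqF ?divr_gt0//; apply: le_trans (expR_ge1Dx _).
  rewrite lerD2l; apply: ler_wpM2l; first exact: ltW.
  have := ln_ge1BV (divr_gt0 k2 k1); rewrite invf_div; apply: le_trans.
  have -> : x = y - 1 by rewrite yx addrK.
  by rewrite le_eqVlt; apply/orP; left; apply/eqP; field; rewrite gt_eqF.
have py : 0 < y `^ (- z) by rewrite powR_gt0.
have e1 : x `^ (- z) = y `^ (- z) * (y / x) `^ z.
  rewrite powRM ?invr_ge0 ?ltW// mulrA -powRD_gt0// addNr powRr0 mul1r.
  by rewrite -[x^-1]powR_inv1 ?ltW// -powRrM mulN1r.
have e2 : y `^ (- (1 + z)) = y^-1 * y `^ (- z).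
  by rewrite opprD powRD_gt0// powR_inv1// ltW.
rewrite e1 e2.
have := ler_wpM2l (ltW py) h.
have zi : 0 < z^-1 by rewrite invr_gt0.
move=> /(ler_wpM2l (ltW zi)); apply: le_trans.
by rewrite le_eqVlt; apply/orP; left; apply/eqP; field; rewrite !gt_eqF.
Qed.

(** * Chebyshev bounds for the noise, and an envelope of the tail free of [alpha] *)

Section fluctuations.
Context (R : realType) (p C : R) (kappa : nat -> R).
Hypotheses (hp : 0 <= p) (hC : 1 <= C).
Hypothesis hkappa : forall i : nat, (0 < i)%N ->
     C^-1 * (i%:R `^ (- p)) <= kappa i /\ kappa i <= C * (i%:R `^ (- p)).
Variables (n : nat) (n0 : (0 < n)%N).
Context d (T : measurableType d) (P : probability T R).
Variables (Z : nat -> T -> R) (hZ : iid_std_normal P Z).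
Local Notation a := (shrink kappa n).
Local Notation D := (complexity kappa n).

Let mZ i : measurable_fun setT (Z i). Proof. exact: measurable_iid hZ i. Qed.
Let C0 : 0 < C. Proof. exact: lt_le_trans hC. Qed.
Let nR0 : 0 < n%:R :> R. Proof. by rewrite ltr0n. Qed.
Let C2 : 1 <= C ^+ 2. Proof. exact: exprn_ege1. Qed.

Lemma measurable_fluct I al th :
  measurable_fun setT (fun w => fluct kappa n I al th (Z^~ w)).
Proof.
apply: measurable_sum => i; apply: measurable_funB.
  by apply: measurable_funM => //; apply: measurable_funB => //; apply: measurable_funX.
by apply: measurable_funM.
Qed.

(** The quadratic and linear parts contribute [2 * 65 a^2] and [8 (1-a)^2 th^2], to be compared with
    [a^2/4 + (1-a) th^2]; 520 is [4 * 130]. *)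
Lemma mean_le_fluct I al th :
  mean_le P (fun w => (fluct kappa n I al th (Z^~ w) ^+ 2)%:E) (520 * D I al th).
Proof.
pose A w := \sum_(1 <= i < I) a al i * (Z i w ^+ 2 - 1).
pose B w := \sum_(1 <= i < I) (2 * (1 - a al i) * th i) * Z i w.
have us : uniq (index_iota 1 I) by exact: iota_uniq.
have mA := mean_le_centered_sqr_sum hZ (a al) us.
have mB := mean_le_linear_sqr_sum hZ (fun i => 2 * (1 - a al i) * th i) us.
have two : 0 <= 2 :> R by [].
have h := mean_leD (mean_leZ two mA) (mean_leZ two mB).
have h2 : mean_le P (fun w => (fluct kappa n I al th (Z^~ w) ^+ 2)%:E)
   (2 * (65 * \sum_(1 <= i < I) a al i ^+ 2) +
    2 * \sum_(1 <= i < I) (2 * (1 - a al i) * th i) ^+ 2).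
  apply: (mean_le_mono _ _ h).
    by apply/measurable_EFinP; apply: measurable_funX; exact: measurable_fluct.
  move=> w; rewrite lee_fin sqr_ge0/= -!EFinM -EFinD lee_fin.
  have -> : fluct kappa n I al th (Z^~ w) = A w - B w by rewrite /fluct sumrB.
  rewrite -/(A w) -/(B w); have := sqr_ge0 (A w + B w); lra.
apply: mean_le_weaken h2.
apply: (@le_trans _ _ (520 * \sum_(1 <= i < I) (a al i ^+ 2 / 4 + (1 - a al i) * th i ^+ 2))).
  rewrite !mulr_sumr -big_split/= big_seq [leRHS]big_seq; apply: ler_sum => i.
  rewrite mem_index_iota => /andP[i0 _].
  have d0 := shrinkC_gt0 hC hkappa n0 al i0.
  have d1 : 1 - a al i <= 1 by have := shrink_gt0 hC hkappa n0 al i0; lra.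
  have d2 : (1 - a al i) ^+ 2 <= 1 - a al i by nra.
  rewrite !exprMn; have := ler_wpM2r (sqr_ge0 (th i)) d2.
  have := mulr_ge0 (ltW d0) (sqr_ge0 (th i)); have := sqr_ge0 (a al i); lra.
by apply: ler_wpM2l; [exact: ler0n|exact: (complexity_ge_noise hC hkappa n0)].
Qed.

Lemma complexity_ge0 I al th : 0 <= D I al th.
Proof.
apply: le_trans (complexity_ge_noise hC hkappa n0 I al th).
rewrite big_seq sumr_ge0// => i; rewrite mem_index_iota => /andP[i0 _].
by rewrite addr_ge0 ?divr_ge0 ?sqr_ge0// mulr_ge0 ?sqr_ge0// ltW// (shrinkC_gt0 hC hkappa).
Qed.

(** Since [(x/4 + Delta)^2 >= x Delta], normalising by the threshold gives a bound free of [al] and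
    [th], which makes the union bound over the grid uniform over signals. *)
Lemma mean_le_fluct_ratio I al th Delta : 0 < Delta ->
  mean_le P (fun w => ((D I al th / 4 + Delta) ^- 2 * fluct kappa n I al th (Z^~ w) ^+ 2)%:E)
    (520 / Delta).
Proof.
move=> D0; have c0 := complexity_ge0 I al th.
set x := D I al th in c0 *.
have k0 : 0 < x / 4 + Delta by lra.
have h := mean_leZ (ltW (_ : 0 < (x / 4 + Delta) ^- 2)) (mean_le_fluct I al th).
apply: mean_le_weaken (h _); last by rewrite invr_gt0 exprn_gt0.
rewrite -/x mulrC ler_pdivrMr ?exprn_gt0// mulrAC ler_pdivlMr//.
have := sqr_ge0 (x / 4 - Delta); have := sqr_ge0 x; nra.
Qed.

Lemma fluct_ratio_le (x k f : R) : 0 < k -> k ^- 2 * f ^+ 2 <= 1 -> `|f| <= k.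
Proof.
move=> k0; rewrite mulrC ler_pdivrMr ?exprn_gt0// mul1r => h.
by rewrite -(@ler_pXn2r _ 2)// ?nnegrE ?(ltW k0)// real_normK// num_real.
Qed.

(** The ratio [n / t_i] at [al = 0]. For general [al] it is multiplied by [i^(-2 al)], so the
    leading tail term is a monotone weight times a sequence free of [al]. *)
Definition tail_c i : R := n%:R * kappa i ^+ 2 / i%:R.

(** Bounds what remains of a likelihood term once its leading part is removed. The factors [n^2] and
    [n^-2] split the cross term of [th] and [z]: far out [tail_c] is small enough to absorb [n^2],
    and [n^-2] compensates the factor n in the squared signal. *)
Definition tail_q (th z : nat -> R) i : R :=
  tail_c i ^+ 2 * (1 + z i ^+ 2) + tail_c i * th i ^+ 2 +
  (n%:R ^+ 2 * tail_c i ^+ 2 * z i ^+ 2 + n%:R ^- 2 * th i ^+ 2).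

Lemma tail_c_gt0 i : (0 < i)%N -> 0 < tail_c i.
Proof.
move=> i0; rewrite /tail_c divr_gt0 ?ltr0n// mulr_gt0// exprn_gt0//.
exact: (kappa_gt0 hC hkappa).
Qed.

Lemma kappa_sqr_le i : (0 < i)%N -> kappa i ^+ 2 <= C ^+ 2.
Proof.
move=> i0; have [_ h] := hkappa i0; have k0 := kappa_gt0 hC hkappa i0.
rewrite ler_pXn2r ?nnegrE ?(ltW k0) ?(ltW C0)//; apply: (le_trans h).
rewrite -[leRHS]mulr1; apply: ler_wpM2l; first exact: ltW.
by rewrite -[leRHS](powRr0 (i%:R : R)); apply: ler_powR; rewrite ?ler1n// oppr_le0.
Qed.

Lemma tail_c_le i : (0 < i)%N -> tail_c i <= C ^+ 2 * n%:R / i%:R.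
Proof.
move=> i0; rewrite /tail_c ler_wpM2r// mulrC ler_wpM2r//.
exact: kappa_sqr_le.
Qed.

Lemma lik_term_approx al th z i : 0 <= al -> (0 < i)%N ->
  `|lik_term kappa n al (fun i => th i + z i) i +
     i%:R `^ (- (2 * al)) * (tail_c i * (z i ^+ 2 - 1))| <= tail_q th z i.
Proof.
move=> al0 i0; have iR : 0 < i%:R :> R by rewrite ltr0n.
have t0 := tcoef_gt0 hC hkappa al i0; have k0 := kappa_gt0 hC hkappa i0.
have c0 := tail_c_gt0 i0.
set l := n%:R / tcoef kappa al i.
have lE : l = i%:R `^ (- (2 * al)) * tail_c i.
  rewrite /l /tcoef /tail_c powRD_gt0// powRr1 ?ltW// powRN.
  by field; rewrite !gt_eqF// powR_gt0.
have l0 : 0 < l by rewrite divr_gt0.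
have lc : l <= tail_c i.
  rewrite lE ler_piMl ?(ltW c0)// -[leRHS](powRr0 i%:R); apply: ler_powR.
    by rewrite ler1n.
  by rewrite oppr_le0 mulr_ge0.
rewrite mulrA -lE /lik_term (shrinkE hC hkappa n0 al i0) -/l.
set b := l / (1 + l); set c := tail_c i in c0 lc *.
have b0 : 0 <= b by rewrite divr_ge0//; lra.
have l1 : 0 < 1 + l by lra.
have bl : b <= l by rewrite ler_pdivrMr//; nra.
have lb : l - b <= l ^+ 2.
  have -> : l - b = l ^+ 2 / (1 + l) by rewrite /b; field; rewrite gt_eqF.
  rewrite ler_pdivrMr//; have := sqr_ge0 l; nra.
have h := ln1D_dist (ltW l0).
have l2 : l ^+ 2 <= c ^+ 2 by rewrite ler_pXn2r// nnegrE ?(ltW l0) ?(ltW c0).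
set x := th i; set y := z i.
(* The first two summands are of second order in [l]; the other two are of first order but carry the
   summable signal. *)
have -> : ln (1 + l) - b * (x + y) ^+ 2 + l * (y ^+ 2 - 1) =
   (ln (1 + l) - l) + (l - b) * y ^+ 2 - b * x ^+ 2 - b * (2 * x * y) by ring.
have y2 := sqr_ge0 y; have x2 := sqr_ge0 x.
have e1 : `|(l - b) * y ^+ 2| <= c ^+ 2 * y ^+ 2.
  have z0 : 0 <= (l - b) * y ^+ 2 by apply: mulr_ge0 => //; lra.
  by rewrite (ger0_norm z0); apply: ler_wpM2r => //; exact: le_trans l2.
have e2 : `|b * x ^+ 2| <= c * x ^+ 2.
  have z0 : 0 <= b * x ^+ 2 by exact: mulr_ge0.
  by rewrite (ger0_norm z0); apply: ler_wpM2r => //; exact: le_trans lc.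
have e3 : `|b * (2 * x * y)| <= n%:R ^+ 2 * c ^+ 2 * y ^+ 2 + n%:R ^- 2 * x ^+ 2.
  rewrite normrM (ger0_norm b0).
  apply: (@le_trans _ _ (c * `|2 * x * y|)).
    by apply: ler_wpM2r => //; exact: le_trans lc.
  rewrite -(ger0_norm (ltW c0)) -normrM (ger0_norm (ltW c0)).
  have -> : n%:R ^+ 2 * c ^+ 2 * y ^+ 2 + n%:R ^- 2 * x ^+ 2 =
    (n%:R * c * y) ^+ 2 + (x / n%:R) ^+ 2 by field; rewrite gt_eqF.
  have -> : c * (2 * x * y) = 2 * (n%:R * c * y) * (x / n%:R) by field; rewrite gt_eqF.
  rewrite ler_norml; have := sqr_ge0 (n%:R * c * y - x / n%:R).
  have := sqr_ge0 (n%:R * c * y + x / n%:R); lra.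
rewrite /tail_q -/x -/y -/c.
apply: (le_trans (ler_normB _ _)); apply: lerD e3.
apply: (le_trans (ler_normB _ _)); apply: lerD e2.
apply: (le_trans (ler_normD _ _)); rewrite mulrDr mulr1; apply: lerD e1.
exact: le_trans l2.
Qed.

(* The first two terms bound the modulus of the block sum [b], since
   [2 `|b| <= s + s^-1 b^2] at [s = l^-2]; the next one bounds the square of
   the sum of the moduli, by Cauchy-Schwarz on at most [7 l^2] indices. *)
Definition tail_h (th z : nat -> R) l : R :=
  l%:R ^- 2 + l%:R ^+ 2 * (\sum_(l ^ 3 <= i < l.+1 ^ 3) tail_c i * (z i ^+ 2 - 1)) ^+ 2
  + 7 * l%:R ^+ 2 * \sum_(l ^ 3 <= i < l.+1 ^ 3) (tail_c i * (z i ^+ 2 - 1)) ^+ 2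
  + \sum_(l ^ 3 <= i < l.+1 ^ 3) tail_q th z i.

Lemma cube_block_size l : (0 < l)%N -> (l.+1 ^ 3 - l ^ 3 <= 7 * l ^ 2)%N.
Proof.
case: l => // l _.
rewrite leq_subLR -(@ler_nat R) natrD [X in _ <= _ + X]natrM !natrX.
have -> : l.+2%:R = l%:R + 2 :> R by rewrite -addn2 natrD.
have -> : l.+1%:R = l%:R + 1 :> R by rewrite natr1.
by have : 0 <= l%:R :> R by []; nra.
Qed.

Lemma sqr_sum_le (x : nat -> R) m N :
  (\sum_(m <= i < N) x i) ^+ 2 <= (N - m)%:R * \sum_(m <= i < N) x i ^+ 2.
Proof.
have [Nm|mN] := leqP N m.
  by rewrite !big_geq// expr0n mulr0.
rewrite -{1 3}(subnKC (ltnW mN)); elim: (N - m)%N => [|k IH].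
  by rewrite addn0 !big_geq// expr0n mulr0.
rewrite addnS !big_nat_recr ?leq_addr//=; set S := \sum_(_ <= _ < _) x _ in IH *.
set S2 := \sum_(_ <= _ < _) x _ ^+ 2 in IH *; set y := x _.
have S20 : 0 <= S2 by apply: sumr_ge0 => i _; exact: sqr_ge0.
rewrite -[k.+1%:R]natr1.
have [k0|k0] := posnP k.
  subst k; move: IH; rewrite mul0r => IH.
  have S0 : S = 0 by apply/eqP; rewrite -sqrf_eq0 eq_le IH sqr_ge0.
  by rewrite S0 add0r add0r mul1r lerDr.
have kR : 0 < k%:R :> R by rewrite ltr0n.
have h : 2 * S * y <= S2 + k%:R * y ^+ 2.
  have : S ^+ 2 / k%:R <= S2 by rewrite ler_pdivrMr// mulrC.
  have : 0 <= (S / k%:R - y) ^+ 2 * k%:R by rewrite mulr_ge0 ?sqr_ge0// ltW.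
  have -> : (S / k%:R - y) ^+ 2 * k%:R = S ^+ 2 / k%:R - 2 * S * y + k%:R * y ^+ 2.
    by field; rewrite gt_eqF.
  lra.
lra.
Qed.

Lemma block_ge l i : (0 < l)%N -> (l ^ 3 <= i)%N -> (0 < i)%N.
Proof. by move=> l0; apply: leq_trans; rewrite expn_gt0 l0. Qed.

Lemma tail_q_ge0 th z i : (0 < i)%N -> 0 <= tail_q th z i.
Proof.
move=> i0; have c0 := ltW (tail_c_gt0 i0).
have y0 := sqr_ge0 (z i); have x0 := sqr_ge0 (th i); have cc := sqr_ge0 (tail_c i).
have m0 := sqr_ge0 (n%:R : R); have mi : 0 <= n%:R ^- 2 :> R by rewrite invr_ge0.
apply: addr_ge0; apply: addr_ge0; apply: mulr_ge0 => //; first by rewrite addr_ge0.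
exact: mulr_ge0.
Qed.

Lemma tail_h_ge th z l : (0 < l)%N -> 
  [/\ `|\sum_(l ^ 3 <= i < l.+1 ^ 3) tail_c i * (z i ^+ 2 - 1)| <= tail_h th z l,
      (\sum_(l ^ 3 <= i < l.+1 ^ 3) `|tail_c i * (z i ^+ 2 - 1)|) ^+ 2 <= tail_h th z l &
      \sum_(l ^ 3 <= i < l.+1 ^ 3) tail_q th z i <= tail_h th z l].
Proof.
move=> l0; have lR : 0 < l%:R :> R by rewrite ltr0n.
rewrite /tail_h; set b := \sum_(_ <= _ < _) _ * _; set q := \sum_(_ <= _ < _) tail_q _ _ _.
set e := \sum_(_ <= _ < _) _ ^+ 2.
have q0 : 0 <= q.
  by apply: sum_nat_ge0 => i li; apply: tail_q_ge0; exact: block_ge li.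
have e0 : 0 <= e by apply: sumr_ge0 => i _; exact: sqr_ge0.
have e0' : 0 <= 7 * l%:R ^+ 2 * e by rewrite mulr_ge0// mulr_ge0// sqr_ge0.
have b0 : 0 <= l%:R ^+ 2 * b ^+ 2 by rewrite mulr_ge0 ?sqr_ge0.
have s0 : 0 <= l%:R ^- 2 :> R by rewrite invr_ge0 sqr_ge0.
split.
- have h : `|b| <= l%:R ^- 2 + l%:R ^+ 2 * b ^+ 2.
    have -> : l%:R ^- 2 + l%:R ^+ 2 * b ^+ 2 = (l%:R^-1) ^+ 2 + (l%:R * b) ^+ 2.
      by rewrite exprVn exprMn.
    have bE : b = l%:R^-1 * (l%:R * b) by field; rewrite gt_eqF.
    rewrite {1}bE; set u := l%:R^-1; set v := l%:R * b.
    rewrite ler_norml; have := sqr_ge0 (u - v); have := sqr_ge0 (u + v).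
    have := sqr_ge0 u; have := sqr_ge0 v; lra.
  lra.
- apply: (@le_trans _ _ (7 * l%:R ^+ 2 * e)); last lra.
  apply: (le_trans (sqr_sum_le _ _ _)).
  have -> : \sum_(l ^ 3 <= i < l.+1 ^ 3) `|tail_c i * (z i ^+ 2 - 1)| ^+ 2 = e.
    by apply: eq_bigr => i _; rewrite real_normK// num_real.
  rewrite ler_wpM2r// -natrX -natrM ler_nat; exact: cube_block_size.
- lra.
Qed.

End fluctuations.

Lemma sum_inv_sqr_le (R : realType) (m N : nat) : (0 < m)%N ->
  \sum_(m <= l < N) (l%:R ^- 2 : R) <= 2 / m%:R.
Proof.
move=> m0; have mR : 0 < m%:R :> R by rewrite ltr0n.
have [Nm|mN] := leqP N m; first by rewrite big_geq// divr_ge0.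
suff : \sum_(m <= l < N) (l%:R ^- 2 : R) <= 2 / m%:R - 2 / N%:R.
  move=> h; apply: (le_trans h); rewrite lerBlDr lerDl divr_ge0//.
rewrite -(subnKC (ltnW mN)); elim: (N - m)%N => [|k IH].
  by rewrite addn0 big_geq// subrr.
rewrite addnS big_nat_recr ?leq_addr//=; apply: (le_trans (lerD IH (lexx _))).
rewrite -[(m + k).+1%:R]natr1; set x := (m + k)%:R.
have x1 : 1 <= x by rewrite ler1n addn_gt0 m0.
have key : x ^- 2 <= 2 / x - 2 / (x + 1).
  rewrite -subr_ge0.
  have -> : 2 / x - 2 / (x + 1) - x ^- 2 = (x - 1) / (x ^+ 2 * (x + 1)).
    by field; rewrite !gt_eqF//; lra.
  have x0 : 0 <= x + 1 by lra.
  by rewrite divr_ge0 ?subr_ge0// mulr_ge0 ?sqr_ge0.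
move: (2 / m%:R) => y; lra.
Qed.

(** * Means of the tail envelope and of the posterior spread *)

Section tail_mean.
Context (R : realType) (p C : R) (kappa : nat -> R).
Hypotheses (hp : 0 <= p) (hC : 1 <= C).
Hypothesis hkappa : forall i : nat, (0 < i)%N ->
     C^-1 * (i%:R `^ (- p)) <= kappa i /\ kappa i <= C * (i%:R `^ (- p)).
Variables (n : nat) (n0 : (0 < n)%N).
Context d (T : measurableType d) (P : probability T R).
Variables (Z : nat -> T -> R) (hZ : iid_std_normal P Z).

Let mZ i : measurable_fun setT (Z i). Proof. exact: measurable_iid hZ i. Qed.
Let C0 : 0 < C. Proof. exact: lt_le_trans hC. Qed.
Let nR0 : 0 < n%:R :> R. Proof. by rewrite ltr0n. Qed.
Let C2 : 1 <= C ^+ 2. Proof. exact: exprn_ege1. Qed.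
Local Notation c := (tail_c kappa n).

Lemma mean_le_tail_q th i : (0 < i)%N ->
  mean_le P (fun w => (tail_q kappa n th (Z^~ w) i)%:E)
    (3 * n%:R ^+ 2 * c i ^+ 2 + (c i + n%:R ^- 2) * th i ^+ 2).
Proof.
move=> i0; have c0 := tail_c_gt0 hC hkappa n0 i0.
have n1 : 1 <= n%:R :> R by rewrite ler1n.
have n2 : 1 <= n%:R ^+ 2 :> R by exact: exprn_ege1.
have k1 : 0 <= (1 + n%:R ^+ 2) * c i ^+ 2 by rewrite mulr_ge0 ?sqr_ge0//; lra.
have k2 : 0 <= c i ^+ 2 + (c i + n%:R ^- 2) * th i ^+ 2.
  by rewrite addr_ge0 ?sqr_ge0// mulr_ge0 ?sqr_ge0// addr_ge0 ?invr_ge0 ?sqr_ge0// ltW.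
have h := mean_leD (mean_leZ k1 (mean_le_iid_sqr hZ i)) (mean_le_cst P k2).
have E : (fun w => (tail_q kappa n th (Z^~ w) i)%:E) =
  (fun w => ((1 + n%:R ^+ 2) * c i ^+ 2)%:E * (Z i w ^+ 2)%:E +
     (c i ^+ 2 + (c i + n%:R ^- 2) * th i ^+ 2)%:E)%E.
  by apply/funext => w; rewrite -EFinM -EFinD /tail_q; congr (_%:E); ring.
rewrite E; apply: mean_le_weaken h; have := sqr_ge0 (c i).
move=> cc; have := ler_wpM2r cc n2; lra.
Qed.

Lemma block_c_le l i : (0 < l)%N -> (l ^ 3 <= i)%N -> c i <= C ^+ 2 * n%:R / l%:R ^+ 3.
Proof.
move=> l0 li; have i0 := block_ge l0 li.
apply: (le_trans (tail_c_le hp hC hkappa n i0)).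
apply: ler_wpM2l; first by rewrite mulr_ge0 ?sqr_ge0.
by rewrite lef_pV2 ?posrE ?exprn_gt0 ?ltr0n// -natrX ler_nat.
Qed.

Lemma block_c_sqr_le l : (0 < l)%N ->
  \sum_(l ^ 3 <= i < l.+1 ^ 3) c i ^+ 2 <= 7 * C ^+ 4 * n%:R ^+ 2 / l%:R ^+ 4.
Proof.
move=> l0; have lR : 0 < l%:R :> R by rewrite ltr0n.
apply: (@le_trans _ _ (\sum_(l ^ 3 <= i < l.+1 ^ 3) (C ^+ 2 * n%:R / l%:R ^+ 3) ^+ 2)).
  rewrite big_seq [leRHS]big_seq; apply: ler_sum => i.
  rewrite mem_index_iota => /andP[li _].
  have c0 := tail_c_gt0 hC hkappa n0 (block_ge l0 li).
  have h := block_c_le l0 li.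
  by rewrite ler_pXn2r// nnegrE ?(ltW c0)// (le_trans (ltW c0) h).
rewrite big_const_nat iter_addr_0 -[leLHS]mulr_natr.
have h : (l.+1 ^ 3 - l ^ 3)%:R <= 7 * l%:R ^+ 2 :> R.
  by rewrite -natrX -natrM ler_nat; exact: cube_block_size.
have k0 : 0 <= (C ^+ 2 * n%:R / l%:R ^+ 3) ^+ 2 by exact: sqr_ge0.
apply: (@le_trans _ _ ((C ^+ 2 * n%:R / l%:R ^+ 3) ^+ 2 * (7 * l%:R ^+ 2))); first exact: ler_wpM2l.
by rewrite le_eqVlt; apply/orP; left; apply/eqP; field; rewrite gt_eqF.
Qed.

(** With [W = C^4 n^2 / l^2] the noise in the four parts costs at most
    [(1 + 455 + 3185 + 21) W = 3662 W], rounded up to [61 * 61]. On such blocks [tail_c] is at most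
    [C^2 / n^2], whence the coefficient of the signal. *)
Lemma mean_le_tail_h th l : (n <= l)%N ->
  mean_le P (fun w => (tail_h kappa n th (Z^~ w) l)%:E)
    ((61 * 61) * C ^+ 4 * n%:R ^+ 2 * l%:R ^- 2 +
     2 * C ^+ 2 * n%:R ^- 2 * \sum_(l ^ 3 <= i < l.+1 ^ 3) th i ^+ 2).
Proof.
move=> nl; have l0 : (0 < l)%N by exact: leq_trans nl.
have lR : 0 < l%:R :> R by rewrite ltr0n.
have nlR : n%:R <= l%:R :> R by rewrite ler_nat.
have n1 : 1 <= n%:R :> R by rewrite ler1n.
pose s := index_iota (l ^ 3) (l.+1 ^ 3).
have us : uniq s by exact: iota_uniq.
have h1 := mean_le_cst P (_ : 0 <= l%:R ^- 2 :> R).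
have h2 := mean_leZ (sqr_ge0 (l%:R : R)) (mean_le_centered_sqr_sum hZ c us).
have h3 : mean_le P (fun w => (7 * l%:R ^+ 2 * \sum_(i <- s) (c i * (Z i w ^+ 2 - 1)) ^+ 2)%:E)
    (7 * l%:R ^+ 2 * \sum_(i <- s) 65 * c i ^+ 2).
  have k0 : 0 <= 7 * l%:R ^+ 2 :> R by rewrite mulr_ge0 ?sqr_ge0.
  have hs : mean_le P (fun w => \sum_(i <- s) ((c i * (Z i w ^+ 2 - 1)) ^+ 2)%:E)%E
     (\sum_(i <- s) 65 * c i ^+ 2).
    apply: mean_le_sum => i _.
    have := mean_le_centered_sqr_sum hZ c (_ : uniq [:: i]).
    rewrite !big_seq1 => /(_ isT).
    by under eq_fun do rewrite big_seq1.
  have := mean_leZ k0 hs; under eq_fun do rewrite sumEFin -EFinM; exact.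
have h4 : mean_le P (fun w => (\sum_(i <- s) tail_q kappa n th (Z^~ w) i)%:E)
    (\sum_(i <- s) (3 * n%:R ^+ 2 * c i ^+ 2 + (c i + n%:R ^- 2) * th i ^+ 2)).
  under eq_fun do rewrite -sumEFin.
  apply: mean_le_sum => i; rewrite mem_index_iota => /andP[li _].
  exact: (mean_le_tail_q _ (block_ge l0 li)).
have := mean_leD (mean_leD (mean_leD (h1 _) h2) h3) h4.
under eq_fun do rewrite -EFinM -!EFinD.
move=> h; apply: mean_le_weaken (h _); last by rewrite invr_ge0 sqr_ge0.
have q1 := block_c_sqr_le l0; set S2 := \sum_(_ <= _ < _) _ in q1.
have q2 : \sum_(i <- s) (3 * n%:R ^+ 2 * c i ^+ 2 + (c i + n%:R ^- 2) * th i ^+ 2) <=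
   3 * n%:R ^+ 2 * S2 + 2 * C ^+ 2 * n%:R ^- 2 * \sum_(i <- s) th i ^+ 2.
  rewrite !mulr_sumr -big_split/= big_seq [leRHS]big_seq; apply: ler_sum => i.
  rewrite mem_index_iota => /andP[li _].
  rewrite lerD2l; apply: ler_wpM2r; first exact: sqr_ge0.
  have h5 : c i <= C ^+ 2 * n%:R ^- 2.
    apply: (le_trans (block_c_le l0 li)).
    apply: (@le_trans _ _ (C ^+ 2 * n%:R / n%:R ^+ 3)).
      apply: ler_wpM2l; first by rewrite mulr_ge0 ?sqr_ge0.
      rewrite lef_pV2 ?posrE ?exprn_gt0// ler_pXn2r// nnegrE//.
    by rewrite le_eqVlt; apply/orP; left; apply/eqP; field; rewrite gt_eqF.
  have h6 : 1 * n%:R ^- 2 <= C ^+ 2 * n%:R ^- 2.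
    by apply: ler_wpM2r => //; rewrite invr_ge0 sqr_ge0.
  lra.
rewrite -mulr_sumr -/S2.
have k : C ^+ 4 * n%:R ^+ 2 * l%:R ^- 2 * (n%:R ^+ 2 / l%:R ^+ 2) <= C ^+ 4 * n%:R ^+ 2 * l%:R ^- 2.
  apply: ler_piMr.
    by rewrite mulr_ge0 ?invr_ge0 ?sqr_ge0// mulr_ge0 ?sqr_ge0// exprn_ge0// ltW.
  by rewrite ler_pdivrMr ?exprn_gt0// mul1r ler_pXn2r// nnegrE.
have l2 : 0 < l%:R ^+ 2 :> R by rewrite exprn_gt0.
have j1 := ler_wpM2l (ltW l2) q1.
have j2 : n%:R ^+ 2 * S2 <= n%:R ^+ 2 * (7 * C ^+ 4 * n%:R ^+ 2 / l%:R ^+ 4).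
  by apply: ler_wpM2l => //; exact: sqr_ge0.
have e1 : l%:R ^+ 2 * (7 * C ^+ 4 * n%:R ^+ 2 / l%:R ^+ 4) = 7 * (C ^+ 4 * n%:R ^+ 2 * l%:R ^- 2).
  by field; rewrite gt_eqF.
have e2 : n%:R ^+ 2 * (7 * C ^+ 4 * n%:R ^+ 2 / l%:R ^+ 4) =
   7 * (C ^+ 4 * n%:R ^+ 2 * l%:R ^- 2 * (n%:R ^+ 2 / l%:R ^+ 2)).
  by field; rewrite gt_eqF.
rewrite e1 in j1; rewrite e2 in j2.
have k1 : l%:R ^- 2 <= C ^+ 4 * n%:R ^+ 2 * l%:R ^- 2.
  apply: ler_peMl; first by rewrite invr_ge0 ltW.
  have a1 : 1 <= C ^+ 4 by exact: exprn_ege1.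
  have a2 : 1 <= n%:R ^+ 2 :> R by exact: exprn_ege1.
  by rewrite -[leLHS]mulr1; apply: ler_pM.
apply: (@le_trans _ _ (l%:R ^- 2 + l%:R ^+ 2 * (65 * S2) + 7 * l%:R ^+ 2 * (65 * S2) +
   (3 * n%:R ^+ 2 * S2 + 2 * C ^+ 2 * n%:R ^- 2 * \sum_(i <- s) th i ^+ 2))).
  by rewrite lerD2l.
have V0 : 0 <= l%:R ^- 2 :> R by rewrite invr_ge0 ltW.
have -> : \sum_(l ^ 3 <= i < l.+1 ^ 3) th i ^+ 2 = \sum_(i <- s) th i ^+ 2 by [].
move: (\sum_(i <- s) th i ^+ 2) j1 j2 k k1 => TH.
have -> : 61 * 61 * C ^+ 4 * n%:R ^+ 2 / l%:R ^+ 2 = 61 * 61 * (C ^+ 4 * n%:R ^+ 2 / l%:R ^+ 2).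
  by ring.
move: (C ^+ 4 * n%:R ^+ 2 / l%:R ^+ 2) => W.
move: (W * (n%:R ^+ 2 / l%:R ^+ 2)) (l%:R ^- 2) V0 (2 * C ^+ 2 / n%:R ^+ 2 * TH) => W1 V V0 U.
move: (l%:R ^+ 2) (n%:R ^+ 2) V0 => L M; lra.
Qed.

(** Blocks from [n^3] on, that is indices from [n^9] on, make the sum of [l^-2], at most [2 n^-3],
    beat the factor [n^2]; the squared signal grows only like n, against [n^-2]. Both parts are
    [O(1/n)], and a constant is kept. *)
Lemma mean_le_tail mu S : (forall M, \sum_(1 <= i < M) mu i ^+ 2 <= S) ->
  mean_le P (fun w => \sum_(n ^ 3 <= l <oo)
     (tail_h kappa n (signal kappa n mu) (Z^~ w) l)%:E)%E
    ((2 * 61 * 61) * C ^+ 4 + 2 * C ^+ 4 * S).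
Proof.
move=> hS; have n3 : (0 < n ^ 3)%N by rewrite expn_gt0 n0.
have nn3 : (n <= n ^ 3)%N by rewrite -{1}(expn1 n) leq_pexp2l.
have n1 : 1 <= n%:R :> R by rewrite ler1n.
apply: mean_le_series => [l nl|N].
  exact: (mean_le_tail_h _ (leq_trans nn3 nl)).
rewrite big_split/= -!mulr_sumr; apply: lerD.
  have h := sum_inv_sqr_le R N n3.
  have k0 : 0 <= (61 * 61) * C ^+ 4 * n%:R ^+ 2.
    by rewrite mulr_ge0 ?sqr_ge0// mulr_ge0// exprn_ge0// ltW.
  apply: (le_trans (ler_wpM2l k0 h)); rewrite natrX.
  have -> : (61 * 61) * C ^+ 4 * n%:R ^+ 2 * (2 / n%:R ^+ 3) = (2 * 61 * 61) * C ^+ 4 * n%:R^-1.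
    by field; rewrite gt_eqF.
  apply: ler_piMr; first by rewrite mulr_ge0// exprn_ge0// ltW.
  by rewrite invf_le1.
have [Nn|nN] := leqP N (n ^ 3).
  rewrite big_geq// mulr0 mulr_ge0//; first by rewrite mulr_ge0// exprn_ge0// ltW.
  by apply: le_trans (hS 0%N); rewrite big_geq.
rewrite -(sum_cube_blocks (fun i => signal kappa n mu i ^+ 2) (ltnW nN)).
have L0 : (0 < (n ^ 3) ^ 3)%N by rewrite expn_gt0 n3.
have hs : \sum_((n ^ 3) ^ 3 <= i < N ^ 3) signal kappa n mu i ^+ 2 <= n%:R * C ^+ 2 * S.
  apply: (@le_trans _ _ (n%:R * C ^+ 2 * \sum_((n ^ 3) ^ 3 <= i < N ^ 3) mu i ^+ 2)).
    rewrite mulr_sumr big_seq [leRHS]big_seq; apply: ler_sum => i.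
    rewrite mem_index_iota => /andP[li _].
    rewrite /signal !exprMn sqr_sqrtr ?ler0n//; apply: ler_wpM2r; first exact: sqr_ge0.
    apply: ler_wpM2l => //; apply: (kappa_sqr_le hp hC hkappa).
    exact: leq_trans li.
  apply: ler_wpM2l; first by rewrite mulr_ge0 ?sqr_ge0.
  apply: le_trans (hS (N ^ 3)%N).
  rewrite [leRHS](big_cat_nat (n := ((n ^ 3) ^ 3)%N))//=; last by rewrite leq_exp2r// ltnW.
  by rewrite lerDr sumr_ge0// => i _; exact: sqr_ge0.
have k0 : 0 <= 2 * C ^+ 2 * n%:R ^- 2 by rewrite mulr_ge0 ?invr_ge0 ?sqr_ge0// mulr_ge0 ?sqr_ge0.
apply: (le_trans (ler_wpM2l k0 hs)).
have -> : 2 * C ^+ 2 * n%:R ^- 2 * (n%:R * C ^+ 2 * S) = 2 * C ^+ 4 * S * n%:R^-1.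
  by field; rewrite gt_eqF.
apply: ler_piMr; last by rewrite invf_le1.
rewrite mulr_ge0//; first by rewrite mulr_ge0// exprn_ge0// ltW.
by apply: le_trans (hS 0%N); rewrite big_geq.
Qed.

Lemma post_var_gt0 al i : (0 < i)%N -> 0 < post_var kappa n al i.
Proof.
move=> i0; have k0 := kappa_gt0 hC hkappa i0; have t0 := tcoef_gt0 hC hkappa al i0.
by rewrite /post_var divr_gt0 ?addr_gt0// invr_gt0 exprn_gt0.
Qed.

Lemma post_var_homo al be i : (0 < i)%N -> al <= be ->
  post_var kappa n be i <= post_var kappa n al i.
Proof.
move=> i0 ab; have k0 := kappa_gt0 hC hkappa i0; have t0 := tcoef_gt0 hC hkappa al i0.
have t1 := tcoef_gt0 hC hkappa be i0; have := tcoef_homo kappa i0 ab => h.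
rewrite /post_var; apply: ler_wpM2l; first by rewrite invr_ge0 sqr_ge0.
by rewrite lef_pV2 ?posrE ?addr_gt0// lerD2r.
Qed.

(** Below the cutoff the variance is at most [kappa_i^-2 / n], beyond it at most [kappa_i^-2 / t_i];
    the two regimes are joined through [n = J^ex]. The small [z] buys a summable factor at the price
    of [J^z], which requires [2 al >= z]. *)
Lemma post_var_le al z i : 0 < z -> z <= 2 * al -> (0 < i)%N ->
  post_var kappa n al i <=
  C ^+ 4 * cutoff p n al `^ (1 + 2 * p + z) / n%:R * i%:R `^ (- (1 + z)).
Proof.
move=> z0 zal i0; have k0 := kappa_gt0 hC hkappa i0; have t0 := tcoef_gt0 hC hkappa al i0.
have al0 : 0 <= al by lra.
have iR : 0 < i%:R :> R by rewrite ltr0n.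
set J := cutoff p n al; have J0 : 0 < J by exact: cutoff_gt0.
have [kk _] := hkappa i0.
have hk : kappa i ^- 2 <= C ^+ 2 * i%:R `^ (2 * p).
  have e0 : 0 < i%:R `^ (- p) :> R by rewrite powR_gt0.
  have -> : C ^+ 2 * i%:R `^ (2 * p) = (C^-1 * i%:R `^ (- p)) ^- 2.
    rewrite exprMn invfM exprVn invrK; congr (_ * _).
    by rewrite powRN exprVn invrK mulrC powRrM powR_mulrn ?powR_ge0.
  have c0 : 0 < C^-1 * i%:R `^ (- p) by rewrite mulr_gt0 ?invr_gt0.
  rewrite lef_pV2 ?posrE ?exprn_gt0// ler_pXn2r// nnegrE ltW//.
have C4 : 0 <= C ^+ 4 by rewrite exprn_ge0// ltW.
have C24 : C ^+ 2 <= C ^+ 4 by apply: ler_weXn2l.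
have i1 : i%:R `^ (2 * p) = i%:R `^ (1 + 2 * p + z) * i%:R `^ (- (1 + z)) :> R.
  by rewrite -powRD_gt0//; congr (_ `^ _); ring.
have Kz : 0 < 1 + 2 * p + z by move: hp z0; lra.
have [iJ|Ji] := leP i%:R J.
  apply: (@le_trans _ _ (C ^+ 2 * i%:R `^ (2 * p) / n%:R)).
    apply: ler_pM => //; rewrite ?invr_ge0 ?sqr_ge0//; first by rewrite addr_ge0// ltW.
    by rewrite lef_pV2 ?posrE ?addr_gt0// lerDr ltW.
  rewrite i1 mulrA mulrAC.
  apply: ler_wpM2r; first exact: powR_ge0.
  apply: ler_wpM2r; first by rewrite invr_ge0.
  apply: ler_pM => //; rewrite ?sqr_ge0 ?powR_ge0//.
  by apply: ge0_ler_powR; rewrite ?nnegrE ?(ltW iR) ?(ltW J0) ?(ltW Kz).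
have ht := tcoef_ge hC hkappa al i0.
have w0 : 0 < C ^- 2 * i%:R `^ (1 + 2 * al + 2 * p).
  by rewrite mulr_gt0 ?invr_gt0 ?exprn_gt0 ?powR_gt0.
apply: (@le_trans _ _ (C ^+ 2 * i%:R `^ (2 * p) / (C ^- 2 * i%:R `^ (1 + 2 * al + 2 * p)))).
  apply: ler_pM => //; rewrite ?invr_ge0 ?sqr_ge0//; first by rewrite addr_ge0// ltW.
  by rewrite lef_pV2 ?posrE ?addr_gt0// (le_trans ht)// lerDl.
have -> : C ^+ 2 * i%:R `^ (2 * p) / (C ^- 2 * i%:R `^ (1 + 2 * al + 2 * p)) =
   C ^+ 4 * (i%:R `^ (z - 2 * al)) * i%:R `^ (- (1 + z)).
  rewrite -[RHS]mulrA -powRD_gt0//.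
  have -> : z - 2 * al + - (1 + z) = 2 * p - (1 + 2 * al + 2 * p) by ring.
  have -> : i%:R `^ (2 * p - (1 + 2 * al + 2 * p)) = i%:R `^ (2 * p) / i%:R `^ (1 + 2 * al + 2 * p).
    by rewrite -powRN -powRD_gt0.
  by field; rewrite !gt_eqF// powR_gt0.
apply: ler_wpM2r; first exact: powR_ge0.
rewrite -[leRHS]mulrA; apply: ler_wpM2l => //.
have {1}-> : n%:R = J `^ (1 + 2 * al + 2 * p) by rewrite cutoff_ex.
rewrite -powRN -powRD_gt0//.
have -> : 1 + 2 * p + z + - (1 + 2 * al + 2 * p) = - (2 * al - z) by ring.
have -> : z - 2 * al = - (2 * al - z) by ring.
rewrite !powRN lef_pV2 ?posrE ?powR_gt0//.
by apply: ge0_ler_powR; rewrite ?nnegrE ?(ltW iR) ?(ltW J0) ?(ltW Ji)//; lra.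
Qed.

Lemma mean_le_post_var al z : 0 < z -> z <= 2 * al ->
  mean_le P (fun w => \sum_(1 <= i <oo) (post_var kappa n al i * Z i w ^+ 2)%:E)%E
    (C ^+ 4 * cutoff p n al `^ (1 + 2 * p + z) / n%:R * (1 + z^-1)).
Proof.
move=> z0 zal; apply: (@mean_le_series _ _ _ _ _ (post_var kappa n al)) => [i i0|N].
  have v0 := ltW (post_var_gt0 al i0).
  have := mean_leZ v0 (mean_le_iid_sqr hZ i); rewrite mulr1.
  by under eq_fun do rewrite -EFinM.
apply: (@le_trans _ _ (\sum_(1 <= i < N) C ^+ 4 * cutoff p n al `^ (1 + 2 * p + z) / n%:R *
    i%:R `^ (- (1 + z)))).
  rewrite big_seq [leRHS]big_seq; apply: ler_sum => i.
  by rewrite mem_index_iota => /andP[i0 _]; exact: post_var_le.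
rewrite -mulr_sumr; apply: ler_wpM2l; last exact: zeta_sum_le.
by rewrite divr_ge0// mulr_ge0 ?powR_ge0// exprn_ge0// ltW.
Qed.

End tail_mean.

Section markov.
Context d (T : measurableType d) (R : realType) (Q : probability T R).

Lemma mean_le_markov (g : T -> \bar R) c (A : set T) : measurable A ->
  (forall w, A w -> (1 <= g w)%E) -> mean_le Q g c -> (Q A <= c%:E)%E.
Proof.
move=> mA Ag [mg g0 gc]; apply: le_trans gc.
rewrite -[X in (Q X <= _)%E]setIT -integral_indic//.
apply: ge0_le_integral => //.
- by apply/measurable_EFinP; exact: measurable_indic.
- move=> w _; rewrite indicE; have [wA|wA] := boolP (w \in A); last exact: g0.
  by apply: Ag; rewrite inE in wA.
Qed.

End markov.

Lemma nneseries_partial_le (R : realType) (u : nat -> R) m (B : R) :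
  (forall i, (m <= i)%N -> 0 <= u i) ->
  (\sum_(m <= i <oo) (u i)%:E <= B%:E)%E -> forall N, \sum_(m <= i < N) u i <= B.
Proof.
move=> u0 hB N; rewrite -lee_fin -sumEFin; apply: le_trans hB.
by apply: nneseries_lim_ge => i mi _; rewrite lee_fin u0.
Qed.

(** * Contraction of the posterior *)

Section posterior.
Context (R : realType) (p C : R) (kappa : nat -> R).
Hypotheses (hp : 0 <= p) (hC : 1 <= C).
Hypothesis hkappa : forall i : nat, (0 < i)%N ->
     C^-1 * (i%:R `^ (- p)) <= kappa i /\ kappa i <= C * (i%:R `^ (- p)).
Variables (n : nat) (n0 : (0 < n)%N).

Let nR0 : 0 < n%:R :> R. Proof. by rewrite ltr0n. Qed.
Local Notation a := (shrink kappa n).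
Local Notation s := (post_var kappa n).

Definition post_dev (T T' : Type) (Z : nat -> T -> R) (W : nat -> T' -> R)
    (mu : nat -> R) al (w : T) (w' : T') i : R :=
  post_mean kappa n al (obs kappa Z n mu w) i + Num.sqrt (s al i) * W i w' - mu i.

(** The deviation is bias plus data noise plus posterior draw, and the squared coefficient of the
    data noise is [a s <= s]. Monotonicity of [s] replaces a random [al] by the fixed [al'] in both
    random parts, which removes the dependence between estimate and data. *)
Lemma post_dev_sqr_le (T T' : Type) (Z : nat -> T -> R) (W : nat -> T' -> R)
    mu al al' w w' i : (0 < i)%N -> al' <= al ->
  post_dev Z W mu al w w' i ^+ 2 <=
  3 * ((1 - a al i) ^+ 2 * mu i ^+ 2) +
  (3 * (s al' i * Z i w ^+ 2) + 3 * (s al' i * W i w' ^+ 2)).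
Proof.
move=> i0 alal; have k0 := kappa_gt0 hC hkappa i0; have t0 := tcoef_gt0 hC hkappa al i0.
have s0 := post_var_gt0 hC hkappa n0 al i0.
have ss := post_var_homo hC hkappa n0 i0 alal.
have a0 := shrink_gt0 hC hkappa n0 al i0.
have a1 := shrink_lt1 hC hkappa n0 al i0.
have sn : Num.sqrt n%:R != 0 :> R by rewrite gt_eqF// sqrtr_gt0.
set b := n%:R * (kappa i)^-1 / (tcoef kappa al i + n%:R) * (Num.sqrt n%:R)^-1.
have E : post_dev Z W mu al w w' i =
   - ((1 - a al i) * mu i) + b * Z i w + Num.sqrt (s al i) * W i w'.
  rewrite /post_dev /post_mean /obs /b /shrink; field.
  by rewrite sn gt_eqF ?addr_gt0// gt_eqF.
have b2 : b ^+ 2 = a al i * s al i.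
  rewrite /b /shrink /post_var !exprMn !exprVn sqr_sqrtr ?ler0n//; field.
  by rewrite !gt_eqF// addr_gt0.
have q2 : Num.sqrt (s al i) ^+ 2 = s al i by rewrite sqr_sqrtr// ltW.
rewrite E.
set x := (1 - a al i) * mu i; set y := b * Z i w; set v := Num.sqrt _ * _.
have hx : x ^+ 2 = (1 - a al i) ^+ 2 * mu i ^+ 2 by rewrite exprMn.
have hy : y ^+ 2 <= s al' i * Z i w ^+ 2.
  rewrite /y exprMn b2; apply: ler_wpM2r; first exact: sqr_ge0.
  apply: le_trans ss; rewrite -[leRHS]mul1r; apply: ler_wpM2r; exact: ltW.
have hv : v ^+ 2 <= s al' i * W i w' ^+ 2.
  by rewrite /v exprMn q2; apply: ler_wpM2r; first exact: sqr_ge0.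
rewrite -hx.
have := sqr_ge0 (x + y); have := sqr_ge0 (x + v); have := sqr_ge0 (y - v).
lra.
Qed.

Lemma loglik_lik_term (T : Type) (Z : nat -> T -> R) mu al w :
  loglik kappa n al (obs kappa Z n mu w) =
  - 2^-1 * limn (fun N => \sum_(1 <= i < N)
     lik_term kappa n al (fun i => signal kappa n mu i + Z i w) i).
Proof.
rewrite /loglik; apply: (congr1 (fun l : nat -> R => - 2^-1 * limn l)); apply/funext => N.
rewrite big_nat [RHS]big_nat; apply: eq_bigr => i /andP[i0 _].
rewrite /lik_term; congr (_ - _).
have t0 := tcoef_gt0 hC hkappa al i0.
have sn : Num.sqrt n%:R != 0 :> R by rewrite gt_eqF// sqrtr_gt0.
have -> : signal kappa n mu i + Z i w = Num.sqrt n%:R * obs kappa Z n mu w i.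
  by rewrite /signal /obs; field.
rewrite exprMn sqr_sqrtr ?ler0n// /shrink; field.
by rewrite gt_eqF// addr_gt0.
Qed.

Context d (T : measurableType d) (P : probability T R).
Variables (Z : nat -> T -> R) (hZ : iid_std_normal P Z).
Context d' (T' : measurableType d') (Q : probability T' R).
Variables (W : nat -> T' -> R) (hW : iid_std_normal Q W).

Lemma measurable_post_event mu al w r : 0 < r ->
  measurable [set w' | norm_ge (post_dev Z W mu al w w') r].
Proof.
move=> r0; have mW i : measurable_fun setT (W i) by exact: measurable_iid hW i.
have mx i : measurable_fun setT (fun w' => (post_dev Z W mu al w w' i ^+ 2)%:E).
  apply/measurable_EFinP; apply: measurable_funX; apply: measurable_funB => //.
  by apply: measurable_funD => //; apply: measurable_funM.
have ms : measurable_fun setT (fun w' => sqnorm (post_dev Z W mu al w w')).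
  have E : (fun w' => sqnorm (post_dev Z W mu al w w')) =
    (fun w' => \sum_(0 <= i <oo | (0 < i)%N) (post_dev Z W mu al w w' i ^+ 2)%:E)%E.
    apply/funext => w'; rewrite /sqnorm; apply/congr_lim/funext => N.
    have [->|N0] := posnP N; first by rewrite !big_geq.
    rewrite [RHS]big_ltn_cond//= [LHS]big_nat [RHS]big_nat_cond; apply: eq_bigl => i.
    by case: (0 < i)%N; rewrite ?andbT ?andbF.
  rewrite E; apply: ge0_emeasurable_sum => // i x _ _.
  by rewrite lee_fin sqr_ge0.
have -> : [set w' | norm_ge (post_dev Z W mu al w w') r] =
    setT `&` [set w' | ((r ^+ 2)%:E <= sqnorm (post_dev Z W mu al w w'))%E].
  rewrite setTI; apply/seteqP; split => w' /=; last by right.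
  by case=> //; rewrite leNgt r0.
exact: emeasurable_fun_c_infty.
Qed.

(** Bias and data noise each use at most [r^2 / 3], so on the event the posterior draw must supply
    the last third; Markov's inequality bounds the probability of that. *)
Lemma post_prob_le mu al al' B Vb r w : 0 < r -> al' <= al ->
  (forall N, \sum_(1 <= i < N) ((1 - a al i) ^+ 2 * mu i ^+ 2) <= B) ->
  9 * B <= r ^+ 2 ->
  ((9 / r ^+ 2)%:E * \sum_(1 <= i <oo) (s al' i * Z i w ^+ 2)%:E <= 1)%E ->
  mean_le Q (fun w' => \sum_(1 <= i <oo) (s al' i * W i w' ^+ 2)%:E)%E Vb ->
  (post_prob Q W kappa n al (obs kappa Z n mu w) mu r <= (9 / r ^+ 2 * Vb)%:E)%E.
Proof.
move=> r0 alal hB Br hZw hV.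
have r2 : 0 < r ^+ 2 by rewrite exprn_gt0.
have k0 : 0 <= 9 / r ^+ 2 by rewrite divr_ge0// ltW.
apply: (mean_le_markov _ _ (mean_leZ k0 hV)); first exact: measurable_post_event.
move=> w' /= hw.
have s0 i : (0 < i)%N -> 0 <= s al' i by move=> i0; exact/ltW/(post_var_gt0 hC hkappa n0).
have zz0 i : (0 < i)%N -> 0 <= s al' i * Z i w ^+ 2 by move=> /s0 h; rewrite mulr_ge0 ?sqr_ge0.
have ww0 i : (0 < i)%N -> 0 <= s al' i * W i w' ^+ 2 by move=> /s0 h; rewrite mulr_ge0 ?sqr_ge0.
have {hw} hw : ((r ^+ 2)%:E <= sqnorm (post_dev Z W mu al w w'))%E.
  by case: hw => //; rewrite leNgt r0.
set SW := (\sum_(1 <= i <oo) (s al' i * W i w' ^+ 2)%:E)%E.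
have SW0 : (0 <= SW)%E by apply: nneseries_ge0 => i i0 _; rewrite lee_fin ww0.
(* The series may diverge for some draws; the bound is then trivial. *)
have [SWoo|SWfin] := eqVneq SW +oo%E.
  by rewrite SWoo gt0_muley ?leey// lte_fin divr_gt0.
have SWE : SW = (fine SW)%:E by rewrite fineK// ge0_fin_numE// ltey.
have hZs : (\sum_(1 <= i <oo) (s al' i * Z i w ^+ 2)%:E <= (r ^+ 2 / 9)%:E)%E.
  have kk : 0 <= r ^+ 2 / 9 by rewrite divr_ge0// ltW.
  have := lee_wpmul2l (_ : (0 <= (r ^+ 2 / 9)%:E)%E) hZw.
  rewrite mule1 muleA -EFinM => h; apply: le_trans (h _); last by rewrite lee_fin.
  have -> : r ^+ 2 / 9 * (9 / r ^+ 2) = 1 by field; rewrite gt_eqF.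
  by rewrite mul1e.
have hZp := nneseries_partial_le zz0 hZs.
have hWp := nneseries_partial_le ww0 (_ : (SW <= (fine SW)%:E)%E).
have {hWp} hWp : forall N, \sum_(1 <= i < N) s al' i * W i w' ^+ 2 <= fine SW.
  by apply: hWp; rewrite -SWE.
have : (sqnorm (post_dev Z W mu al w w') <= (r ^+ 2 / 3 + (r ^+ 2 / 3 + 3 * fine SW))%:E)%E.
  apply: lime_le; first by apply: is_cvg_nneseries => i _ _; rewrite lee_fin sqr_ge0.
  apply: nearW => N; rewrite sumEFin lee_fin.
  apply: (@le_trans _ _ (\sum_(1 <= i < N) (3 * ((1 - a al i) ^+ 2 * mu i ^+ 2) +
     (3 * (s al' i * Z i w ^+ 2) + 3 * (s al' i * W i w' ^+ 2))))).
    rewrite big_seq [leRHS]big_seq; apply: ler_sum => i.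
    by rewrite mem_index_iota => /andP[i0 _]; exact: post_dev_sqr_le.
  rewrite !big_split/= -!mulr_sumr; have := hB N; have := hZp N; have := hWp N.
  lra.
move=> /(le_trans hw); rewrite lee_fin SWE -EFinM lee_fin => h.
rewrite mulrAC ler_pdivlMr// mul1r; lra.
Qed.

End posterior.

(** * The nonasymptotic bound at fixed n *)

Section fixed_n.
Context (R : realType) (p C : R) (kappa : nat -> R).
Hypotheses (hp : 0 <= p) (hC : 1 <= C).
Hypothesis hkappa : forall i : nat, (0 < i)%N ->
     C^-1 * (i%:R `^ (- p)) <= kappa i /\ kappa i <= C * (i%:R `^ (- p)).
Variables (n : nat) (n2 : (1 < n)%N).
Context d (T : measurableType d) (P : probability T R).
Variables (Z : nat -> T -> R) (hZ : iid_std_normal P Z).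
Context d' (T' : measurableType d') (Q : probability T' R).
Variables (W : nat -> T' -> R) (hW : iid_std_normal Q W).

Let n0 : (0 < n)%N. Proof. exact: ltnW n2. Qed.
Let C0 : 0 < C. Proof. exact: lt_le_trans hC. Qed.
Let nR0 : 0 < n%:R :> R. Proof. by rewrite ltr0n. Qed.
Local Notation J := (cutoff p n).
Local Notation D := (complexity kappa n).
Local Notation c1 := (8 * (1 + C ^+ 2) ^+ 2).
Local Notation I9 := ((n ^ 3) ^ 3)%N.

(** Since [tail_h] is free of [al], a single condition on the data controls the truncation error for
    all [al >= 0], including the random one. *)
Lemma tail_event mu z Delta : 1 <= Delta ->
  (\sum_(n ^ 3 <= l <oo) (tail_h kappa n (signal kappa n mu) z l)%:E <= Delta%:E)%E ->
  forall al, 0 <= al ->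
  `|limn (fun N => \sum_(1 <= i < N) lik_term kappa n al (fun i => signal kappa n mu i + z i) i) -
    \sum_(1 <= i < I9) lik_term kappa n al (fun i => signal kappa n mu i + z i) i| <= 3 * Delta.
Proof.
move=> D1 ht al al0; set th := signal kappa n mu in ht *.
have n3 : (0 < n ^ 3)%N by rewrite expn_gt0 n0.
have hge l : (n ^ 3 <= l)%N -> _ := fun nl =>
  tail_h_ge hC hkappa n0 th z (leq_trans n3 nl).
have hs : forall N, \sum_(n ^ 3 <= l < N) tail_h kappa n th z l <= Delta.
  apply: nneseries_partial_le ht => l nl.
  by have [h _ _] := hge l nl; apply: le_trans h.
pose w i : R := i%:R `^ (- (2 * al)).
have [] // := @weighted_tail_cvg R w (fun i => tail_c kappa n i * (z i ^+ 2 - 1))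
  (lik_term kappa n al (fun i => th i + z i)) (tail_q kappa n th z)
  (tail_h kappa n th z) (n ^ 3) Delta n3 D1.
- move=> i i0; rewrite powR_ge0/= /w !powRN lef_pV2 ?posrE ?powR_gt0 ?ltr0n//.
  by apply: ge0_ler_powR; rewrite ?nnegrE ?ler_nat// mulr_ge0.
- by rewrite /w powR1.
- by move=> i i0; exact: (lik_term_approx hC hkappa n0).
- by move=> l nl; have [] := hge l nl.
- by move=> l nl; have [] := hge l nl.
- by move=> l nl; have [] := hge l nl.
Qed.

(** The error terms stand for the noise at the [K] grid points and at [be], the tail of the series,
    and then the spread twice: once through the data, once through the posterior draw. *)
Lemma fixed_n_bound (K G : nat) (al' be z eta Delta X S r Vb : R) (mu : nat -> R)
    (ah : T -> R) :
  Vb = C ^+ 4 * J al' `^ (1 + 2 * p + z) / n%:R * (1 + z^-1) ->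
  (0 < G)%N -> 0 <= al' -> 0 < z -> z <= 2 * al' -> 0 <= be <= ln (n%:R : R) ->
  ln (n%:R : R) * G%:R < K%:R -> 0 <= eta <= 1 -> (I9%:R : R) `^ (2 / G%:R) <= 1 + eta ->
  4 * c1 * C ^+ 2 * (1 + ln (I9%:R : R)) * eta <= 1 -> 1 <= Delta ->
  (forall N, \sum_(1 <= i < N) (i%:R `^ (2 * be) * mu i ^+ 2) <= S) ->
  5 / 2 * (C ^+ 2 * J be * ((1 + ln (I9%:R : R)) * ln (1 + C ^+ 2 * n%:R) + S)) + 16 * Delta <= X ->
  X < J al' / c1 -> 0 < r ->
  9 * (2 * C ^+ 2 * J be `^ (2 * p) / n%:R * X + J be `^ (- (2 * be)) * S) <= r ^+ 2 ->
  {ae P, forall w, (0 <= ah w <= ln (n%:R : R)) /\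
     (forall alpha, 0 <= alpha <= ln (n%:R : R) ->
        loglik kappa n alpha (obs kappa Z n mu w) <= loglik kappa n (ah w) (obs kappa Z n mu w))} ->
  (\int[P]_w post_prob Q W kappa n (ah w) (obs kappa Z n mu w) mu r <=
    (520 / Delta * K.+1%:R + Delta^-1 * (2 * 61 * 61 * C ^+ 4 + 2 * C ^+ 4 * S) +
     9 / r ^+ 2 * Vb + 9 / r ^+ 2 * Vb)%:E)%E.
Proof.
move=> VbE G0 al0 z0 zal /andP[be0 beM] hK heta hI hetaC D1 hS hX XJ r0 hr hah.
have D0 : 0 < Delta by exact: lt_le_trans D1.
have r2 : 0 < r ^+ 2 by rewrite exprn_gt0.
set th := signal kappa n mu.
(* Truncated sums run over [i < I.+1], so they stop exactly where the tail blocks start. *)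
pose I := I9.-1.
have I0 : (0 < I9)%N by rewrite !expn_gt0 n0.
have IE : I9 = I.+1 by rewrite prednK.
have nI : (n <= I)%N.
  rewrite -ltnS -IE -expnM -{1}(expn1 n) ltn_exp2l//.
have IR : I%:R <= I9%:R :> R by rewrite ler_nat IE.
have I1 : (0 < I)%N by exact: leq_trans nI.
have lnI : ln (I%:R : R) <= ln (I9%:R : R) by rewrite ler_ln// posrE ltr0n.
have S0 : 0 <= S by apply: le_trans (hS 0%N); rewrite big_geq.
have hmu M : \sum_(1 <= i < M) mu i ^+ 2 <= S.
  apply: le_trans (hS M); rewrite big_seq [leRHS]big_seq; apply: ler_sum => i.
  rewrite mem_index_iota => /andP[i0 _]; rewrite ler_peMl ?sqr_ge0//.
  by rewrite -[leLHS](powRr0 (i%:R : R)); apply: ler_powR; rewrite ?ler1n// mulr_ge0.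
pose ratio al w : R := (D I.+1 al th / 4 + Delta) ^- 2 * fluct kappa n I.+1 al th (Z^~ w) ^+ 2.
have [kf kfE hf] : exists2 kf, kf = 520 / Delta & forall al, mean_le P (fun w => (ratio al w)%:E) kf.
  by exists (520 / Delta) => // al; exact: (mean_le_fluct_ratio hC hkappa n0 hZ I.+1 al th D0).
have ratio0 al w : 0 <= ratio al w.
  by rewrite mulr_ge0 ?invr_ge0 ?sqr_ge0.
(* [H1] and [H2] govern the noise on the grid and at [be], which need not be a grid point; [H3]
   governs the tail, [H4] the data part of the deviation. If their sum is at most 1, so is each of
   them. *)
pose H1 w : \bar R := (\sum_(j <- index_iota 0 K) (ratio (j%:R / G%:R) w)%:E)%E.
pose H2 w : \bar R := (ratio be w)%:E.
pose H3 w : \bar R := ((Delta^-1)%:E * \sum_(n ^ 3 <= l <oo) (tail_h kappa n th (Z^~ w) l)%:E)%E.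
pose H4 w : \bar R := ((9 / r ^+ 2)%:E * \sum_(1 <= i <oo) (post_var kappa n al' i * Z i w ^+ 2)%:E)%E.
have m1 : mean_le P H1 (\sum_(j <- index_iota 0 K) kf) by apply: mean_le_sum => j _; exact: hf.
have m2 : mean_le P H2 kf by exact: hf.
have Di : 0 <= Delta^-1 by rewrite invr_ge0 ltW.
have m3 := mean_leZ Di (mean_le_tail hp hC hkappa n0 hZ hmu).
have rk : 0 <= 9 / r ^+ 2 by rewrite divr_ge0// ltW.
have m4 := mean_leZ rk (mean_le_post_var hp hC hkappa n0 hZ z0 zal).
have mW := mean_le_post_var hp hC hkappa n0 hW z0 zal.
rewrite -VbE in m4 mW.
have m := mean_leD (mean_leD (mean_leD m1 m2) m3) m4.
have Vb0 : 0 <= 9 / r ^+ 2 * Vb.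
  rewrite VbE; apply: mulr_ge0 => //; apply: mulr_ge0.
    by rewrite divr_ge0// mulr_ge0 ?powR_ge0// exprn_ge0// ltW.
  by rewrite addr_ge0// invr_ge0 ltW.
have post01 w : (0 <= post_prob Q W kappa n (ah w) (obs kappa Z n mu w) mu r <= 1)%E.
  rewrite /post_prob measure_ge0/= probability_le1//.
  exact: (measurable_post_event kappa n Z hW mu (ah w) w r0).
have := integral_le_bad_event Vb0 post01 m.
rewrite (_ : (\sum_(j <- index_iota 0 K) kf) + kf = kf * K.+1%:R); last first.
  by rewrite big_const_nat subn0 iter_addr_0 mulr_natr mulrSr.
rewrite kfE; apply.
apply: filterS hah => w [/andP[ah0 ahM] hmax] hH.
have h1 : (0 <= H1 w)%E by case: m1.
have h2 : (0 <= H2 w)%E by case: m2.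
have h3 : (0 <= H3 w)%E by have [_ h _] := m3; exact: h.
have h4 : (0 <= H4 w)%E by have [_ h _] := m4; exact: h.
have {hH} hH : (H1 w + H2 w + H3 w + H4 w <= 1)%E by [].
have b4 : (H4 w <= 1)%E by apply: le_trans hH; rewrite leeDr// !adde_ge0.
have b3 : (H3 w <= 1)%E.
  by apply: le_trans hH; rewrite -addeA addeCA leeDl// !adde_ge0.
have b12 : (H1 w + H2 w <= 1)%E.
  by apply: le_trans hH; rewrite -addeA leeDl// adde_ge0.
have b2 : ratio be w <= 1.
  by rewrite -lee_fin; apply: le_trans b12; rewrite leeDr.
have b1 j : (j < K)%N -> ratio (j%:R / G%:R) w <= 1.
  move=> jK; rewrite -lee_fin.
  have b1' : (H1 w <= 1)%E by apply: le_trans b12; rewrite leeDl.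
  apply: le_trans b1'; rewrite /H1 (bigD1_seq j) ?iota_uniq ?mem_index_iota//=.
  by rewrite leeDl// sume_ge0// => i _; rewrite lee_fin.
have fl al : ratio al w <= 1 -> `|fluct kappa n I.+1 al th (Z^~ w)| <= D I.+1 al th / 4 + Delta.
  apply: (@fluct_ratio_le _ 0).
  apply: ltr_wpDl => //; rewrite divr_ge0//.
  exact: (complexity_ge0 hC hkappa n0).
have ht : (\sum_(n ^ 3 <= l <oo) (tail_h kappa n th (Z^~ w) l)%:E <= Delta%:E)%E.
  have := lee_wpmul2l (_ : (0 <= Delta%:E)%E) b3.
  rewrite /H3 mule1 muleA -EFinM divff ?gt_eqF// mul1e; apply.
  by rewrite lee_fin ltW.
have tail := tail_event D1 ht.
pose V al := limn (fun N => \sum_(1 <= i < N)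
  lik_term kappa n al (fun i => th i + Z i w) i).
have Vle : V (ah w) <= V be.
  have := hmax be; rewrite be0 beM => /(_ isT).
  rewrite !(loglik_lik_term hC hkappa n0) -/th -/(V _) -/(V _).
  by rewrite ler_nM2l// oppr_lt0 invr_gt0.
rewrite IE in tail.
have etaC : 4 * c1 * C ^+ 2 * (1 + ln I%:R) * eta <= 1.
  apply: le_trans hetaC; have /andP[e0 _] := heta.
  apply: ler_wpM2r => //; apply: ler_wpM2l; last by rewrite lerD2l.
  rewrite mulr_ge0 ?sqr_ge0// mulr_ge0// mulr_ge0// sqr_ge0//.
have hI' : I%:R `^ (2 / G%:R) <= 1 + eta.
  apply: le_trans hI; apply: ge0_ler_powR; rewrite ?nnegrE ?ler0n//.
have DX : 5 / 2 * D I.+1 be th + 16 * Delta <= X.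
  apply: le_trans hX; rewrite lerD2r; apply: ler_wpM2l; first by rewrite divr_ge0.
  have IP : I.+1 = I.-1.+2 by rewrite prednK.
  rewrite IP; apply: (le_trans (complexity_le hp hC hkappa n0 be0 (hS _))).
  rewrite prednK//; apply: ler_wpM2l.
    by rewrite mulr_ge0 ?sqr_ge0// ltW// cutoff_gt0.
  rewrite lerD2r; apply: ler_wpM2r; last by rewrite lerD2l.
  by apply: ln_ge0; rewrite lerDl mulr_ge0 ?sqr_ge0.
have beM' : 0 <= be <= ln (n%:R : R) by rewrite be0 beM.
have ahM' : 0 <= ah w <= ln (n%:R : R) by rewrite ah0 ahM.
have [al'ah hB] := oracle_risk_le hp hC hkappa n0 nI G0 al0 beM' ahM' hK heta hI' etaC
  (fun j jK => fl _ (b1 j jK)) (fl _ b2) tail Vle DX XJ hS.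
exact: (post_prob_le hC hkappa n0 hW r0 al'ah hB hr b4 mW).
Qed.

End fixed_n.

(** * Growth comparisons and arithmetic in powers of [y] *)

Section asymptotics.
Context (R : realType).
Implicit Types (A e x : R).

Lemma near_powR_ge A e : 0 < e -> exists N, forall n, (N <= n)%N -> A <= n%:R `^ e.
Proof.
move=> e0; pose B := Num.max A 1.
have B1 : 0 < B by rewrite lt_max ltr01 orbT.
exists (Num.truncn (B `^ e^-1)).+1 => n hn.
apply: (@le_trans _ _ B); first by rewrite le_max lexx.
have -> : B = (B `^ e^-1) `^ e by rewrite -powRrM mulVf ?gt_eqF// powRr1// ltW.
apply: ge0_ler_powR; rewrite ?nnegrE ?powR_ge0 ?(ltW e0)//.
apply: ltW; apply: (@lt_le_trans _ _ (Num.truncn (B `^ e^-1)).+1%:R).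
  by have /andP[] := truncn_itv (powR_ge0 B e^-1).
by rewrite ler_nat.
Qed.

Lemma ln_le_powR x e : 0 < x -> 0 < e -> ln x <= e^-1 * x `^ e.
Proof.
move=> x0 e0; have -> : ln x = e^-1 * ln (x `^ e).
  by rewrite ln_powR mulrA mulVf ?mul1r// gt_eqF.
by rewrite ler_pM2l ?invr_gt0// ltW// ln_sublinear// powR_gt0.
Qed.

Lemma near_log_le A e : 0 < e -> exists N, forall n, (N <= n)%N ->
  A * (1 + ln (n%:R : R)) <= n%:R `^ e.
Proof.
move=> e0; have e20 : 0 < e / 2 by rewrite divr_gt0.
have [N hN] := near_powR_ge (Num.max (`|A| * (1 + (e / 2)^-1)) 1) e20.
exists N.+1 => n hn; have n0 : (0 < n)%N by exact: leq_ltn_trans hn.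
have nR : 0 < n%:R :> R by rewrite ltr0n.
have := hN n (ltnW hn); rewrite ge_max => /andP[h1 h2].
set y := n%:R `^ (e / 2) in h1 h2.
have hl : ln (n%:R : R) <= (e / 2)^-1 * y by exact: ln_le_powR.
have l0 : 0 <= ln (n%:R : R) by rewrite ln_ge0// ler1n.
have -> : n%:R `^ e = y * y by rewrite -powRD_gt0// -splitr.
have y0 : 0 <= y by lra.
apply: (@le_trans _ _ (`|A| * (1 + ln (n%:R : R)))).
  by apply: ler_wpM2r; [lra|exact: ler_norm].
apply: (@le_trans _ _ (`|A| * ((1 + (e / 2)^-1) * y))).
  by apply: ler_wpM2l => //; rewrite mulrDl mul1r; exact: lerD.
by rewrite mulrA; apply: ler_wpM2r.
Qed.

Lemma expR_half_le x : 0 <= x <= 1 -> expR (x / 2) <= 1 + x.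
Proof.
move=> /andP[x0 x1]; have h : 1 - x / 2 <= expR (- (x / 2)) by exact: expR_ge1Dx.
have := ler_wpM2r (ltW (expR_gt0 (x / 2))) h.
rewrite [leRHS]mulrC expRxMexpNx_1 => h1.
have x2 : 0 < 1 - x / 2 by lra.
rewrite -(@ler_pM2l _ (1 - x / 2))//; apply: (le_trans h1); nra.
Qed.

End asymptotics.

Lemma log_bounds (R : realType) (c x y : R) : 1 <= c -> 1 <= x ->
  (9 + ln (2 * c)) * (1 + ln x) <= y ->
  [/\ 0 <= 1 + 9 * ln x <= y, ln x <= y & 0 <= ln (1 + c * x) <= y].
Proof.
move=> c1 x1 hl.
have lx0 : 0 <= ln x by exact: ln_ge0.
have lC : 0 <= ln (2 * c) by apply: ln_ge0; lra.
have cx : 1 * 1 <= c * x by apply: ler_pM.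
have h : ln (1 + c * x) <= ln (2 * c) + ln x.
  rewrite -lnM ?posrE; [|lra|lra].
  by rewrite ler_ln ?posrE; lra.
split.
- by apply/andP; split; nra.
- nra.
- apply/andP; split; first by apply: ln_ge0; lra.
  apply: (le_trans h); nra.
Qed.

(** The exponent 3 reflects the condition on [eta]: a constant and two logarithms, each at most [y],
    have to be compensated by the mesh. *)
Lemma grid_size (R : realType) (y l : R) : 1 <= y -> 0 <= l <= y ->
  exists G K : nat, [/\ (0 < G)%N, y ^+ 3 <= G%:R, l * G%:R < K%:R & K.+1%:R <= 4 * y ^+ 4].
Proof.
move=> y1 /andP[l0 ly]; have y0 : 0 <= y by lra.
have /andP[G1 G2] := truncn_itv (exprn_ge0 3 y0).
have /andP[K1 K2] := truncn_itv (mulr_ge0 l0 (ler0n R (Num.truncn (y ^+ 3)).+1)).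
exists (Num.truncn (y ^+ 3)).+1, (Num.truncn (l * (Num.truncn (y ^+ 3)).+1%:R)).+1.
split => //; first exact: ltW.
move: K1 K2; set G := (Num.truncn (y ^+ 3)).+1 in G2 *; set K := Num.truncn _ => K1 _.
have y3 : 1 <= y ^+ 3 by exact: exprn_ege1.
have hG : G%:R <= 2 * y ^+ 3 by rewrite /G -natr1; lra.
have e4 : y ^+ 4 = y * y ^+ 3 by rewrite -exprS.
have h1 : l * G%:R <= y * (2 * y ^+ 3) by apply: ler_pM.
have h2 : 1 * 1 <= y * y ^+ 3 by apply: ler_pM.
have -> : K.+2%:R = K%:R + 2 :> R by rewrite -addn2 natrD.
rewrite e4; lra.
Qed.

Section scalar_bounds.
Context (R : realFieldType).
Implicit Types (y J S : R).

Lemma penalty_bound y J (c S u v : R) : 1 <= J -> 1 <= y -> 0 <= c -> 0 <= S ->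
  0 <= u <= y -> 0 <= v <= y -> 5 / 2 * c * (1 + S) + 16 <= y ->
  5 / 2 * (c * J * (u * v + S)) + 16 * y ^+ 6 <= J * y ^+ 7.
Proof.
move=> J1 y1 c0 S0 /andP[u0 uy] /andP[v0 vy] hy.
have y0 : 0 <= y by lra.
have J0 : 0 <= J by lra.
have uv : u * v <= y ^+ 2 by rewrite expr2; exact: ler_pM.
have y26 : y ^+ 2 <= y ^+ 6 by exact: ler_weXn2l.
have y6 : 1 <= y ^+ 6 by exact: exprn_ege1.
have S6 : S * 1 <= S * y ^+ 6 by exact: ler_wpM2l.
have h1 : u * v + S <= y ^+ 6 * (1 + S) by lra.
have cJ : 0 <= c * J by exact: mulr_ge0.
have h2 := ler_wpM2l cJ h1.
have h3 : 1 * y ^+ 6 <= J * y ^+ 6 by apply: ler_wpM2r => //; lra.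
have Jy : 0 <= J * y ^+ 6 by apply: mulr_ge0 => //; lra.
have h4 := ler_wpM2l Jy hy.
have -> : J * y ^+ 7 = J * y ^+ 6 * y by rewrite -mulrA -exprSr.
move: h4; rewrite mulrDr; set w := y ^+ 6 in h2 h3 *; set a := c * J * _ in h2 *.
lra.
Qed.

Lemma risk_bound y (rho c S A X B : R) : 1 <= y -> 0 <= rho -> 0 <= c -> 0 <= S ->
  9 * (2 * c + S) <= y -> A * X <= rho * y ^+ 7 -> 0 <= A -> B <= rho ->
  9 * (2 * c * A * X + B * S) <= rho * y ^+ 8.
Proof.
move=> y1 r0 c0 S0 hy hA A0 hB.
have y7 : 1 <= y ^+ 7 by exact: exprn_ege1.
have h1 := ler_wpM2l c0 hA.
have h2 := ler_wpM2r S0 hB.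
have rS : 0 <= rho * S by exact: mulr_ge0.
have h3 := ler_wpM2l rS y7.
have ry : 0 <= rho * y ^+ 7 by apply: mulr_ge0 => //; lra.
have h4 := ler_wpM2l ry hy.
have -> : rho * y ^+ 8 = rho * y ^+ 7 * y by rewrite -mulrA -exprSr.
lra.
Qed.

(** Grid, tail and spread each contribute at most [1/y]. The exponent 6 lets [Delta] beat the
    [4 y^4] grid points with a spare factor for the constant. *)
Lemma total_bound y (k cT t cV K eps : R) : 1 <= y -> 0 < eps -> 0 <= k -> k * 4 <= y -> cT <= y ->
  18 * cV <= y -> 3 / eps <= y -> t <= 9 * cV / y ^+ 2 -> K <= 4 * y ^+ 4 ->
  k / y ^+ 6 * K + (y ^+ 6)^-1 * cT + t + t <= eps.
Proof.
move=> y1 e0 k0 hk hT hV he ht hK.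
have y0 : 0 < y by lra.
have y6 : 0 < y ^+ 6 by exact: exprn_gt0.
have y2 : 0 < y ^+ 2 by exact: exprn_gt0.
have h1 : k / y ^+ 6 * K <= y^-1.
  apply: (@le_trans _ _ (k / y ^+ 6 * (4 * y ^+ 4))).
    by apply: ler_wpM2l => //; rewrite divr_ge0// ltW.
  have -> : k / y ^+ 6 * (4 * y ^+ 4) = (k * 4) * y^-1 ^+ 2 by field; rewrite gt_eqF.
  apply: (@le_trans _ _ (y * y^-1 ^+ 2)); first by apply: ler_wpM2r => //; exact: sqr_ge0.
  by rewrite expr2 mulrA divff ?gt_eqF// mul1r.
have h2 : (y ^+ 6)^-1 * cT <= y^-1.
  rewrite mulrC ler_pdivrMr//; apply: (le_trans hT).
  have -> : y^-1 * y ^+ 6 = y ^+ 5 by field; rewrite gt_eqF.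
  by rewrite -{1}(expr1 y); exact: ler_weXn2l.
have h3 : t + t <= y^-1.
  apply: (@le_trans _ _ (18 * cV / y ^+ 2)); first lra.
  rewrite ler_pdivrMr//; apply: (le_trans hV).
  by rewrite expr2 mulrA mulVf ?gt_eqF// mul1r.
have h4 : 3 * y^-1 <= eps.
  by rewrite ler_pdivrMr// mulrC -ler_pdivrMr.
lra.
Qed.

End scalar_bounds.

(** * Contraction at the rate of any smaller smoothness *)

Section contraction.
Context (R : realType) (p C : R) (kappa : nat -> R).
Hypotheses (hp : 0 <= p) (hC : 1 <= C).
Hypothesis hkappa : forall i : nat, (0 < i)%N ->
     C^-1 * (i%:R `^ (- p)) <= kappa i /\ kappa i <= C * (i%:R `^ (- p)).
Context d (T : measurableType d) (P : probability T R).
Variables (Z : nat -> T -> R) (hZ : iid_std_normal P Z).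
Context d' (T' : measurableType d') (Q : probability T' R).
Variables (W : nat -> T' -> R) (hW : iid_std_normal Q W).
Local Notation ex al := (1 + 2 * al + 2 * p).
Local Notation c1 := (8 * (1 + C ^+ 2) ^+ 2).

Let C0 : 0 < C. Proof. exact: lt_le_trans hC. Qed.

Lemma ratio_ex_gap b al : 0 <= b -> b < al ->
  0 < 2 * al / ex al - 2 * b / ex b.
Proof.
move=> b0 bal; have e1 := ex_ge1 hp b0.
have al0 : 0 <= al by lra.
have e2 := ex_ge1 hp al0.
have -> : 2 * al / ex al - 2 * b / ex b = 2 * (al - b) * (1 + 2 * p) / (ex al * ex b).
  by field; rewrite !gt_eqF//; lra.
rewrite divr_gt0//; first by rewrite mulr_gt0//; [lra|move: hp; lra].
by rewrite mulr_gt0//; lra.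
Qed.

Lemma cutoff_powR n al e : cutoff p n al `^ e = n%:R `^ (e / ex al).
Proof. by rewrite /cutoff -powRrM mulrC. Qed.

(** The spread is controlled at the midpoint [al'], strictly between [b] and [be]: its distance to
    [be] makes the oracle inequality exclude smaller estimates, its distance to [b] leaves room in
    the rate. *)
Lemma contraction_near b be S eps : 0 < b -> b < be -> 0 <= S -> 0 < eps ->
  exists N, forall n, (N <= n)%N -> forall (mu : nat -> R) (ah : T -> R) (r : R),
    (forall N', \sum_(1 <= i < N') (i%:R `^ (2 * be) * mu i ^+ 2) <= S) ->
    {ae P, forall w, (0 <= ah w <= ln (n%:R : R)) /\
     (forall alpha, 0 <= alpha <= ln (n%:R : R) ->
        loglik kappa n alpha (obs kappa Z n mu w) <= loglik kappa n (ah w) (obs kappa Z n mu w))} ->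
    n%:R `^ (- (b / ex b)) <= r ->
    (\int[P]_w post_prob Q W kappa n (ah w) (obs kappa Z n mu w) mu r <= eps%:E)%E.
Proof.
move=> b0 bbe S0 eps0.
pose al' := (b + be) / 2.
have bal : b < al' by rewrite /al'; lra.
have albe : al' < be by rewrite /al'; lra.
have al0 : 0 <= al' by lra.
have be0 : 0 <= be by lra.
(* Three gaps in the exponent of n: [g1] for the spread at [al'] against the target, [g2] for the
   bias at [be] against the target, [g3] for the cutoff at [al'] against that at [be]. *)
have e1 := ratio_ex_gap (ltW b0) bal; set g1 := _ - _ in e1.
have e2 := ratio_ex_gap (ltW b0) bbe; set g2 := _ - _ in e2.
have xb := ex_ge1 hp (ltW b0); have xal := ex_ge1 hp al0; have xbe := ex_ge1 hp be0.
pose g3 := (ex al')^-1 - (ex be)^-1.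
have e3 : 0 < g3.
  rewrite /g3 subr_gt0 ltf_pV2 ?posrE; lra.
pose z := Num.min al' (g1 / 2).
have z0 : 0 < z by rewrite lt_min; apply/andP; split; [lra|exact: divr_gt0].
have zal : z <= 2 * al' by rewrite ge_min; apply/orP; left; lra.
have zg : z <= g1 / 2 by rewrite ge_min lexx orbT.
pose dd := Num.min (Num.min (g1 / 4) (g2 / 8)) (g3 / 8).
have d0 : 0 < dd by rewrite !lt_min !divr_gt0.
have d1 : 4 * dd <= g1.
  have : dd <= g1 / 4 by rewrite !ge_min lexx.
  lra.
have d2 : 8 * dd <= g2.
  have : dd <= g2 / 8 by rewrite !ge_min lexx orbT.
  lra.
have d3 : 8 * dd <= g3.
  have : dd <= g3 / 8 by rewrite ge_min lexx orbT.
  lra.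
pose cV := C ^+ 4 * (1 + z^-1).
pose cT := 2 * 61 * 61 * C ^+ 4 + 2 * C ^+ 4 * S.
pose cX := 5 / 2 * C ^+ 2 * (1 + S) + 16.
pose cB := 9 * (2 * C ^+ 2 + S).
have [N1 hN1] := near_powR_ge (Num.max (Num.max (Num.max (Num.max 1 (16 * (9 * (c1 * C ^+ 2)))) 36)
   (Num.max cX (c1 + 1))) (Num.max (Num.max cB (520 * 4)) (Num.max (Num.max cT (18 * cV)) (3 / eps)))) d0.
have [N2 hN2] := near_log_le (9 + ln (2 * C ^+ 2)) d0.
(* Ensures [be <= ln n], so that [be] competes in the maximisation. *)
have [N3 hN3] := near_powR_ge (expR be) ltr01.
exists (maxn (maxn N1 N2) (maxn N3 2)) => n.
rewrite !geq_max => /andP[/andP[n1 n2] /andP[n3 n22]] mu ah r hS hah hr.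
have n0 : (0 < n)%N by exact: ltnW.
set x : R := n%:R; have x0 : 0 < x by rewrite ltr0n.
have x1 : 1 <= x by rewrite ler1n.
have := hN1 n n1; rewrite -/x; set y := x `^ dd; rewrite !ge_max.
move=> /andP[/andP[/andP[/andP[y1 ky1] ky2] /andP[kyX kyc]] /andP[/andP[kyB ky520] /andP[/andP[kyT kyV] kye]]].
have lx0 : 0 <= ln x by exact: ln_ge0.
have CC : 1 <= C ^+ 2 by exact: exprn_ege1.
have hl : (9 + ln (2 * C ^+ 2)) * (1 + ln x) <= y := hN2 n n2.
have lI : ln (((n ^ 3) ^ 3)%N%:R : R) = 9 * ln x.
  by rewrite -expnM natrX lnXn// mulr_natl.
have [hu hlx hv] := log_bounds CC x1 hl.
have hbe : be <= ln x.
  rewrite -(expRK be) ler_ln ?posrE ?expR_gt0//.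
  by have := hN3 n n3; rewrite powRr1// ltW.
have yk k : y ^+ k = x `^ (dd * k%:R) by rewrite powRrM powR_mulrn// powR_ge0.
have pw u v : u <= v -> x `^ u <= x `^ v by move=> uv; apply: ler_powR.
have y0 : 0 < y by lra.
have [|G [K [G0 Glo hlnK Khi]]] := @grid_size R y (ln x) y1; first by rewrite lx0 hlx.
have GR : 0 < G%:R :> R by rewrite ltr0n.
(* As [ln (n^9) = 9 ln n], the grid ratio is [exp (18 ln n / G) = exp (eta/2)], at most
   [1 + eta]. *)
pose eta := 36 * ln x / G%:R.
pose J := cutoff p n be.
have J1 : 1 <= J by exact: cutoff_ge1.
have J0 : 0 < J by lra.
have lnG : 36 * ln x <= G%:R.
  apply: le_trans Glo; have : 36 * ln x <= y * y by apply: ler_pM.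
  move=> /le_trans; apply; rewrite -expr2; exact: ler_weXn2l.
have eta01 : 0 <= eta <= 1.
  by rewrite divr_ge0 ?mulr_ge0//= ler_pdivrMr// mul1r.
have hI : (((n ^ 3) ^ 3)%N%:R : R) `^ (2 / G%:R) <= 1 + eta.
  rewrite /powR gt_eqF; last by rewrite ltr0n !expn_gt0 n0.
  rewrite lI; have -> : 2 / G%:R * (9 * ln x) = eta / 2 by rewrite /eta; field; rewrite gt_eqF.
  exact: expR_half_le.
have hetaC : 4 * c1 * C ^+ 2 * (1 + ln (((n ^ 3) ^ 3)%N%:R : R)) * eta <= 1.
  rewrite lI /eta mulrA ler_pdivrMr// mul1r; apply: le_trans Glo.
  have -> : 4 * c1 * C ^+ 2 * (1 + 9 * ln x) * (36 * ln x) =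
    16 * (9 * (c1 * C ^+ 2)) * ((1 + 9 * ln x) * ln x) by ring.
  rewrite exprS; apply: ler_pM => //.
  - by do 3 apply: mulr_ge0 => //; rewrite ?sqr_ge0//; apply: mulr_ge0 => //; exact: sqr_ge0.
  - by case/andP: hu => ? ?; exact: mulr_ge0.
  - by case/andP: hu => ? ?; exact: ler_pM.
pose X := 5 / 2 * (C ^+ 2 * J * ((1 + ln (((n ^ 3) ^ 3)%N%:R : R)) * ln (1 + C ^+ 2 * x) + S))
   + 16 * y ^+ 6.
have hX : X <= J * y ^+ 7 by rewrite /X lI; apply: penalty_bound => //; exact: sqr_ge0.
have c10 : 0 < c1 by rewrite mulr_gt0// exprn_gt0// addr_gt0// exprn_gt0.
have XJ : X < cutoff p n al' / c1.
  rewrite ltr_pdivlMr//.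
  (* Seven powers of [y] come from the bound on [X]; the eighth beats the constant [c1]. *)
  have JJ : J * y ^+ 8 <= cutoff p n al'.
    rewrite yk /J /cutoff -/x -powRD_gt0//; apply: pw.
    by move: d3; rewrite /g3; lra.
  apply: lt_le_trans JJ; apply: (@le_lt_trans _ _ (J * y ^+ 7 * c1)).
    by apply: ler_wpM2r => //; exact: ltW.
  have J7 : 0 < J * y ^+ 7 by rewrite mulr_gt0// exprn_gt0.
  have -> : J * y ^+ 8 = J * y ^+ 7 * y by rewrite -mulrA -exprSr.
  rewrite ltr_pM2l//.
  by apply: lt_le_trans kyc; rewrite ltrDl.
pose rho := x `^ (- (2 * be / ex be)).
have rho0 : 0 < rho by exact: powR_gt0.
have rb0 : 0 < x `^ (- (b / ex b)) by exact: powR_gt0.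
have r0 : 0 < r by exact: lt_le_trans hr.
have r2 : x `^ (- (2 * b / ex b)) <= r ^+ 2.
  have -> : - (2 * b / ex b) = - (b / ex b) * 2%:R by rewrite -mulrA; ring.
  rewrite powRrM powR_mulrn ?powR_ge0//.
  by rewrite ler_pXn2r// nnegrE ltW.
have hrisk : 9 * (2 * C ^+ 2 * J `^ (2 * p) / x * X + J `^ (- (2 * be)) * S) <= r ^+ 2.
  apply: (@le_trans _ _ (rho * y ^+ 8)); last first.
    apply: le_trans r2; rewrite yk -powRD_gt0//; apply: pw.
    by move: d2; rewrite /g2; lra.
  have Jp : 0 <= J `^ (2 * p) / x by rewrite divr_ge0 ?powR_ge0// ltW.
  rewrite -[2 * C ^+ 2 * _ / x]mulrA; apply: risk_bound => //; rewrite ?sqr_ge0 ?(ltW rho0)//.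
    apply: (le_trans (ler_wpM2l Jp hX)).
    rewrite mulrA; apply: ler_wpM2r; first by rewrite exprn_ge0// ltW.
    (* [J^(2p) J / n = J^(1+2p) / n] is exactly [n^(-2 be / (1 + 2 be + 2p))], the squared rate at
       [be]. *)
    rewrite -{2}(powRr1 (ltW J0)) mulrAC -powRD_gt0// cutoff_powR -/x.
    rewrite -[x^-1]powR_inv1 ?(ltW x0)// -powRD_gt0//; apply: pw.
    by rewrite le_eqVlt; apply/orP; left; apply/eqP; field; rewrite gt_eqF//; lra.
  by rewrite cutoff_powR -/x; apply: pw; rewrite mulNr.
pose Vb := C ^+ 4 * cutoff p n al' `^ (1 + 2 * p + z) / x * (1 + z^-1).
have cV0 : 0 <= cV.
  by rewrite mulr_ge0 ?addr_ge0 ?invr_ge0 ?(ltW z0)// exprn_ge0// ltW.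
have hVb : 9 / r ^+ 2 * Vb <= 9 * cV / y ^+ 2.
  have rr : 0 < r ^+ 2 by rewrite exprn_gt0.
  have yy : 0 < y ^+ 2 by rewrite exprn_gt0.
  have hV : Vb <= cV * (r ^+ 2 / y ^+ 2).
    have -> : Vb = cV * (cutoff p n al' `^ (1 + 2 * p + z) / x) by rewrite /Vb /cV; ring.
    apply: ler_wpM2l => //; rewrite ler_pdivlMr//; apply: le_trans r2.
    rewrite cutoff_powR -/x -[x^-1]powR_inv1 ?(ltW x0)// -powRD_gt0// yk -powRD_gt0//.
    apply: pw.
    have zs : z / ex al' <= z.
      by apply: ler_piMr; [exact: ltW|rewrite invf_le1// (lt_le_trans ltr01)].
    have -> : (1 + 2 * p + z) / ex al' + -1 = - (2 * al' / ex al') + z / ex al'.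
      by field; rewrite gt_eqF//; lra.
    by move: d1 zg; rewrite /g1; lra.
  rewrite mulrAC ler_pdivrMr//.
  apply: (le_trans (ler_wpM2l (ler0n R 9) hV)).
  by rewrite le_eqVlt; apply/orP; left; apply/eqP; field; rewrite gt_eqF.
have y6 : 1 <= y ^+ 6 by exact: exprn_ege1.
have be01 : 0 <= be <= ln (n%:R : R) by rewrite be0.
apply: (le_trans (fixed_n_bound hp hC hkappa n22 hZ hW (erefl Vb) G0 al0 z0 zal be01
  hlnK eta01 hI hetaC y6 hS (lexx X) XJ r0 hrisk hah)).
rewrite lee_fin.
exact: (total_bound y1 eps0 (ler0n R 520) ky520 kyT kyV kye hVb Khi).
Qed.

End contraction.

(** * Diagonal choice of [L_n], smoothness classes, and the conclusion *)

Lemma diagonal_index (N : nat -> nat) : exists kk : nat -> nat,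
  (forall K, exists n0, forall n, (n0 <= n)%N -> (K <= kk n)%N) /\
  (exists n0, forall n, (n0 <= n)%N -> (N (kk n) <= n)%N).
Proof.
(* The largest [k <= n] whose threshold has been passed. An empty maximum is 0, so the second claim
   only starts at [N 0]. *)
exists (fun n => \max_(k < n.+1 | (N k <= n)%N) (k : nat)); split => [K|].
  exists (maxn K (N K)) => n; rewrite geq_max => /andP[Kn NKn].
  have Kn1 : (K < n.+1)%N by rewrite ltnS.
  by apply: (@bigop.leq_bigmax_cond _ _ (fun k : 'I_n.+1 => (k : nat)) (Ordinal Kn1)).
exists (N 0%N) => n n0.
have : (0 < #|[pred k : 'I_n.+1 | (N k <= n)%N]|)%N.
  by apply/card_gt0P; exists ord0; rewrite inE.
move=> /(bigop.eq_bigmax_cond (fun k : 'I_n.+1 => (k : nat)))[k].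
by rewrite inE => hk; rewrite (eq_bigl [in [pred k : 'I_n.+1 | (N k <= n)%N]])// => ->.
Qed.

Lemma slowly_varying_powR (R : realType) (kk : nat -> nat) :
  (forall K, exists n0, forall n, (n0 <= n)%N -> (K <= kk n)%N) ->
  slowly_varying (fun n => n%:R `^ ((kk n).+1%:R^-1) : R).
Proof.
move=> hk dlt d0; have d2 : 0 < dlt / 2 by rewrite divr_gt0.
apply/cvgrPdist_le => eps e0.
have [n1 h1] := hk (Num.truncn (dlt / 2)^-1).
have [n2 h2] := near_powR_ge eps^-1 d2.
exists (maxn (maxn n1 n2) 1) => // n /=; rewrite !geq_max => /andP[/andP[nn1 nn2] n0].
have nR : 1 <= n%:R :> R by rewrite ler1n.
have nR0 : 0 < n%:R :> R by lra.
rewrite sub0r normrN ger0_norm ?mulr_ge0 ?powR_ge0// -powRD_gt0//.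
have hkn : (kk n).+1%:R^-1 <= dlt / 2.
  rewrite -[leRHS]invrK lef_pV2 ?posrE ?invr_gt0//.
  apply: ltW; apply: (@lt_le_trans _ _ (Num.truncn (dlt / 2)^-1).+1%:R).
    have i0 : 0 <= (dlt / 2)^-1 by rewrite invr_ge0 ltW.
    by have /andP[] := truncn_itv i0.
  by rewrite ler_nat ltnS h1.
apply: (@le_trans _ _ (n%:R `^ (- (dlt / 2)))).
  apply: ler_powR => //; apply: (le_trans (lerB hkn (lexx dlt))); lra.
rewrite powRN -[leRHS]invrK lef_pV2 ?posrE ?invr_gt0 ?powR_gt0//.
exact: h2.
Qed.

(** By [ln i <= 2 sqrt i], the difference of the exponents is at least [2 gam (sqrt i - be/gam)^2];
    completing this square determines the constant. *)
Lemma powR_le_expR (R : realType) (be gam : R) (i : nat) : 0 <= be -> 0 < gam ->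
  (0 < i)%N -> i%:R `^ (2 * be) <= expR (2 * be ^+ 2 / gam) * expR (2 * gam * i%:R).
Proof.
move=> be0 g0 i0; have iR : 0 < i%:R :> R by rewrite ltr0n.
rewrite /powR gt_eqF// -expRD ler_expR.
have h2 : 0 < 2^-1 :> R by rewrite invr_gt0.
have := ln_le_powR iR h2; rewrite invrK; set u := i%:R `^ 2^-1 => h.
have half2 : 2^-1 + 2^-1 = 1 :> R by field.
have u2 : i%:R = u * u by rewrite -powRD_gt0// half2 powRr1// ltW.
have hb : 2 * be * ln i%:R <= 2 * be * (2 * u) by apply: ler_wpM2l => //; rewrite mulr_ge0.
apply: (le_trans hb); rewrite u2 -subr_ge0.
have -> : 2 * be ^+ 2 / gam + 2 * gam * (u * u) - 2 * be * (2 * u) =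
   2 * gam * (u - be / gam) ^+ 2 by field; rewrite gt_eqF.
by rewrite mulr_ge0 ?sqr_ge0// mulr_ge0// ltW.
Qed.

Lemma sqnorm_le_sob (R : realType) (be : R) (mu : nat -> R) : 0 <= be ->
  (sqnorm mu <= sob_sqnorm be mu)%E.
Proof.
move=> be0; apply: lee_lim.
- by apply: is_cvg_nneseries => i _ _; rewrite lee_fin sqr_ge0.
- by apply: is_cvg_nneseries => i _ _; rewrite lee_fin mulr_ge0 ?powR_ge0 ?sqr_ge0.
apply: nearW => N; rewrite big_nat [leRHS]big_nat; apply: lee_sum => i /andP[i0 _].
rewrite lee_fin ler_peMl ?sqr_ge0// -[leLHS](powRr0 (i%:R : R)).
by apply: ler_powR; rewrite ?ler1n// mulr_ge0.
Qed.

Lemma sob_partial_le (R : realType) (be S : R) (mu : nat -> R) :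
  (sob_sqnorm be mu <= S%:E)%E ->
  forall N, \sum_(1 <= i < N) (i%:R `^ (2 * be) * mu i ^+ 2) <= S.
Proof. by apply: nneseries_partial_le => i _; rewrite mulr_ge0 ?powR_ge0 ?sqr_ge0. Qed.

Lemma ana_partial_le (R : realType) (be gam S : R) (mu : nat -> R) : 0 <= be -> 0 < gam ->
  (ana_sqnorm gam mu <= S%:E)%E ->
  forall N, \sum_(1 <= i < N) (i%:R `^ (2 * be) * mu i ^+ 2) <= expR (2 * be ^+ 2 / gam) * S.
Proof.
move=> be0 g0 hS N.
have h : forall N, \sum_(1 <= i < N) (expR (2 * gam * i%:R) * mu i ^+ 2) <= S.
  by apply: nneseries_partial_le hS => i _; rewrite mulr_ge0 ?expR_ge0 ?sqr_ge0.
apply: (le_trans _ (ler_wpM2l (expR_ge0 _) (h N))).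
rewrite mulr_sumr big_seq [leRHS]big_seq; apply: ler_sum => i.
rewrite mem_index_iota => /andP[i0 _]; rewrite [leRHS]mulrA; apply: ler_wpM2r.
  exact: sqr_ge0.
exact: powR_le_expR.
Qed.

Lemma sqnorm_ana_lty (R : realType) (gam S : R) (mu : nat -> R) : 0 < gam ->
  (ana_sqnorm gam mu <= S%:E)%E -> (sqnorm mu < +oo)%E.
Proof.
move=> g0 hS; apply: (@le_lt_trans _ _ (ana_sqnorm gam mu)); last first.
  by apply: le_lt_trans hS _; rewrite ltry.
apply: lee_lim.
- by apply: is_cvg_nneseries => i _ _; rewrite lee_fin sqr_ge0.
- by apply: is_cvg_nneseries => i _ _; rewrite lee_fin mulr_ge0 ?expR_ge0 ?sqr_ge0.
apply: nearW => N; rewrite big_nat [leRHS]big_nat; apply: lee_sum => i /andP[i0 _].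
rewrite lee_fin ler_peMl ?sqr_ge0// -expR0 ler_expR mulr_ge0// mulr_ge0// ltW//.
Qed.

Theorem theorem2p2 (R : realType) (p C : R) (kappa : nat -> R)
  (hp : 0 <= p) (hC : 1 <= C)
  (hkappa : forall i : nat, (0 < i)%N ->
     C^-1 * (i%:R `^ (- p)) <= kappa i /\ kappa i <= C * (i%:R `^ (- p)))
  (d : measure_display) (T : measurableType d) (P : probability T R)
  (Z : nat -> T -> R) (hZ : iid_std_normal P Z)
  (d' : measure_display) (T' : measurableType d') (Q : probability T' R)
  (W : nat -> T' -> R) (hW : iid_std_normal Q W)
  (beta gamma Rad : R) (hbeta : 0 < beta) (hgamma : 0 < gamma) (hRad : 0 < Rad) :
  exists L : nat -> R, slowly_varying L /\
  forall (alphahat : nat -> (nat -> R) -> R),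
    emp_bayes_selector P Z kappa alphahat ->
  forall M : nat -> R, M @ \oo --> +oo ->
  (forall eps : R, 0 < eps -> \forall n \near \oo,
     forall mu0 : nat -> R, (sob_sqnorm beta mu0 <= (Rad ^+ 2)%:E)%E ->
       (\int[P]_w post_prob Q W kappa n (alphahat n (obs kappa Z n mu0 w))
            (obs kappa Z n mu0 w) mu0
            (M n * L n * (n%:R `^ (- (beta / (1 + 2 * beta + 2 * p)))))
        <= eps%:E)%E) /\
  (forall eps : R, 0 < eps -> \forall n \near \oo,
     forall mu0 : nat -> R, (ana_sqnorm gamma mu0 <= (Rad ^+ 2)%:E)%E ->
       (\int[P]_w post_prob Q W kappa n (alphahat n (obs kappa Z n mu0 w))
            (obs kappa Z n mu0 w) mu0
            (M n * L n * ((ln n%:R) `^ (2^-1 + p)) * (n%:R `^ (- 2^-1)))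
        <= eps%:E)%E).
Proof.
have gexb b : 0 <= b -> 1 <= 1 + 2 * b + 2 * p by move=> b0; exact: ex_ge1.
pose e k : R := k.+1%:R^-1.
have e0 k : 0 < e k by rewrite invr_gt0.
have R2 : 0 <= Rad ^+ 2 by exact: sqr_ge0.
(* The minimum with [beta / 2] keeps the smoothness positive; the loss in the rate exponent is at
   most [e k]. *)
pose b1 k := beta - Num.min (beta / 2) (e k).
have m1 k : 0 < Num.min (beta / 2) (e k) by rewrite lt_min e0 andbT divr_gt0.
have b10 k : 0 < b1 k.
  by rewrite subr_gt0 (@le_lt_trans _ _ (beta / 2)) ?ge_min ?lexx//; lra.
have b1b k : b1 k < beta by rewrite /b1; have := m1 k; lra.
have gap1 k : beta / (1 + 2 * beta + 2 * p) - e k <= b1 k / (1 + 2 * b1 k + 2 * p).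
  have x1 := gexb _ (ltW (b10 k)); have x2 := gexb _ (ltW hbeta).
  rewrite lerBlDr -lerBlDl.
  have -> : beta / (1 + 2 * beta + 2 * p) - b1 k / (1 + 2 * b1 k + 2 * p) =
     (beta - b1 k) * ((1 + 2 * p) / (1 + 2 * beta + 2 * p) / (1 + 2 * b1 k + 2 * p)).
    by field; rewrite !gt_eqF//; lra.
  have -> : beta - b1 k = Num.min (beta / 2) (e k) by rewrite /b1; lra.
  apply: (@le_trans _ _ (Num.min (beta / 2) (e k))); last by rewrite ge_min lexx orbT.
  apply: ler_piMr; first exact: ltW.
  rewrite ler_pdivrMr ?mul1r; last lra.
  apply: (@le_trans _ _ 1) => //.
  by rewrite ler_pdivrMr ?mul1r; lra.
(* Chosen so that the distance of the exponent to 1/2, at most [(1 + 2p) / (4 b2)], is at most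
   [e k]. *)
pose b2 k : R := (1 + 2 * p) * k.+1%:R / 4.
have p1 : 0 < 1 + 2 * p by lra.
have b20 k : 0 < b2 k by rewrite divr_gt0// mulr_gt0.
have gap2 k : 2^-1 - e k <= b2 k / (1 + 2 * b2 k + 2 * p).
  have x1 := gexb _ (ltW (b20 k)); rewrite lerBlDr -lerBlDl.
  have -> : 2^-1 - b2 k / (1 + 2 * b2 k + 2 * p) = (1 + 2 * p) / (2 * (1 + 2 * b2 k + 2 * p)).
    by field; rewrite gt_eqF//; lra.
  have -> : e k = (1 + 2 * p) / (4 * b2 k).
    by rewrite /e /b2; field; rewrite !gt_eqF.
  apply: ler_wpM2l; first exact: ltW.
  rewrite lef_pV2 ?posrE; [lra|lra|].
  by rewrite mulr_gt0.
have /choice[N1 hN1] k := contraction_near hp hC hkappa hZ hW (b10 k) (b1b k) R2 (e0 k).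
(* The squared Sobolev radius of the analytic ball at smoothness [b2 k + 1]. It grows with [k],
   which only delays the threshold [N2 k]. *)
pose S2 k := expR (2 * (b2 k + 1) ^+ 2 / gamma) * Rad ^+ 2.
have S20 k : 0 <= S2 k by rewrite mulr_ge0 ?expR_ge0.
have b2b k : b2 k < b2 k + 1 by rewrite ltrDl.
have /choice[N2 hN2] k := contraction_near hp hC hkappa hZ hW (b20 k) (b2b k) (S20 k) (e0 k).
have [kk [kkoo [n1 hn1]]] := diagonal_index (fun k => maxn (N1 k) (N2 k)).
(* [n^(e k)] is the price of replacing the exponent of the class by that of [b1 k] or [b2 k]; one
   factor serves both classes. *)
exists (fun n => n%:R `^ e (kk n)); split; first exact: slowly_varying_powR.
move=> alphahat hsel M hM.
have ev (eps : R) : 0 < eps -> exists n0, forall n, (n0 <= n)%N ->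
    [/\ (N1 (kk n) <= n)%N, (N2 (kk n) <= n)%N, e (kk n) <= eps, 1 <= M n &
        expR 1 <= n%:R :> R].
  move=> eps0; have [n2 hn2] := kkoo (Num.truncn eps^-1).
  have [n3 _ hn3] : \forall n \near \oo, 1 <= M n by exact: (cvgry_ge hM).
  have [n4 hn4] := near_powR_ge (expR 1) (@ltr01 R).
  exists (maxn (maxn n1 n2) (maxn n3 n4)) => n.
  rewrite !geq_max => /andP[/andP[a1 a2] /andP[a3 a4]].
  have := hn1 n a1; rewrite geq_max => /andP[c1 c2]; split => //.
  - rewrite /e -[leRHS]invrK lef_pV2 ?posrE ?invr_gt0//.
    apply: ltW; apply: (@lt_le_trans _ _ (Num.truncn eps^-1).+1%:R).
      have i0 : 0 <= eps^-1 by rewrite invr_ge0 ltW.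
      by have /andP[] := truncn_itv i0.
    by rewrite ler_nat ltnS hn2.
  - exact: hn3.
  - by have := hn4 n a4; rewrite powRr1.
split=> eps eps0; have [n0 hn0] := ev eps eps0; exists n0 => // n /= nn0 mu hmu;
  have [c1 c2 c3 c4 c5] := hn0 n nn0.
- have fin : (sqnorm mu < +oo)%E.
    apply: le_lt_trans (sqnorm_le_sob mu (ltW hbeta)) _.
    by apply: le_lt_trans hmu _; rewrite ltry.
  have [_ hae] := hsel n mu fin.
  have x1 : 1 <= n%:R :> R by apply: le_trans c5; rewrite -[leLHS]expR0 ler_expR.
  have x0 : 0 < n%:R :> R by lra.
  apply: (le_trans (hN1 (kk n) n c1 mu _ _ (sob_partial_le hmu) hae _)).
    rewrite -mulrA -[leLHS]mul1r; apply: ler_pM => //.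
    rewrite -powRD_gt0//; apply: ler_powR => //.
    by have := gap1 (kk n); lra.
  by rewrite lee_fin.
- have fin : (sqnorm mu < +oo)%E by exact: sqnorm_ana_lty hgamma hmu.
  have [_ hae] := hsel n mu fin.
  have x1 : 1 <= n%:R :> R by apply: le_trans c5; rewrite -[leLHS]expR0 ler_expR.
  have x0 : 0 < n%:R :> R by lra.
  have b21 : 0 <= b2 (kk n) + 1 by have := b20 (kk n); lra.
  have hS := ana_partial_le b21 hgamma hmu.
  apply: (le_trans (hN2 (kk n) n c2 mu _ _ hS hae _)).
    have l1 : 1 <= ln n%:R :> R.
      by rewrite -[leLHS]expRK ler_ln ?posrE ?expR_gt0.
    have l2 : 1 <= ln n%:R `^ (2^-1 + p) :> R.
      rewrite -[leLHS](powRr0 (ln n%:R : R)); apply: ler_powR => //.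
      by rewrite addr_ge0// invr_ge0.
    have m0 : 0 <= M n * ln n%:R `^ (2^-1 + p).
      by rewrite mulr_ge0 ?powR_ge0//; lra.
    have -> : M n * n%:R `^ e (kk n) * ln n%:R `^ (2^-1 + p) * n%:R `^ (- 2^-1) =
       (M n * ln n%:R `^ (2^-1 + p)) * (n%:R `^ e (kk n) * n%:R `^ (- 2^-1)) by ring.
    rewrite -[leLHS]mul1r; apply: ler_pM => //.
      by rewrite -[leLHS]mul1r; apply: ler_pM.
    rewrite -powRD_gt0//; apply: ler_powR => //.
    by have := gap2 (kk n); lra.
  by rewrite lee_fin.
Qed.
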